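(* Let $J\subseteq I$, $\nu\in\Lambda_J^\vee$, $\Psi^J\in\mathfrak r^J$, and let $W$ be a $U_q^\nu(\mathfrak g_J)$-module of highest $\ell$-weight $\Psi^J$. Let $\mu\in\Lambda^\vee$ satisfy $\mathrm{res}_J(\mu)=\nu$ and let $V$ be an object of $\mathcal O^\mu$. (1) Suppose that $\mathrm{res}_J^\mu(V)\simeq W$ in $\mathcal O_J^\nu$. Then $V$ is a $J$-inflation of $W$ to $\mathfrak g$ if and only if $\overline{\chi}(V)=\varpi(\iota_J)(\overline{\chi}(W))$. (2) Suppose that $W$ is simple. Then $V$ is a $J$-inflation of $W$ to $\mathfrak g$ if and only if $\chi_q(V)=\iota_J(\overline{\chi_q}(W))\,[\Psi^J\Psi_p]$ for some $J$-trivial $\Psi_p\in\mathfrak r_{\mu-\nu}$.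
   Context: Setup. Everything is over $\mathbb C$; $\mathbb N=\mathbb Z_{\ge 0}$. $\mathfrak g$ is a finite-dimensional simple Lie algebra with Dynkin index set $I=\{1,\dots,n\}$ and Cartan matrix $C=(C_{i,j})_{i,j\in I}$; $d_1,\dots,d_n$ are the relatively prime positive integers such that $(d_iC_{i,j})$ is symmetric. $\alpha_i,\omega_i,\omega_i^\vee$ are the simple roots, fundamental weights and fundamental coweights (so $\alpha_i(\omega_j^\vee)=\delta_{i,j}$ and $\alpha_i=\sum_jC_{j,i}\omega_j$), and $\Lambda^\vee=\bigoplus_{i\in I}\mathbb Z\omega_i^\vee$. $q\in\mathbb C^\times$ is not a root of unity and $q_i=q^{d_i}$. For $J\subseteq I$, $\mathfrak g_J$ is the semisimple Lie algebra with Cartan matrix $(C_{i,j})_{i,j\in J}$, $Q_J^+=\bigoplus_{j\in J}\mathbb N\alpha_j$, $\Lambda_J^\vee=\bigoplus_{j\in J}\mathbb Z\omega_j^\vee\subseteq\Lambda^\vee$, and $\mathrm{res}_J:\Lambda^\vee\to\Lambda_J^\vee$ is the projection. Algebras. For $J\subseteq I$ and $\nu\in\Lambda_J^\vee$, $U_q^\nu(\mathfrak g_J)$ is the unital algebra generated by $x_{i,r}^\pm,\phi_{i,r}^\pm$ ($i\in J$, $r\in\mathbb Z$), with $\phi_{i,0}^+$ and $\phi^-_{i,\alpha_i(\nu)}$ invertible, and relations (for $i,j\in J$, $r,s\in\mathbb Z$, $m\in\mathbb Z\setminus\{0\}$): all the $\phi^{\pm}_{i,r}$ commute with each other; $\phi_{i,0}^+x_{j,r}^\pm=q_i^{\pm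 C_{i,j}}x_{j,r}^\pm\phi_{i,0}^+$; $\phi_{i,\alpha_i(\nu)}^-x_{j,r}^\pm=q_i^{\mp C_{i,j}}x_{j,r}^\pm\phi_{i,\alpha_i(\nu)}^-$; $[h_{i,m},x_{j,r}^\pm]=\pm\frac1m[mC_{i,j}]_{q_i}x_{j,m+r}^\pm$; $(q_i-q_i^{-1})[x_{i,r}^+,x_{j,s}^-]=\delta_{i,j}(\phi_{i,r+s}^+-\phi_{j,r+s}^-)$; $x_{i,r+1}^\pm x_{j,s}^\pm-q_i^{\pm C_{i,j}}x_{j,s}^\pm x_{i,r+1}^\pm=q_i^{\pm C_{i,j}}x_{i,r}^\pm x_{j,s+1}^\pm-x_{j,s+1}^\pm x_{i,r}^\pm$; and, for $i\ne j$, $p=1-C_{i,j}$ and $r',r_1,\dots,r_p\in\mathbb Z$, $\sum_{\pi\in\Sigma_p}\sum_{\ell=0}^p(-1)^\ell\frac{[p]_{q_i}!}{[\ell]_{q_i}![p-\ell]_{q_i}!}x^\pm_{i,r_{\pi(1)}}\cdots x^\pm_{i,r_{\pi(\ell)}}x^\pm_{j,r'}x^\pm_{i,r_{\pi(\ell+1)}}\cdots x^\pm_{i,r_{\pi(p)}}=0$. Here $[m]_x=\frac{x^m-x^{-m}}{x-x^{-1}}$, $[m]_x!=\prod_{r=1}^m[r]_x$, and the $h_{i,m}$ are defined by $\sum_{r\in\mathbb Z}\phi^\pm_{i,\pm r}z^{\pm r}=z^{\nu(i,\pm)}\phi^\pm_{i,\nu(i,\pm)}\exp\big(\pm(q_i-q_i^{-1})\sum_{m>0}h_{i,\pm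 m}z^{\pm m}\big)$ with $\nu(i,+)=0$, $\nu(i,-)=\alpha_i(\nu)$ (so $\phi_{i,r}^+=0$ for $r<0$ and $\phi_{i,r}^-=0$ for $r>\alpha_i(\nu)$). Currents: $x_i^\pm(z)=\sum_{r}x_{i,r}^\pm z^r$, $\phi_i^\pm(z)=\sum_r\phi_{i,r}^\pm z^r$. For $J=I$ this is the shifted quantum affine algebra $U_q^\mu(\mathfrak g)$, $\mu\in\Lambda^\vee$. If $\mathrm{res}_J(\mu)=\nu$, identifying generators with the same name gives an embedding $U_q^\nu(\mathfrak g_J)\hookrightarrow U_q^\mu(\mathfrak g)$, and $\mathrm{res}_J^\mu$ denotes the corresponding restriction functor. Category $\mathcal O$. Let $\mathfrak t_J^\times=(\mathbb C^\times)^J$, $\mathfrak t^\times=\mathfrak t_I^\times$. For $\alpha=\sum_i a_i\alpha_i$ let $[\alpha]=\big(\prod_{i}q_j^{a_iC_{j,i}}\big)_{j\in I}\in\mathfrak t^\times$, and let $\mathrm{res}_J:\mathfrak t^\times\to\mathfrak t_J^\times$ be the projection. $\mathfrak t_J^\times$ is ordered by $\gamma\le\gamma'$ iff $\gamma'\gamma^{-1}\in\mathrm{res}_J([Q_J^+])$. For a $U_q^\nu(\mathfrak g_J)$-module $V$ and $\gamma\in\mathfrak t_J^\times$ let $V_\gamma=V_\gamma^+=\{v:\phi_{i,0}^+v=\gamma_iv\ \forall i\in J\}$, $V_\gamma^-=\{v:\phi_{i,\alpha_i(\nu)}^-v=\gamma_i^{-1}v\ \forall i\in J\}$, $P(V)=\{\gamma:V_\gamma\ne0\}$,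 $P^-(V)=\{\gamma:V_\gamma^-\neq0\}$. $\mathcal O_J^\nu$ is the full subcategory of $U_q^\nu(\mathfrak g_J)$-modules $V$ with $V=\bigoplus_\gamma V_\gamma=\bigoplus_\gamma V_\gamma^-$, $\dim V_\gamma^\pm<\infty$ for all $\gamma$, and $P(V)\cup P^-(V)\subseteq\bigcup_{i=1}^s\{\gamma:\gamma\le\lambda_i\}$ for some $\lambda_1,\dots,\lambda_s\in\mathfrak t_J^\times$. $\mathcal O^\mu=\mathcal O_I^\mu$. $\ell$-weights. $\mathfrak r^J$ is the multiplicative group of tuples $\Psi=(\Psi_j(z))_{j\in J}$ of rational functions regular and nonzero at $z=0$; $\mathfrak r^J_\nu\subseteq\mathfrak r^J$ consists of those with $\deg\Psi_j=\alpha_j(\nu)$ for all $j$ (degree of numerator minus degree of denominator); $\mathfrak r=\mathfrak r^I$, $\mathfrak r_\mu=\mathfrak r^I_\mu$. $\varpi(\Psi)=(\Psi_j(0))_j$. $\mathrm{res}_J:\mathfrak r\to\mathfrak r^J$ forgets the components outside $J$; $\mathfrak r^J$ is viewed inside $\mathfrak r$ by setting the components outside $J$ equal to $1$. $\Psi\in\mathfrak r$ is $J$-trivial if $\Psi_j(z)=1$ for all $j\in J$. For $V$ in $\mathcal O_J^\nu$, $V_\Psi=\{v:\exists p,\ (\phi_{j,r}^+-\Psi_{j,r}^+)^pv=0\ \forall j\in J,r\ge0\}$ where $\Psi_j(z)=\sum_{r\ge0}\Psi_{j,r}^+z^r$; $\Psi$ is an $\ell$-weight of $V$ if $V_\Psi\ne0$.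 An object $V$ of $\mathcal O_J^\nu$ has highest $\ell$-weight $\Psi$ if it is generated by some $v\ne0$ with $x_j^+(z)v=0$ and $\phi_j^\pm(z)v=\Psi_j(z)v$ for all $j\in J$ ($\Psi_j$ expanded at $z=0$ for $+$, at $z=\infty$ for $-$). Characters. $\chi_q(V)=\sum_\Psi\dim V_\Psi[\Psi]$ and $\chi(V)=\sum_\gamma\dim V_\gamma[\gamma]$ (formal sums, multiplied by convolution, $[\Psi][\Psi']=[\Psi\Psi']$). If $V$ has a unique $\ell$-weight $\Psi$ whose weight $\varpi(\Psi)$ is maximal in $P(V)$, put $\overline{\chi_q}(V)=[\Psi^{-1}]\chi_q(V)$ and $\overline\chi(V)=[\varpi(\Psi)^{-1}]\chi(V)$; an equality involving $\overline\chi(V)$ includes the assertion that it is defined. For $i\in I,a\in\mathbb C^\times$, $Y_{i,a}\in\mathfrak r$ has $i$-th component $q_i\frac{1-azq_i^{-1}}{1-azq_i}$ and other components $1$, and $A_{i,a}=Y_{i,aq_i^{-1}}Y_{i,aq_i}\Big(\prod_{C_{j,i}=-1}Y_{j,a}\prod_{C_{j,i}=-2}Y_{j,aq^{-1}}Y_{j,aq}\prod_{C_{j,i}=-3}Y_{j,aq^{-2}}Y_{j,a}Y_{j,aq^2}\Big)^{-1}$. If $W$ is simple, $\overline{\chi_q}(W)\in\mathbb Z[[\mathrm{res}_J(A_{j,a}^{-1})]]_{j\in J,a\in\mathbb C^\times}$. $\iota_J:\mathbb Z[[\mathrm{res}_J(A_{j,a}^{-1})]]_{j\in J,a}\to\mathbb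 Z[[A_{i,a}^{-1}]]_{i\in I,a}$ is the injective ring morphism with $\mathrm{res}_J(A_{j,a}^{-1})\mapsto A_{j,a}^{-1}$, and $\varpi(\iota_J):\mathbb Z[[\mathrm{res}_J([-\alpha_j])]]_{j\in J}\to\mathbb Z[[[-\alpha_i]]]_{i\in I}$ the injective ring morphism with $\mathrm{res}_J([-\alpha_j])\mapsto[-\alpha_j]$. Inflation. Let $W$ be an object of $\mathcal O_J^\nu$, $\mathrm{res}_J(\mu)=\nu$ and $V$ an object of $\mathcal O^\mu$. $V$ is a $J$-inflation of $W$ to $\mathfrak g$ (with coweight $\mu$) if (i) $\mathrm{res}_J^\mu(V)\simeq W$ as $U_q^\nu(\mathfrak g_J)$-modules and (ii) $x_i^\pm(z) V=0$ for all $i\in I\setminus J$. *)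

(* Defs.v *)
From HB Require Import structures.
From mathcomp Require Import all_boot all_order all_algebra perm.
From mathcomp Require Import boolp reals complex.
From mathcomp Require classical_sets.

Set Implicit Arguments.
Unset Strict Implicit.
Unset Printing Implicit Defensive.

Import Order.TTheory GRing.Theory Num.Theory.
Local Open Scope ring_scope.

(* Throughout, a boolean [e] stands for a sign: [true] is +, [false] is -. *)
Definition sg (e : bool) : int := if e then 1 else -1.

Notation sub J := {j | j \in J}.
Notation ratfun F := {fraction {poly F}}.

(** * Tuples indexed by I or by a subset J of I *)

Definition res (I : finType) (J : {set I}) (T : Type) (f : {ffun I -> T}) :
  {ffun sub J -> T} := [ffun j => f (val j)].

(* x0 is the value given to the components outside J *)
Definition ext (I : finType) (J : {set I}) (T : Type) (x0 : T)
  (f : {ffun sub J -> T}) : {ffun I -> T} := [ffun i => oapp f x0 (insub i)].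

Definition tmul (K : finType) (T : fieldType) (f g : {ffun K -> T}) :
  {ffun K -> T} := [ffun k => f k * g k].

Definition tinv (K : finType) (T : fieldType) (f : {ffun K -> T}) :
  {ffun K -> T} := [ffun k => (f k)^-1].

(** * Cartan data *)

Record datum (F : fieldType) (K : finType) := Datum {
  cart : K -> K -> int;
  dsym : K -> nat;
  qpar : F
}.

Definition qi (F : fieldType) (K : finType) (D : datum F K) (i : K) : F :=
  qpar D ^+ dsym D i.

Definition resD (F : fieldType) (I : finType) (J : {set I}) (D : datum F I) :
  datum F (sub J) :=
  Datum (fun i j => cart D (val i) (val j)) (fun i => dsym D (val i)) (qpar D).

(* [cart D] is the Cartan matrix of a finite-dimensional complex simple Lie
   algebra, i.e. an indecomposable Cartan matrix of finite type, and [dsym D]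
   is its relatively prime symmetrizer.  Positivity of the symmetrized integral
   form on integral vectors is equivalent to its positivity on real vectors. *)
Record simple_datum (F : fieldType) (K : finType) (D : datum F K) : Prop := {
  sd_nonempty : (0 < #|K|)%N;
  sd_diag : forall i, cart D i i = 2;
  sd_offdiag : forall i j, i != j -> cart D i j <= 0;
  sd_dpos : forall i, (0 < dsym D i)%N;
  sd_dcoprime : \big[gcdn/0%N]_i dsym D i = 1%N;
  sd_dsym : forall i j,
    (dsym D i)%:Z * cart D i j = (dsym D j)%:Z * cart D j i;
  sd_posdef : forall x : K -> int, (exists i, x i != 0) ->
    0 < \sum_i \sum_j x i * ((dsym D i)%:Z * cart D i j) * x j;
  sd_indec : forall S : {set K}, S != set0 ->
    (forall i j, i \in S -> j \notin S -> cart D i j = 0) -> S = setT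
}.

Definition not_root_of_unity (F : fieldType) (q : F) : Prop :=
  forall m : nat, (0 < m)%N -> q ^+ m != 1.

Definition qint (F : fieldType) (x : F) (m : int) : F :=
  (x ^ m - x ^ (- m)) / (x - x^-1).

Definition qfact (F : fieldType) (x : F) (m : nat) : F :=
  \prod_(1 <= r < m.+1) qint x r%:Z.

(** * Formal power series with coefficients in operators *)

Section OpSeries.
Variables (F : fieldType) (V : lmodType F).
Implicit Types f g : nat -> V -> V.

Definition ops_one (r : nat) (v : V) : V := if r == 0%N then v else 0.

Definition ops_mul f g (r : nat) (v : V) : V :=
  \sum_(k < r.+1) f k (g (r - k)%N v).

(* The exponential of a series [f] with [f 0 = 0]: the coefficient of z^r only
   receives contributions from the powers f^k with k <= r. *)
Definition ops_exp f (r : nat) (v : V) : V :=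
  \sum_(k < r.+1) (k`!%:R)^-1 *: iter k (ops_mul f) ops_one r v.

End OpSeries.

(** * Modules over shifted quantum affine algebras *)

Section Relations.
Variables (F : fieldType) (K : finType) (D : datum F K).
Variable nu : {ffun K -> int}.   (* the coweight \sum_i nu_i \omega_i^\vee *)

(* \nu(i,+) = 0 and \nu(i,-) = \alpha_i(\nu) *)
Definition lead (e : bool) (i : K) : int := if e then 0 else nu i.

Section Ops.
Variable V : lmodType F.
Variables x phi : bool -> K -> int -> V -> V.

(* The series \pm (q_i - q_i^{-1}) \sum_{m > 0} h_{i, \pm m} z^{\pm m} *)
Definition hseries (h : K -> int -> V -> V) (e : bool) (i : K) (m : nat)
  (v : V) : V :=
  if m == 0%N then 0
  else ((sg e)%:~R * (qi D i - (qi D i)^-1)) *: h i (sg e * m%:Z) v.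

Record is_h (h : K -> int -> V -> V) : Prop := {
  h_exp : forall e i (r : nat) v,
    phi e i (lead e i + sg e * r%:Z) v
    = phi e i (lead e i) (ops_exp (hseries h e i) r v);
  h_x : forall i j (m r : int) e v, m != 0 ->
    h i m (x e j r v) - x e j r (h i m v)
    = ((sg e)%:~R * m%:~R^-1 * qint (qi D i) (m * cart D i j))
      *: x e j (m + r) v
}.

(* x_{i,s_1} ... x_{i,s_l} x_{j,r'} x_{i,s_{l+1}} ... x_{i,s_p} *)
Definition serre_word (e : bool) (i j : K) (s : seq int) (l : nat) (r' : int)
  (v : V) : V :=
  foldr (x e i) (x e j r' (foldr (x e i) v (drop l s))) (take l s).

Record relations : Prop := {
  rel_phi_inv : forall e i, bijective (phi e i (lead e i));
  rel_phi_comm : forall e e' i j r s v,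
    phi e i r (phi e' j s v) = phi e' j s (phi e i r v);
  rel_phi_x : forall e e' i j r v,
    phi e i (lead e i) (x e' j r v)
    = qi D i ^ (sg e * sg e' * cart D i j) *: x e' j r (phi e i (lead e i) v);
  rel_phi_pos0 : forall i r v, r < 0 -> phi true i r v = 0;
  rel_phi_neg0 : forall i r v, nu i < r -> phi false i r v = 0;
  (* the h_{i,m} are determined by the phi's *)
  rel_h : exists h : K -> int -> V -> V, is_h h;
  rel_xpxm : forall i j r s v,
    (qi D i - (qi D i)^-1)
      *: (x true i r (x false j s v) - x false j s (x true i r v))
    = if i == j then phi true i (r + s) v - phi false j (r + s) v else 0;
  rel_xx : forall e i j r s v,
    x e i (r + 1) (x e j s v)
    - qi D i ^ (sg e * cart D i j) *: x e j s (x e i (r + 1) v)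
    = qi D i ^ (sg e * cart D i j) *: x e i r (x e j (s + 1) v)
      - x e j (s + 1) (x e i r v);
  rel_serre : forall e i j, i != j ->
    forall p : nat, p%:Z = 1 - cart D i j ->
    forall (r' : int) (r : 'I_p -> int) (v : V),
      \sum_(s : 'S_p) \sum_(l < p.+1)
        ((-1) ^+ l * (qfact (qi D i) p
                      / (qfact (qi D i) l * qfact (qi D i) (p - l))))
        *: serre_word e i j [seq r (s k) | k <- enum 'I_p] l r' v = 0
}.

End Ops.

(* A module over U_q^\nu: a vector space on which the generators act by linear
   maps satisfying the defining relations. *)
Record qmodule := QModule {
  mspace :> lmodType F;
  mx : bool -> K -> int -> {linear mspace -> mspace};
  mphi : bool -> K -> int -> {linear mspace -> mspace};
  mrel : relations mx mphi
}.

End Relations.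

Section Modules.
Variables (F : fieldType) (K : finType) (D : datum F K).

(* The comparison ignores the shifts, which are part of the types only. *)
Definition mod_iso (nu nu' : {ffun K -> int}) (V : qmodule D nu)
  (W : qmodule D nu') : Prop :=
  exists f : {linear V -> W},
    [/\ bijective f,
        forall e i r v, f (mx V e i r v) = mx W e i r (f v)
      & forall e i r v, f (mphi V e i r v) = mphi W e i r (f v)].

Variables (nu : {ffun K -> int}) (V : qmodule D nu).

(* [sm_inv] is stability under the inverses of \phi^+_{i,0} and
   \phi^-_{i,\alpha_i(\nu)}, which belong to the algebra. *)
Record submodule (S : V -> Prop) : Prop := {
  sm_0 : S 0;
  sm_add : forall u v, S u -> S v -> S (u + v);
  sm_scale : forall (a : F) v, S v -> S (a *: v);
  sm_x : forall e i r v, S v -> S (mx V e i r v);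
  sm_phi : forall e i r v, S v -> S (mphi V e i r v);
  sm_inv : forall e i v, S (mphi V e i (lead nu e i) v) -> S v
}.

Definition generated_by (v : V) : Prop :=
  forall S : V -> Prop, submodule S -> S v -> forall w, S w.

Definition simple_module : Prop :=
  (exists v : V, v != 0) /\
  forall S : V -> Prop, submodule S ->
    (forall v, S v -> v = 0) \/ (forall v, S v).

End Modules.

(** * The restriction functor *)

Section Restriction.
Variables (F : fieldType) (I : finType) (J : {set I}) (D : datum F I).
Variables (mu : {ffun I -> int}) (nu : {ffun sub J -> int}).
Hypothesis munu : res J mu = nu.

Lemma res_mod_rel (V : qmodule D mu) :
  relations (resD J D) nu (fun e (j : sub J) => mx V e (val j))
    (fun e (j : sub J) => mphi V e (val j)).
Proof.
have El e (j : sub J) : lead nu e j = lead mu e (val j).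
  by rewrite /lead -munu ffunE.
case: (mrel V) => Hinv Hcomm Hpx Hp0 Hm0 [h [h1 h2]] Hxx Hqu Hse.
split.
- by move=> e i; rewrite El; exact: Hinv.
- by move=> *; exact: Hcomm.
- by move=> e e' i j r v; rewrite El; exact: Hpx.
- by move=> *; exact: Hp0.
- by move=> i r v; rewrite -munu ffunE => /Hm0.
- exists (fun j : sub J => h (val j)); split.
    by move=> e i r v; rewrite El; exact: h1.
  by move=> i j m r e v m0; exact: h2.
- by move=> i j r s v; rewrite -val_eqE; exact: Hxx.
- by move=> *; exact: Hqu.
- by move=> e i j ij p pE r' r v; apply: Hse => //; rewrite val_eqE.
Qed.

Definition res_mod (V : qmodule D mu) : qmodule (resD J D) nu :=
  QModule (res_mod_rel V).

End Restriction.

(** * Dimensions of subspaces of possibly infinite-dimensional spaces *)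

Section Dim.
Variables (F : fieldType) (V : lmodType F).

Definition has_dim (S : V -> Prop) (n : nat) : Prop :=
  exists b : 'I_n -> V,
    [/\ forall i, S (b i),
        forall c : 'I_n -> F, \sum_i c i *: b i = 0 -> forall i, c i = 0
      & forall v, S v -> exists c : 'I_n -> F, v = \sum_i c i *: b i].

(* meaningful only for finite-dimensional subspaces *)
Definition dim (S : V -> Prop) : nat := classical_sets.xget 0%N (has_dim S).

End Dim.

(** * Category O *)

Section CategoryO.
Variables (F : fieldType) (K : finType) (D : datum F K).
Local Notation weight := {ffun K -> F}.

Definition in_t (g : weight) : Prop := forall j, g j != 0.

(* the tuple attached to the root lattice element \sum_i a_i \alpha_i *)
Definition rootw (a : K -> int) : weight :=
  [ffun j => \prod_i qi D j ^ (a i * cart D j i)].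

Definition wle (g g' : weight) : Prop :=
  exists a : K -> nat, tmul g' (tinv g) = rootw (fun i => (a i)%:Z).

Variables (nu : {ffun K -> int}) (V : qmodule D nu).

Definition wspace (e : bool) (g : weight) (v : V) : Prop :=
  forall i, mphi V e i (lead nu e i) v = g i ^ sg e *: v.

Definition in_P (e : bool) (g : weight) : Prop :=
  in_t g /\ exists2 v : V, v != 0 & wspace e g v.

Definition weight_decomposition (e : bool) : Prop :=
  (forall v : V, exists (s : seq weight) (f : weight -> V),
      (forall g, g \in s -> in_t g /\ wspace e g (f g))
      /\ v = \sum_(g <- s) f g) /\
  (forall (s : seq weight) (f : weight -> V), uniq s ->
      (forall g, g \in s -> in_t g /\ wspace e g (f g)) ->
      \sum_(g <- s) f g = 0 -> forall g, g \in s -> f g = 0).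

Record in_O : Prop := {
  O_sum : forall e, weight_decomposition e;
  O_dim : forall e g, in_t g -> exists n, has_dim (@wspace e g) n;
  O_cone : exists s : seq weight, (forall l, l \in s -> in_t l) /\
    forall e g, in_P e g -> exists2 l, l \in s & wle g l
}.

End CategoryO.

(** * Rational functions and l-weights *)

Section Lweights.
Variable F : fieldType.
Local Notation "p %:F" := (@FracField.tofrac {poly F} p).

Definition regular_nonzero0 (f : ratfun F) : Prop :=
  exists p r : {poly F}, [/\ p.[0] != 0, r.[0] != 0 & f = p%:F / r%:F].

Definition has_degree (f : ratfun F) (m : int) : Prop :=
  exists p r : {poly F},
    [/\ p != 0, r != 0, f = p%:F / r%:F & m = (size p)%:Z - (size r)%:Z].

Definition value0 (f : ratfun F) : F :=
  classical_sets.xget 0 (fun y => exists p r : {poly F},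
    [/\ r.[0] != 0, f = p%:F / r%:F & y = p.[0] / r.[0]]).

(* [c] is the family of coefficients of the Laurent expansion of [f] at z = 0
   (e = true) or at z = \infty (e = false): writing f = p / r, the product of
   r and \sum_k c_k z^k is p. *)
Definition expansion (e : bool) (f : ratfun F) (c : int -> F) : Prop :=
  (exists N : int, forall k : int, (if e then k < N else N < k) -> c k = 0) /\
  exists p r : {poly F}, [/\ r != 0, f = p%:F / r%:F
    & forall k : int, \sum_(l < size r) r`_l * c (k - l%:Z)
                      = if k is Posz m then p`_m else 0].

Variable K : finType.
Local Notation lweight := {ffun K -> ratfun F}.

Definition in_r (Psi : lweight) : Prop := forall j, regular_nonzero0 (Psi j).

Definition in_r_deg (nu : {ffun K -> int}) (Psi : lweight) : Prop :=
  in_r Psi /\ forall j, has_degree (Psi j) (nu j).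

Definition varpi (Psi : lweight) : {ffun K -> F} :=
  [ffun j => value0 (Psi j)].

Variable D : datum F K.

Definition Y (i : K) (a : F) : lweight :=
  [ffun k => if k == i
             then (qi D i *: (1 - (a / qi D i) *: 'X))%:F
                  / (1 - (a * qi D i) *: 'X)%:F
             else 1].

Definition A (i : K) (a : F) : lweight :=
  let q := qpar D in
  [ffun k =>
    Y i (a / qi D i) k * Y i (a * qi D i) k
    / (\prod_(j | cart D j i == -1) Y j a k
       * \prod_(j | cart D j i == -2) (Y j (a / q) k * Y j (a * q) k)
       * \prod_(j | cart D j i == -3)
           (Y j (a / q ^+ 2) k * Y j a k * Y j (a * q ^+ 2) k))].

Variables (nu : {ffun K -> int}) (V : qmodule D nu).

Definition lspace (Psi : lweight) (v : V) : Prop :=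
  exists2 c : K -> int -> F, forall j, expansion true (Psi j) (c j)
  & exists p : nat, forall j (r : nat),
      iter p (fun w => mphi V true j r%:Z w - c j r%:Z *: w) v = 0.

Definition is_lweight (Psi : lweight) : Prop :=
  in_r Psi /\ exists2 v : V, v != 0 & lspace Psi v.

Definition highest_lweight (Psi : lweight) : Prop :=
  in_O V /\
  exists v : V, [/\ v != 0, generated_by v,
    forall j r, mx V true j r v = 0
  & forall e j, exists2 c, expansion e (Psi j) c
                         & forall r, mphi V e j r v = c r *: v].

End Lweights.

(** * Characters *)

Section FormalSums.
Variables (K : finType) (T : fieldType).
Local Notation G := {ffun K -> T}.

(* the product of the formal sum [f] with [g] *)
Definition shift (g : G) (f : G -> int) : G -> int :=
  fun t => f (tmul (tinv g) t).

(* the monomial \prod_{x <- m} u_x *)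
Definition mono (X : Type) (u : X -> G) (m : seq X) : G :=
  [ffun k => \prod_(x <- m) u x k].

End FormalSums.

(* For families [u], [w] of multiplicatively independent elements indexed by
   the same set: f \in Z[[u_x]]_x, g \in Z[[w_x]]_x and g is the image of f by
   the ring morphism u_x |-> w_x, i.e. f and g are supported on monomials and
   have the same coefficients on corresponding monomials. *)
Definition transport (X : Type) (K K' : finType) (T T' : fieldType)
  (u : X -> {ffun K -> T}) (w : X -> {ffun K' -> T'})
  (f : {ffun K -> T} -> int) (g : {ffun K' -> T'} -> int) : Prop :=
  [/\ forall t, f t != 0 -> exists m, t = mono u m,
      forall t, g t != 0 -> exists m, t = mono w m
    & forall m : seq X, f (mono u m) = g (mono w m)].

Section Characters.
Variables (F : fieldType) (K : finType) (D : datum F K).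
Variables (nu : {ffun K -> int}) (V : qmodule D nu).
Local Notation lweight := {ffun K -> ratfun F}.
Local Notation weight := {ffun K -> F}.

Definition chiq (Psi : lweight) : int :=
  if `[< in_r Psi >] then (dim (@lspace _ _ _ _ V Psi))%:Z else 0.

Definition chi (g : weight) : int :=
  if `[< in_t g >] then (dim (@wspace _ _ _ _ V true g))%:Z else 0.

Definition maximal_lweight (Psi : lweight) : Prop :=
  is_lweight V Psi /\
  (in_P V true (varpi Psi) /\
   forall g, in_P V true g -> wle D (varpi Psi) g -> g = varpi Psi).

Definition top_lweight (Psi : lweight) : Prop :=
  maximal_lweight Psi /\ forall Psi', maximal_lweight Psi' -> Psi' = Psi.

(* "\overline{\chi_q}(V) is defined and equal to f", and likewise for
   \overline{\chi} *)
Definition nchiq (f : lweight -> int) : Prop :=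
  exists2 Psi, top_lweight Psi & f =1 shift (tinv Psi) chiq.

Definition nchi (f : weight -> int) : Prop :=
  exists2 Psi, top_lweight Psi & f =1 shift (tinv (varpi Psi)) chi.

End Characters.

Section Inflation.
Variables (F : fieldType) (I : finType) (J : {set I}) (D : datum F I).

(* iota_J f g : f \in Z[[res_J(A_{j,a}^{-1})]] and g = \iota_J(f) *)
Definition iota_J (f : {ffun sub J -> ratfun F} -> int)
    (g : {ffun I -> ratfun F} -> int) : Prop :=
  let Ainv (x : sub J * {a : F | a != 0}) := tinv (A D (val x.1) (val x.2)) in
  transport (fun x => res J (Ainv x)) Ainv f g.

(* varpi_iota_J f g : f \in Z[[res_J([-\alpha_j])]] and g = \varpi(\iota_J)(f) *)
Definition varpi_iota_J (f : {ffun sub J -> F} -> int)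
    (g : {ffun I -> F} -> int) : Prop :=
  let aneg (j : sub J) := rootw D (fun i => - (i == val j)%:Z) in
  transport (fun j => res J (aneg j)) aneg f g.

Definition J_trivial (Psi : {ffun I -> ratfun F}) : Prop :=
  forall j, j \in J -> Psi j = 1.

Variables (mu : {ffun I -> int}) (nu : {ffun sub J -> int}).
Hypothesis munu : res J mu = nu.

(* V is a J-inflation of W *)
Definition is_inflation (V : qmodule D mu) (W : qmodule (resD J D) nu) : Prop :=
  [/\ in_O W, in_O V, mod_iso (res_mod munu V) W
    & forall i, i \notin J -> forall e r v, mx V e i r v = 0].

End Inflation.

(* Main.v *)
(* Let v be killed by the x_i^+ and a joint eigenvector of the phi's, of l-weight
   Psi. A span S of vectors x^-_{j_1,r_1} ... x^-_{j_k,r_k} v, with the j's fixed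
   and the r's varying, is a sum of spaces of l-weights Psi A_{j_1,a_1}^{-1} ...
   A_{j_k,a_k}^{-1}: if not, some linear form on S is an eigenvector of the phi's
   and kills all these spaces, and the exchange relation between phi_i(z) and
   x_j^-(z) shows by induction on k that its eigenvalue has this shape. This
   gives the direct implications, the monomials in the A's being independent.
   Conversely, either character formula puts the weights of V in a coset
   lambda - Q_J^+, and x_i^{+-} shifts weights by +-alpha_i, so it vanishes for i
   outside J. In (2), V has a vector v1 of l-weight
   Psi^J Psi_p, and the submodule of res_J(V) + W generated by (v1, w), where w
   generates W, is the graph of an isomorphism: it meets W trivially since W is
   simple, projects onto W, and l-weight spaces of V and W have equal
   dimensions. *)

From HB Require Import structures.
From mathcomp Require Import all_boot all_order all_algebra perm.
From mathcomp Require Import boolp reals complex zify ring lra.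
From mathcomp Require classical_sets.
Require Import Defs.

Set Implicit Arguments.
Unset Strict Implicit.
Unset Printing Implicit Defensive.

Import Order.TTheory GRing.Theory Num.Theory.
Local Open Scope ring_scope.

(** * Commuting families of operators *)

(** Restriction to J forgets the components outside J, so it might merge weights or l-weights of V.
    Dimensions can be compared because restriction is injective on lambda - Q_J^+, and on Psi times
    the monomials in the A_{j,a}^{-1} with j in J: C_J is nondegenerate by positivity of the form,
    and q is not a root of unity. Rationality of l-weights comes from finite-dimensional weight
    spaces, which force a linear recurrence linking phi^+ and phi^-; the same recurrence recovers
    phi^- from phi^+ on v1 in the converse of (2). The factor Psi_p collects the components of the
    highest l-weight outside J: there x_i^{+-} = 0 gives phi_i^+ = phi_i^- on the highest vector,
    hence a polynomial of degree exactly mu_i. The h_{i,m} are given as bare functions, so their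
    linearity and commutation are first extracted from the phi's. Across a multiple bond the
    definition of A_{j,a} shifts by powers of q instead of q_k; it matches the exchange factor
    because the shorter root k of such a bond has d_k = 1, a consequence of indecomposability and
    coprimality. *)

Section JointEigen.
Variables (F : closedFieldType) (n : nat) (kT : Type) (M : kT -> 'M[F]_n.+1).
Hypothesis Mcomm : forall k l, M k * M l = M l * M k.

(** Peeling off the linear factors one at a time, the last vector that is still outside [Z] is an
    eigenvector of [A] modulo [Z]. *)
Lemma split_eigen_mod (A Z U : 'M[F]_n.+1) (r : seq F) (u : 'rV[F]_n.+1) :
  (U *m A <= U)%MS -> (u <= U)%MS -> ~~ (u <= Z)%MS ->
  (u *m horner_mx A (\prod_(z <- r) ('X - z%:P)) <= Z)%MS ->
  exists z (w : 'rV[F]_n.+1),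
    [/\ (w <= U)%MS, ~~ (w <= Z)%MS & (w *m (A - z%:M) <= Z)%MS].
Proof.
move=> UA; elim: r u => [|z r IH] u uU uZ.
  by rewrite big_nil rmorph1 mulmx1 (negbTE uZ).
rewrite big_cons rmorphM /= rmorphB /= horner_mx_X horner_mx_C mulmxA.
case: (boolP (u *m (A - z%:M) <= Z)%MS) => [h _|h /(IH _ _ h)]; first by exists z, u.
apply; rewrite mulmxBr addmx_sub //.
  by apply: submx_trans (submxMr _ uU) UA.
by rewrite eqmx_opp mul_mx_scalar scalemx_sub.
Qed.

(** Induction on the rank of [U]: either every [M k] is a scalar on [U] modulo [Z], and any row of
    [U] outside [Z] serves, or some [M k] is not, and one of its eigenspaces modulo [Z] is a smaller
    stable subspace. Only the rank decreases, so the family may be infinite. *)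
Lemma joint_eigen_mod (Z U : 'M[F]_n.+1) :
  (forall k, (Z *m M k <= Z)%MS) -> (forall k, (U *m M k <= U)%MS) ->
  ~~ (U <= Z)%MS ->
  exists u : 'rV[F]_n.+1, [/\ (u <= U)%MS, ~~ (u <= Z)%MS
    & exists th : kT -> F, forall k, (u *m M k - th k *: u <= Z)%MS].
Proof.
move=> Zst; move: {2}(\rank U).+1 (ltnSn (\rank U)) => N.
elim: N U => // N IH U rU Ust UZ.
have [scal|/existsNP[k /forallNP nscal]] :=
  pselect (forall k, exists a, (U *m (M k - a%:M) <= Z)%MS).
  have [th thP] := choice scal.
  case/row_subPn: UZ => i uZ; have uU := row_sub i U.
  exists (row i U); split=> //; exists th => k.
  rewrite -mul_mx_scalar -mulmxBr.
  exact: submx_trans (submxMr _ uU) (thP k).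
case/row_subPn: (UZ) => i0 u0Z; have u0U := row_sub i0 U; move: (row i0 U) u0Z u0U => u0 u0Z u0U.
have [r rP] := closed_field_poly_normal (char_poly (M k)).
have lc0 : lead_coef (char_poly (M k)) = 1 by apply/monicP/char_poly_monic.
rewrite lc0 scale1r in rP.
have [|z [w [wU wZ wzZ]]] := split_eigen_mod (Ust k) u0U u0Z (r := r).
  by rewrite -rP Cayley_Hamilton mulmx0 sub0mx.
(* The vectors of [U] that [M k - z] sends into [Z]; multiplication by [cokermx Z] tests membership
   in [Z]. *)
pose U' := (U :&: kermx ((M k - z%:M) *m cokermx Z))%MS.
have inU' (v : 'rV_n.+1) :
    (v <= U')%MS = (v <= U)%MS && (v *m (M k - z%:M) <= Z)%MS.
  rewrite sub_capmx; congr andb; rewrite [RHS]submxE -mulmxA.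
  exact: (sameP sub_kermxP eqP).
have U'U : (U' < U)%MS.
  rewrite ltmxE capmxSl /=; apply/negP => UU'; apply: (nscal z).
  apply/rV_subP => v /submxP[y ->]; rewrite mulmxA.
  by have := submx_trans (submxMl y U) UU'; rewrite inU' => /andP[].
have [|l||u [uU' uZ thP]] := IH U'.
- by move: U'U; rewrite ltmxErank => /andP[_ h]; rewrite -ltnS; apply: leq_trans rU.
- apply/rV_subP => v /submxP[y ->]; rewrite mulmxA.
  have: (y *m U' <= U')%MS by apply: submxMl.
  rewrite !inU' => /andP[h1 h2]; apply/andP; split.
    exact: submx_trans (submxMr _ h1) (Ust l).
  have -> : y *m U' *m M l *m (M k - z%:M) = y *m U' *m (M k - z%:M) *m M l.
    rewrite -!mulmxA; congr (_ *m (_ *m _)); rewrite mulmxBl mulmxBr -scalar_mxC.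
    by have := Mcomm l k; rewrite /GRing.mul /= => ->.
  exact: submx_trans (submxMr _ h2) (Zst l).
- by apply/negP => U'Z; move/negP: wZ; apply; apply: submx_trans U'Z; rewrite inU' wU.
exists u; split=> //; exact: submx_trans uU' (capmxSl _ _).
Qed.

(** A subspace on which some [M k] has several eigenvalues is, by Bezout applied to two coprime
    factors of the characteristic polynomial, the sum of two stable subspaces of smaller rank. Where
    no such [k] exists, the exponent [n.+1] serves for the whole family at once. *)
Lemma joint_gen_eigen (Q : 'rV[F]_n.+1 -> Prop) :
  Q 0 -> (forall u v, Q u -> Q v -> Q (u + v)) ->
  (forall u, (exists (th : kT -> F) (p : nat),
     forall k, u *m (M k - (th k)%:M) ^+ p = 0) -> Q u) ->
  forall u, Q u.
Proof.
move=> Q0 QD Qg.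
suff gen (U : 'M[F]_n.+1) : (forall k, (U *m M k <= U)%MS) ->
    forall u : 'rV_n.+1, (u <= U)%MS -> Q u.
  by move=> u; apply: (gen 1%:M) (submx1 _) => k; apply: submx1.
move: {2}(\rank U).+1 (ltnSn (\rank U)) => N.
elim: N U => // N IH U rU Ust.
have [scal|/existsNP[k /forallNP nscal]] :=
  pselect (forall k, exists a, U *m (M k - a%:M) ^+ n.+1 = 0).
  have [th thP] := choice scal => u uU.
  apply: Qg; exists th, n.+1 => k; case/submxP: uU => y ->.
  by rewrite -mulmxA thP mulmx0.
have U0 : ~~ (U <= (0 : 'M_n.+1))%MS.
  by apply/negP; rewrite submx0 => /eqP U0; apply: (nscal 0); rewrite U0 mul0mx.
(* The eigenvector is taken inside [U], so that [a] is an eigenvalue of [M k] on [U] itself; this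
   makes the piece [U *m A ^+ m] proper. *)
have [|w [wU w0 [th thP]]] := @joint_eigen_mod 0 U _ Ust U0.
  by move=> l; rewrite mul0mx sub0mx.
set a := th k; have wk : w *m M k = a *: w.
  by have := thP k; rewrite submx0 subr_eq0 => /eqP.
have [m [q]] := multiplicity_XsubC (char_poly (M k)) a.
have cp0 : char_poly (M k) != 0 by rewrite monic_neq0 ?char_poly_monic.
rewrite cp0 /= => qa cpE.
have q0 : q != 0 by apply: contraNneq cp0 => q0; rewrite cpE q0 mul0r.
have mn : (m <= n.+1)%N.
  have := size_char_poly (M k); rewrite cpE size_Mmonic // ?monic_exp ?monicXsubC //.
  rewrite size_exp_XsubC; have := size_poly_gt0 q; rewrite q0; lia.
have cop : coprimep q (('X - a%:P) ^+ m).
  by rewrite coprimep_expr // coprimep_XsubC.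
have [[s t] /= st1] := Bezout_eq1_coprimepP _ _ cop.
pose A := M k - a%:M; pose G := horner_mx (M k) q.
have AE : horner_mx (M k) (('X - a%:P) ^+ m) = A ^+ m.
  by rewrite rmorphXn /= rmorphB /= horner_mx_X horner_mx_C.
have GA : G * A ^+ m = 0.
  by have := Cayley_Hamilton (M k); rewrite cpE rmorphM /= AE.
have comG l : G * M l = M l * G by apply/esym/comm_mx_horner/Mcomm.
have comA l : A ^+ m * M l = M l * A ^+ m.
  apply/esym/commrX; rewrite /A; apply: commrB; first exact: Mcomm.
  by rewrite /GRing.comm /GRing.mul /= scalar_mxC.
have stab (B : 'M[F]_n.+1) : (forall l, B * M l = M l * B) ->
    forall l, (U *m B *m M l <= U *m B)%MS.
  move=> cB l; have := cB l; rewrite /GRing.mul /= -mulmxA => ->.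
  by rewrite mulmxA submxMr.
have hst (p : {poly F}) (v : 'rV[F]_n.+1) : (v <= U)%MS -> (v *m horner_mx (M k) p <= U)%MS.
  move=> vU; apply: submx_trans (submxMr _ vU) _.
  by apply: (horner_mx_stable p); exact: Ust.
have sub1 : (U *m G <= U)%MS.
  apply/rV_subP => v /submxP[y ->]; rewrite mulmxA; apply: hst; exact: submxMl.
have sub2 : (U *m A ^+ m <= U)%MS.
  by apply/rV_subP => v /submxP[y ->]; rewrite mulmxA -AE; apply: hst; exact: submxMl.
have strict (B C : 'M[F]_n.+1) : (U *m B <= U)%MS -> B * C = 0 -> U *m C != 0 ->
    (\rank (U *m B) < N)%N.
  move=> UB BC UC; rewrite -ltnS; apply: leq_trans rU; rewrite ltnS.
  suff: (U *m B < U)%MS by rewrite ltmxErank => /andP[].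
  rewrite ltmxE UB /=; apply/negP => /submxP[y yE]; move/eqP: UC; apply.
  by rewrite yE -!mulmxA; rewrite /GRing.mul /= in BC; rewrite BC !mulmx0.
have r1 : (\rank (U *m G) < N)%N.
  apply: (strict _ (A ^+ m)) => //; apply/eqP => UA; apply: (nscal a).
  have -> : (M k - a%:M) ^+ n.+1 = A ^+ m * A ^+ (n.+1 - m) by rewrite -exprD subnKC.
  by rewrite /GRing.mul /= mulmxA UA mul0mx.
have r2 : (\rank (U *m A ^+ m) < N)%N.
  apply: (strict _ G) => //; first by have := Cayley_Hamilton (M k); rewrite cpE mulrC rmorphM /= AE.
  apply/eqP => UG; case/submxP: wU => y wE.
  have : w *m G = 0 by rewrite wE -mulmxA UG mulmx0.
  have -> : w *m G = q.[a] *: w.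
    rewrite /G; elim/poly_ind: (q) => [|p c IHp]; first by rewrite rmorph0 mulmx0 horner0 scale0r.
    rewrite rmorphD rmorphM /= horner_mx_X horner_mx_C mulmxDr mulmxA IHp hornerMXaddC.
    by rewrite -scalemxAl wk scalerA mul_mx_scalar -scalerDl.
  by move/eqP; rewrite scaler_eq0 -rootE (negbTE qa) /= => /eqP w00; rewrite w00 sub0mx in w0.
move=> u uU.
have -> : u = u *m horner_mx (M k) s *m G + u *m horner_mx (M k) t *m A ^+ m.
  rewrite -!mulmxA -mulmxDr -AE.
  suff -> : horner_mx (M k) s *m G + horner_mx (M k) t *m horner_mx (M k) (('X - a%:P) ^+ m) = 1%:M.
    by rewrite mulmx1.
  have := congr1 (horner_mx (M k)) st1; rewrite rmorphD !rmorphM rmorph1 /=.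
  by [].
apply: QD.
  by apply: (IH (U *m G) r1 (stab _ comG)); rewrite submxMr ?hst.
by apply: (IH (U *m A ^+ m) r2 (stab _ comA)); rewrite submxMr ?hst.
Qed.

End JointEigen.

(** * Subspaces and spans given by predicates *)

Section Sums.
Variables (F : fieldType) (V : lmodType F).
Implicit Types (S P Q : V -> Prop).

Record subspace S : Prop := Subspace {
  subspace0 : S 0;
  subspaceD : forall u v, S u -> S v -> S (u + v);
  subspaceZ : forall a v, S v -> S (a *: v)
}.

Lemma subspaceN S v : subspace S -> S v -> S (- v).
Proof. by move=> hS Sv; rewrite -scaleN1r; apply: subspaceZ. Qed.

Lemma subspaceB S u v : subspace S -> S u -> S v -> S (u - v).
Proof. by move=> hS Su Sv; apply: subspaceD => //; apply: subspaceN. Qed.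

Lemma subspace_sum S (I : Type) (r : seq I) (f : I -> V) :
  subspace S -> (forall i, S (f i)) -> S (\sum_(i <- r) f i).
Proof.
move=> hS hf; elim/big_rec: _ => [|i x _ Sx]; first exact: subspace0.
exact: subspaceD.
Qed.

(** For a [P] stable under scaling this is the linear span. [P] is typically a union of eigenspaces,
    and each summand keeps its own eigenvalue. *)
Inductive sums P : V -> Prop :=
| sums0 : sums P 0
| sumsS u v : P u -> sums P v -> sums P (u + v).

Lemma sums1 P u : P u -> sums P u.
Proof. by move=> Pu; rewrite -[u]addr0; apply: sumsS => //; apply: sums0. Qed.

Lemma sumsD P u v : sums P u -> sums P v -> sums P (u + v).
Proof.
move=> hu hv; elim: hu => [|w u' Pw _ IH]; first by rewrite add0r.
by rewrite -addrA; apply: sumsS.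
Qed.

Lemma sumsZ P a u : (forall a v, P v -> P (a *: v)) -> sums P u -> sums P (a *: u).
Proof.
move=> PZ; elim=> [|w u' Pw _ IH]; first by rewrite scaler0; apply: sums0.
by rewrite scalerDr; apply: sumsS => //; apply: PZ.
Qed.

Lemma sums_subspace P : (forall a v, P v -> P (a *: v)) -> subspace (sums P).
Proof. by move=> PZ; split; [exact: sums0|exact: sumsD|move=> a v; exact: sumsZ]. Qed.

Lemma sums_min P S : subspace S -> (forall v, P v -> S v) -> forall v, sums P v -> S v.
Proof.
move=> hS PS v; elim=> [|w u' Pw _ IH]; first exact: subspace0.
by apply: subspaceD => //; apply: PS.
Qed.

Lemma sums_mono P Q : (forall v, P v -> Q v) -> forall v, sums P v -> sums Q v.
Proof.
move=> PS v; elim=> [|w u' Pw _ IH]; first exact: sums0.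
by apply: sumsS => //; apply: PS.
Qed.

Lemma sums_of_seq P (T : eqType) (s : seq T) (f : T -> V) :
  (forall t, t \in s -> P (f t)) -> sums P (\sum_(t <- s) f t).
Proof.
elim: s => [|t s IH] h; first by rewrite big_nil; apply: sums0.
rewrite big_cons; apply: sumsS; first by apply: h; rewrite mem_head.
by apply: IH => t' ts; apply: h; rewrite inE ts orbT.
Qed.

End Sums.

Lemma sums_map (F : fieldType) (V W : lmodType F) (f : {linear V -> W})
    (P : V -> Prop) (Q : W -> Prop) :
  (forall v, P v -> sums Q (f v)) -> forall v, sums P v -> sums Q (f v).
Proof.
move=> PQ v; elim=> [|w u' Pw _ IH]; first by rewrite raddf0; apply: sums0.
by rewrite raddfD; apply: sumsD => //; apply: PQ.
Qed.

(** * Coordinates and dimension *)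

Section Dimension.
Variables (F : fieldType) (V : lmodType F).
Implicit Types (S : V -> Prop).

Definition vec n (b : 'I_n -> V) (u : 'rV[F]_n) : V := \sum_i u 0 i *: b i.

Lemma vec_linear n (b : 'I_n -> V) a u v :
  vec b (a *: u + v) = a *: vec b u + vec b v.
Proof.
rewrite /vec scaler_sumr -big_split /=; apply: eq_bigr => i _.
by rewrite !mxE scalerDl scalerA.
Qed.

Lemma vecD n (b : 'I_n -> V) u v : vec b (u + v) = vec b u + vec b v.
Proof. by have := vec_linear b 1 u v; rewrite !scale1r. Qed.

Lemma vec0 n (b : 'I_n -> V) : vec b 0 = 0.
Proof. by rewrite /vec big1 // => i _; rewrite mxE scale0r. Qed.

Lemma vecZ n (b : 'I_n -> V) a u : vec b (a *: u) = a *: vec b u.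
Proof. by have := vec_linear b a u 0; rewrite !addr0 vec0 addr0. Qed.

Lemma vecB n (b : 'I_n -> V) u v : vec b (u - v) = vec b u - vec b v.
Proof. by rewrite vecD -(scaleN1r v) vecZ scaleN1r. Qed.

Lemma vec_sum n (b : 'I_n -> V) (I : Type) (r : seq I) (f : I -> 'rV_n) :
  vec b (\sum_(i <- r) f i) = \sum_(i <- r) vec b (f i).
Proof. by elim/big_rec2: _ => [|i x y _ <-]; rewrite ?vec0 ?vecD. Qed.

Lemma vec_mul n m (b : 'I_n -> V) (u : 'rV_m) (U : 'M_(m, n)) :
  vec b (u *m U) = \sum_i u 0 i *: vec b (row i U).
Proof. by rewrite mulmx_sum_row vec_sum; apply: eq_bigr => i _; rewrite vecZ. Qed.

Record basis (S : V -> Prop) n (b : 'I_n -> V) : Prop := Basis {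
  basis_in : forall u, S (vec b u);
  basis_inj : forall u, vec b u = 0 -> u = 0;
  basis_span : forall v, S v -> exists u, v = vec b u
}.

Lemma has_dimP S n : subspace S -> has_dim S n <-> exists b : 'I_n -> V, basis S b.
Proof.
move=> hS; split=> -[b []] => [h1 h2 h3|h1 h2 h3]; exists b; split.
- by move=> u; apply: subspace_sum => // i; apply: subspaceZ.
- move=> u /h2 u0; apply/rowP => i; by rewrite u0 mxE.
- move=> v /h3[c ->]; exists (\row_i c i); by apply: eq_bigr => i _; rewrite mxE.
- move=> i; rewrite -[b i](_ : vec b (delta_mx 0 i) = _) //.
  rewrite /vec (bigD1 i) //= big1 ?addr0 ?mxE ?eqxx ?scale1r // => j /negbTE ij.
  by rewrite mxE ij andbF scale0r.
- move=> c c0 i; have: \row_i c i = 0 :> 'rV_n.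
    by apply: h2; rewrite -c0; apply: eq_bigr => j _; rewrite mxE.
  by move/rowP/(_ i); rewrite !mxE.
- by move=> v /h3[u ->]; exists (fun i => u 0 i).
Qed.

Lemma basis_inj2 S n (b : 'I_n -> V) u v : basis S b -> vec b u = vec b v -> u = v.
Proof. by move=> hb uv; apply/subr0_eq/(basis_inj hb); rewrite vecB uv subrr. Qed.

(** Adding to [U] a vector of [P] outside it raises the rank, so the enlargement stops after at most
    [n] steps. *)
Lemma rV_subspace n (P : 'rV[F]_n -> Prop) : subspace P ->
  exists U : 'M_n, forall u, P u <-> (u <= U)%MS.
Proof.
move=> hP.
suff gen k (U : 'M_n) : (n - \rank U <= k)%N -> (forall u, (u <= U)%MS -> P u) ->
    exists U : 'M_n, forall u, P u <-> (u <= U)%MS.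
  apply: (gen n 0); first by rewrite leq_subr.
  by move=> u; rewrite submx0 => /eqP ->; apply: subspace0.
elim: k U => [|k IH] U hr hU; have [hall|/existsNP[u /not_implyP[Pu /negP uU]]] :=
  pselect (forall u, P u -> (u <= U)%MS); try by exists U => u; split; auto.
- case/negP: uU; apply: submx_trans (submx1 _) _; rewrite sub1mx.
  by rewrite /row_full eqn_leq rank_leq_row -subn_eq0 -leqn0.
- apply: (IH (U + u)%MS).
    have: (\rank U < \rank (U + u)%MS)%N.
      have: (U < U + u)%MS.
        by rewrite ltmxE addsmxSl; apply: contra uU; apply: submx_trans; apply: addsmxSr.
      by rewrite ltmxErank => /andP[].
    lia.
  move=> w /sub_addsmxP[[x y] /= ->]; apply: subspaceD => //.
    by apply: hU; apply: submxMl.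
  have -> : y *m u = y 0 0 *: u by rewrite [y]mx11_scalar mul_scalar_mx !mxE.
  exact: subspaceZ.
Qed.

Lemma has_dim_sub S (S' : V -> Prop) n : subspace S' -> (forall v, S' v -> S v) ->
  subspace S -> has_dim S n -> exists m, has_dim S' m.
Proof.
move=> hS' sub hS /(has_dimP _ hS)[b hb].
have [|U UP] := @rV_subspace n (fun u => S' (vec b u)).
  split=> [|u v|a v]; rewrite ?vec0 ?vecD ?vecZ.
  - exact: subspace0.
  - exact: subspaceD.
  - exact: subspaceZ.
exists (\rank U); apply/(has_dimP _ hS'); exists (fun i => vec b (row i (row_base U))).
have vE u : vec (fun i => vec b (row i (row_base U))) u = vec b (u *m row_base U).
  by rewrite vec_mul.
split=> [u|u|v Sv]; rewrite ?vE.
- by apply/UP; rewrite -(eq_row_base U) submxMl.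
- by move/(basis_inj hb) => u0; apply: (row_free_inj (row_base_free U)); rewrite u0 mul0mx.
have [u vu] := basis_span hb (sub _ Sv).
have: (u <= row_base U)%MS by rewrite eq_row_base; apply/UP; rewrite -vu.
by case/submxP=> y uy; exists y; rewrite vE -uy.
Qed.

Lemma independent_le S n b m (c : 'I_m -> V) : @basis S n b -> (forall i, S (c i)) ->
  (forall u, vec c u = 0 -> u = 0) ->
  exists2 C : 'M_(m, n), row_free C & forall u, vec c u = vec b (u *m C).
Proof.
move=> hb hc inj; have [C CP] := choice (fun i => basis_span hb (hc i)).
have vE u : vec c u = vec b (u *m \matrix_i C i).
  by rewrite vec_mul; apply: eq_bigr => i _; rewrite CP rowK.
exists (\matrix_i C i) => //; apply/row_freeP.
have: kermx (\matrix_i C i) = 0.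
  apply/eqP; rewrite -submx0; apply/rV_subP => u /sub_kermxP u0.
  by rewrite (inj u) ?sub0mx // vE u0 vec0.
by move/eqP; rewrite kermx_eq0 => /row_freeP.
Qed.

Lemma has_dim_uniq S n m : subspace S -> has_dim S n -> has_dim S m -> n = m.
Proof.
move=> hS /(has_dimP _ hS)[b hb] /(has_dimP _ hS)[c hc].
have le p r (b' : 'I_p -> V) (c' : 'I_r -> V) : basis S b' -> basis S c' -> (r <= p)%N.
  move=> hb' hc'; have [i|C Cf _] := independent_le hb' _ (basis_inj hc').
    rewrite -[c' i](_ : vec c' (delta_mx 0 i) = _); first exact: basis_in.
    rewrite /vec (bigD1 i) //= big1 ?addr0 ?mxE ?eqxx ?scale1r // => j /negbTE ij.
    by rewrite mxE ij andbF scale0r.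
  by rewrite -(eqP Cf) rank_leq_col.
by apply/eqP; rewrite eqn_leq (le _ _ _ _ hb hc) (le _ _ _ _ hc hb).
Qed.

Lemma dimE S n : subspace S -> has_dim S n -> dim S = n.
Proof.
move=> hS hn; rewrite /dim; case: classical_sets.xgetP => [m -> h|/(_ n)//].
exact: has_dim_uniq h hn.
Qed.

Lemma independent_span S n (c : 'I_n -> V) : subspace S -> has_dim S n ->
  (forall i, S (c i)) -> (forall u, vec c u = 0 -> u = 0) ->
  forall v, S v -> exists u, v = vec c u.
Proof.
move=> hS /(has_dimP _ hS)[b hb] hc inj v Sv.
have [C Cf CE] := independent_le hb hc inj.
have [u ->] := basis_span hb Sv.
have Cu : C \in unitmx by rewrite -row_free_unit.
by exists (u *m invmx C); rewrite CE mulmxKV.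
Qed.

Lemma dim_eq0 S n : subspace S -> has_dim S n ->
  dim S = 0%N <-> forall v, S v -> v = 0.
Proof.
move=> hS hn; rewrite (dimE hS hn); split.
  move=> n0; subst n => v; case: hn => b [_ _ h] /h[c ->]; by rewrite big_ord0.
case: n hn => // n [b [h1 h2 _]] h0.
suff /(h2 (fun i => (i == ord0)%:R))/(_ ord0)/eqP : \sum_i (i == ord0)%:R *: b i = 0.
  by rewrite eqxx oner_eq0.
by rewrite big1 // => i _; rewrite (h0 _ (h1 i)) scaler0.
Qed.

End Dimension.

Lemma has_dim_bij (F : fieldType) (V W : lmodType F) (f : {linear V -> W})
    (S : V -> Prop) (S' : W -> Prop) n :
  bijective f -> (forall v, S v <-> S' (f v)) -> has_dim S n -> has_dim S' n.
Proof.
move=> [g fK gK] SS' [b [h1 h2 h3]]; exists (f \o b); split=> [i|c c0 i|w].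
- by apply/SS'.
- apply: h2; apply: (can_inj fK); rewrite raddf0 -c0 raddf_sum.
  apply: eq_bigr => j _. exact: linearZZ.
- rewrite -[w in S' w]gK => /SS'/h3[c gw]; exists c; rewrite -[w]gK gw raddf_sum.
  by apply: eq_bigr => j _; apply: linearZZ.
Qed.

Lemma dim_bij (F : fieldType) (V W : lmodType F) (f : {linear V -> W})
    (S : V -> Prop) (S' : W -> Prop) n : subspace S -> subspace S' ->
  bijective f -> (forall v, S v <-> S' (f v)) -> has_dim S n -> dim S = dim S'.
Proof.
move=> hS hS' bf SS' hn; rewrite (dimE hS hn).
by rewrite (dimE hS' (has_dim_bij bf SS' hn)).
Qed.

Lemma has_dim_prod (F : fieldType) (V W : lmodType F)
    (S : V -> Prop) (S' : W -> Prop) n m :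
  subspace S -> subspace S' -> has_dim S n -> has_dim S' m ->
  exists p, has_dim (fun x : V * W => S x.1 /\ S' x.2) p.
Proof.
move=> hS hS' [b [b1 b2 b3]] [c [c1 c2 c3]]; exists (n + m)%N.
pose h (i : 'I_(n + m)) : V * W :=
  match split i with inl j => (b j, 0) | inr j => (0, c j) end.
have hl j : h (lshift m j) = (b j, 0) by rewrite /h (unsplitK (inl j)).
have hr j : h (rshift n j) = (0, c j) by rewrite /h (unsplitK (inr j)).
have sE (a : 'I_(n + m) -> F) : \sum_i a i *: h i =
    (\sum_i a (lshift m i) *: b i, \sum_i a (rshift n i) *: c i).
  rewrite big_split_ord /=.
  under eq_bigr do rewrite hl.
  under [X in _ + X]eq_bigr do rewrite hr.
  have p1 : forall s (f : 'I_n -> F), \sum_(i <- s) f i *: (b i, 0 : W) = (\sum_(i <- s) f i *: b i, 0).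
    move=> s f; elim/big_rec2: _ => [|i x y _ ->] //.
    by congr pair; rewrite /= scaler0 add0r.
  have p2 : forall s (f : 'I_m -> F), \sum_(i <- s) f i *: (0 : V, c i) = (0, \sum_(i <- s) f i *: c i).
    move=> s f; elim/big_rec2: _ => [|i x y _ ->] //.
    by congr pair; rewrite /= scaler0 add0r.
  by rewrite p1 p2; congr pair; rewrite /= ?addr0 ?add0r.
exists h; split.
- move=> i; rewrite -(splitK i); case: (split i) => j /=; rewrite ?hl ?hr; split=> //=; exact: subspace0.
- move=> a; rewrite sE => -[/b2 a1 /c2 a2] i; rewrite -(splitK i).
  by case: (split i) => j /=.
- move=> [v w] /= [/b3[a1 ->] /c3[a2 ->]].
  exists (fun i => match split i with inl j => a1 j | inr j => a2 j end).
  rewrite sE; congr pair; apply: eq_bigr => i _.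
    by rewrite (unsplitK (inl i)).
  by rewrite (unsplitK (inr i)).
Qed.

(** * Linear maps as plain functions *)

Section Lin.
Variables (F : fieldType) (V W : lmodType F).

Definition lin (G : V -> W) := forall c u w, G (c *: u + w) = c *: G u + G w.

Variable G : V -> W.
Hypothesis linG : lin G.

Lemma linD u v : G (u + v) = G u + G v.
Proof. by have := linG 1 u v; rewrite !scale1r. Qed.

Lemma lin0 : G 0 = 0.
Proof. by apply: (addrI (G 0)); rewrite -linD !addr0. Qed.

Lemma linZ c u : G (c *: u) = c *: G u.
Proof. by have := linG c u 0; rewrite !addr0 lin0 addr0. Qed.

Lemma linB u v : G (u - v) = G u - G v.
Proof. by rewrite linD -(scaleN1r v) linZ scaleN1r. Qed.

Lemma lin_sum (I : Type) (r : seq I) (P : pred I) (f : I -> V) :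
  G (\sum_(i <- r | P i) f i) = \sum_(i <- r | P i) G (f i).
Proof. by elim/big_rec2: _ => [|i x y _ <-]; rewrite ?lin0 ?linD. Qed.

End Lin.

Lemma linear_lin (F : fieldType) (V W : lmodType F) (f : {linear V -> W}) : lin f.
Proof. by move=> c u w; rewrite linearP. Qed.

Lemma lin_comp (F : fieldType) (V W X : lmodType F) (f : W -> X) (g : V -> W) :
  lin f -> lin g -> lin (fun v => f (g v)).
Proof. by move=> hf hg c u w; rewrite hg hf. Qed.

(** * Joint generalized eigenvectors *)

Section FamilyDef.
Variables (F : fieldType) (V : lmodType F) (kT : Type).
Variable T : kT -> {linear V -> V}.

Definition shiftop k (a : F) (w : V) : V := T k w - a *: w.

(** The exponent is uniform in [k], as in [lspace]. *)
Definition jgen (th : kT -> F) (v : V) : Prop :=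
  exists p : nat, forall k, iter p (shiftop k (th k)) v = 0.

Lemma shiftop_lin k a : lin (shiftop k a).
Proof.
move=> c u w; rewrite /shiftop linearP !scalerDr !scalerA mulrC -!scalerA.
by rewrite scalerN opprD addrACA.
Qed.

Lemma iter_lin (G : V -> V) p : lin G -> lin (iter p G).
Proof. by move=> hG; elim: p => //= p IH; apply: lin_comp. Qed.

Lemma iter_ge0 (G : V -> V) p r v : lin G -> (p <= r)%N ->
  iter p G v = 0 -> iter r G v = 0.
Proof. by move=> hG /subnK <- h; rewrite iterD h lin0 //; apply: iter_lin. Qed.

Lemma jgen_subspace th : subspace (jgen th).
Proof.
split=> [|u v [p hp] [r hr]|a v [p hp]].
- by exists 0%N.
- exists (p + r)%N => k; rewrite linD; last by apply/iter_lin/shiftop_lin.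
  rewrite (iter_ge0 (shiftop_lin _ _) (leq_addr _ _) (hp k)).
  by rewrite (iter_ge0 (shiftop_lin _ _) (leq_addl _ _) (hr k)) addr0.
- by exists p => k; rewrite linZ ?hp ?scaler0 //; apply/iter_lin/shiftop_lin.
Qed.

Lemma jgen_eigen th v : (forall k, T k v = th k *: v) -> jgen th v.
Proof. by move=> h; exists 1%N => k /=; rewrite /shiftop h subrr. Qed.

Lemma shiftop_comm k a (G : V -> V) v : lin G ->
  (forall w, G (T k w) = T k (G w)) -> shiftop k a (G v) = G (shiftop k a v).
Proof. by move=> hG GT; rewrite /shiftop (linB hG) (linZ hG) GT. Qed.

Lemma iter_shiftop_comm k a p (G : V -> V) v : lin G ->
  (forall w, G (T k w) = T k (G w)) ->
  iter p (shiftop k a) (G v) = G (iter p (shiftop k a) v).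
Proof. by move=> hG GT; elim: p => //= p ->; apply: shiftop_comm. Qed.

Lemma jgen_comm th (G : V -> V) v : lin G ->
  (forall k w, G (T k w) = T k (G w)) -> jgen th v -> jgen th (G v).
Proof.
by move=> hG GT [p hp]; exists p => k; rewrite iter_shiftop_comm // hp lin0.
Qed.

Lemma iter_eigen k a b p v : T k v = b *: v ->
  iter p (shiftop k a) v = (b - a) ^+ p *: v.
Proof.
move=> h; elim: p => [|p IH] /=; first by rewrite expr0 scale1r.
by rewrite IH linZ; [rewrite /shiftop h -scalerBl scalerA exprSr|exact: shiftop_lin].
Qed.

(** By induction [v] is an eigenvector for [a]; the second equation then multiplies it by a power of
    [a - b]. *)
Lemma two_eigen k a b p r v : a != b -> iter p (shiftop k a) v = 0 ->
  iter r (shiftop k b) v = 0 -> v = 0.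
Proof.
move=> ab; elim: p v => // p IH v; rewrite iterSr => h1 h2.
have: shiftop k a v = 0.
  apply: IH => //; rewrite iter_shiftop_comm.
  - by rewrite h2 lin0 //; apply: shiftop_lin.
  - exact: shiftop_lin.
  - by move=> w; rewrite shiftop_comm //; exact: linear_lin.
move/subr0_eq => Tv; move: h2; rewrite (iter_eigen _ _ Tv) => /eqP.
by rewrite scaler_eq0 expf_eq0 subr_eq0 (negbTE ab) andbF => /eqP.
Qed.

Lemma jgen_eigenvalue th c v : v != 0 -> jgen th v -> (forall k, T k v = c k *: v) ->
  th = c.
Proof.
move=> v0 hv hc; apply/funext => k; have [p hp] := hv.
apply/eqP; apply: contraT => ne; case/negP: v0; apply/eqP.
apply: (@two_eigen k (th k) (c k) p 1) => //=.
by rewrite /shiftop hc subrr.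
Qed.

Lemma jgen_inj th th' v : v != 0 -> jgen th v -> jgen th' v -> th = th'.
Proof.
move=> v0 [p hp] [r hr]; apply/funext => k; apply/eqP; apply: contraT => ne.
by case/negP: v0; apply/eqP; apply: (two_eigen ne (hp k) (hr k)).
Qed.

(** Modulo [Z] the operator [T k - a] multiplies [u] by [t - a], and a power of it kills [u], which
    is nonzero modulo [Z]. *)
Lemma eigenvalue_mod (U Z : V -> Prop) k t a p u :
  subspace U -> subspace Z -> (forall w, U w -> U (T k w)) ->
  (forall w, U w -> Z w -> Z (T k w)) -> U u -> ~ Z u ->
  Z (T k u - t *: u) -> iter p (shiftop k a) u = 0 -> t = a.
Proof.
move=> hU hZ TU TZ Uu Zu Zt hp; apply/eqP; apply: contraT => ta.
have Us w : U w -> U (shiftop k a w).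
  by move=> Uw; apply: subspaceB => //; [apply: TU|apply: subspaceZ].
have [_ h] : U (iter p (shiftop k a) u) /\
    Z (iter p (shiftop k a) u - (t - a) ^+ p *: u).
  elim: p {hp} => [|p [IH1 IH2]] /=; first by rewrite expr0 scale1r subrr; split; last exact: subspace0.
  split; first exact: Us.
  set w := iter _ _ _ in IH1 IH2 *; set y := (t - a) ^+ p *: u in IH2.
  have Uy : U y by apply: subspaceZ.
  have -> : shiftop k a w - (t - a) ^+ p.+1 *: u
     = shiftop k a (w - y) + (t - a) ^+ p *: (T k u - t *: u).
    have yE : shiftop k a y = (t - a) ^+ p *: (T k u - a *: u).
      exact: (linZ (shiftop_lin k a)).
    rewrite (linB (shiftop_lin k a)) yE exprSr -scalerA -[RHS]addrA; congr (_ + _).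
    rewrite -(scalerN _ (T k u - a *: u)) -(scalerN _ ((t - a) *: u)) -scalerDr; congr (_ *: _).
    by rewrite scalerBl !opprB addrA subrK.
  apply: subspaceD => //; last exact: subspaceZ.
  by apply: subspaceB => //; [apply: TZ => //; apply: subspaceB|apply: subspaceZ].
case: Zu; rewrite hp sub0r in h.
have -> : u = - ((t - a) ^- p) *: - ((t - a) ^+ p *: u).
  by rewrite scaleNr scalerN opprK scalerA mulVf ?scale1r // expf_neq0 // subr_eq0.
exact: subspaceZ.
Qed.

Hypothesis Tcomm : forall k l v, T k (T l v) = T l (T k v).

(** Each summand of [u] has an eigenvalue differing from [th0] at some [k]; the power of
    [T k - th k] killing that summand is injective on the generalized eigenspace of [th0]. *)
Lemma jgen_disjoint th0 u :
  sums (fun v => exists2 th, th <> th0 & jgen th v) u -> jgen th0 u -> u = 0.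
Proof.
move=> hu hu0.
(* [G] is a product of powers of the operators [T k - th k] *)
suff [G [linG GT Gu Ginj]] : exists G : V -> V, [/\ lin G,
    forall k w, G (T k w) = T k (G w), G u = 0
    & forall v, jgen th0 v -> G v = 0 -> v = 0] by exact: Ginj.
elim: hu {hu0} => [|v u' [th ne [p hp]] _ [G [linG GT Gu Ginj]]].
  by exists idfun; split.
have [k /eqP nk] : exists k, th k <> th0 k.
  by apply/existsNP => h; apply: ne; apply/funext.
have com l a w : iter p (shiftop k a) (T l w) = T l (iter p (shiftop k a) w).
  apply: iter_shiftop_comm; first exact: linear_lin.
  by move=> x; apply: Tcomm.
have lin1 := iter_lin p (shiftop_lin k (th k)).
exists (fun w => iter p (shiftop k (th k)) (G w)); split.
- exact: lin_comp.
- by move=> l w; rewrite GT com.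
- rewrite (linD linG) Gu addr0 (iter_shiftop_comm _ _ _ linG) ?hp //.
  exact: (lin0 linG).
- move=> w wg; rewrite iter_shiftop_comm // => /(Ginj _ (jgen_comm lin1 _ wg)) h.
  have [r hr] := wg; apply: (two_eigen nk (h _) (hr k)).
  by move=> l x; rewrite com.
Qed.

Lemma sums_split th0 (R : V -> Prop) u : (forall v, R v -> exists th, jgen th v) ->
  sums R u -> exists u1 u2, [/\ u = u1 + u2, sums (fun v => R v /\ jgen th0 v) u1
    & sums (fun v => R v /\ exists2 th, th <> th0 & jgen th v) u2].
Proof.
move=> Rg; elim=> [|v w Rv _ [u1 [u2 [-> h1 h2]]]].
  by exists 0, 0; split; rewrite ?addr0 //; apply: sums0.
have [th hth] := Rg _ Rv.
have [E|ne] := pselect (th = th0).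
  exists (v + u1), u2; split=> //; first by rewrite addrA.
  by apply: sumsS => //; rewrite -E.
exists u1, (v + u2); split=> //; first by rewrite addrCA.
by apply: sumsS => //; split=> //; exists th.
Qed.

(** The summands with other eigenvalues add up to a generalized eigenvector for [th0], hence cancel.
    This transfers what is known about the summands in [R] to an arbitrary eigenvector in their
    span. *)
Lemma sums_project th0 (R : V -> Prop) u : (forall v, R v -> exists th, jgen th v) ->
  sums R u -> jgen th0 u -> sums (fun v => R v /\ jgen th0 v) u.
Proof.
move=> Rg /(sums_split th0 Rg)[u1 [u2 [-> h1 h2]]] hu.
have g1 : jgen th0 u1 by apply: (sums_min (jgen_subspace th0) _ h1) => v [].
rewrite [u2](@jgen_disjoint th0) ?addr0 //.
  by apply: sums_mono h2 => v [].
rewrite -[u2](addKr u1); apply: (subspaceD (jgen_subspace _)) => //.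
by apply: (subspaceN (jgen_subspace _)).
Qed.

End FamilyDef.

(** * Commuting operators on a finite-dimensional subspace *)

Section FiniteDim.
Variables (F : closedFieldType) (V : lmodType F) (kT : Type).
Variable T : kT -> {linear V -> V}.
Hypothesis Tcomm : forall k l v, T k (T l v) = T l (T k v).
Variables (S : V -> Prop) (n : nat).
Hypothesis hS : subspace S.
Hypothesis dS : has_dim S n.
Hypothesis TS : forall k v, S v -> S (T k v).

Lemma operator_matrices m (b : 'I_m -> V) : basis S b ->
  exists M : kT -> 'M[F]_m, (forall k u, T k (vec b u) = vec b (u *m M k)) /\
    (forall k l, M k *m M l = M l *m M k).
Proof.
move=> hb.
have hT k i : exists u, T k (b i) = vec b u.
  apply: (basis_span hb); apply: TS; rewrite -[b i](_ : vec b (delta_mx 0 i) = _).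
    exact: basis_in.
  rewrite /vec (bigD1 i) //= big1 ?addr0 ?mxE ?eqxx ?scale1r // => j /negbTE ij.
  by rewrite mxE ij andbF scale0r.
have /choice[M MP] : forall k, exists f : 'I_m -> 'rV_m, forall i, T k (b i) = vec b (f i).
  by move=> k; have [f fP] := choice (hT k); exists f.
have ME k u : T k (vec b u) = vec b (u *m \matrix_i M k i).
  rewrite vec_mul raddf_sum; apply: eq_bigr => i _.
  by rewrite rowK -MP; apply: linearZZ.
exists (fun k => \matrix_i M k i); split=> // k l.
apply/row_matrixP => i; rewrite !rowE !mulmxA; apply: (basis_inj2 hb).
by rewrite -!ME Tcomm.
Qed.

Lemma subspace_vec m (b : 'I_m -> V) (L : V -> Prop) : subspace L ->
  exists U : 'M_m, forall u, L (vec b u) <-> (u <= U)%MS.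
Proof.
move=> hL; apply: (@rV_subspace _ m (fun u => L (vec b u))).
split=> [|u v|a v]; rewrite ?vec0 ?vecD ?vecZ.
- exact: subspace0.
- exact: subspaceD.
- exact: subspaceZ.
Qed.

Lemma eigen_mod (Z : V -> Prop) : subspace Z ->
  (forall k v, S v -> Z v -> Z (T k v)) -> ~ (forall v, S v -> Z v) ->
  exists u, [/\ S u, ~ Z u & exists th : kT -> F, forall k, Z (T k u - th k *: u)].
Proof.
move=> hZ TZ /existsNP[v0 /not_implyP[Sv0 Zv0]].
(* The matrix lemmas are about matrices of positive size; a zero space [S] would lie in [Z]. *)
have [[|m'] [b hb]] : exists m (b : 'I_m -> V), basis S b.
  - by exists n; apply/(has_dimP _ hS).
  - have [u vu] := basis_span hb Sv0; case: Zv0; rewrite vu thinmx0 vec0.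
    exact: subspace0.
have [M [ME Mc]] := operator_matrices hb.
have [U UP] := subspace_vec b hZ.
have [|k||u [_ /negP uU [th thP]]] := @joint_eigen_mod F m' kT M Mc U 1%:M.
- move=> k; apply/rV_subP => v /submxP[y ->]; rewrite mulmxA; apply/UP.
  by rewrite -ME; apply: TZ; [exact: basis_in|apply/UP; apply: submxMl].
- exact: submx1.
- have [u vu] := basis_span hb Sv0; apply/negP => h; apply: Zv0; rewrite vu.
  by apply/UP; apply: submx_trans (submx1 _) h.
exists (vec b u); split; first exact: basis_in.
  by move/UP.
by exists th => k; rewrite ME -vecZ -vecB; apply/UP.
Qed.

(** The transposed matrices preserve the annihilator of [L], which is nonzero since [L] does not
    contain [S]; a common eigenvector there is [xi]. *)
Lemma eigen_functional (L : V -> Prop) : subspace L ->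
  (forall k v, S v -> L v -> L (T k v)) -> ~ (forall v, S v -> L v) ->
  exists (xi : V -> F) (th : kT -> F), [/\
    forall a u v, S u -> S v -> xi (a *: u + v) = a * xi u + xi v,
    forall v, S v -> L v -> xi v = 0, exists2 v, S v & xi v != 0
  & forall k v, S v -> xi (T k v) = th k * xi v].
Proof.
move=> hL TL /existsNP[v0 /not_implyP[Sv0 Lv0]].
have [[|m'] [b hb]] : exists m (b : 'I_m -> V), basis S b.
  - by exists n; apply/(has_dimP _ hS).
  - have [u vu] := basis_span hb Sv0; case: Lv0; rewrite vu thinmx0 vec0.
    exact: subspace0.
have [M [ME Mc]] := operator_matrices hb.
have [U UP] := subspace_vec b hL.
pose K := kermx U^T.
have McT k l : (M k)^T * (M l)^T = (M l)^T * (M k)^T.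
  by rewrite /GRing.mul /= -!trmx_mul Mc.
have [k|k||c [cK c0 [th thP]]] := @joint_eigen_mod F m' kT _ McT 0 K.
- by rewrite mul0mx sub0mx.
- apply/rV_subP => v /submxP[y ->]; rewrite mulmxA.
  have /sub_kermxP h : (y *m K <= K)%MS by apply: submxMl.
  apply/sub_kermxP; rewrite -mulmxA -trmx_mul.
  have /submxP[X XE] : (U *m M k <= U)%MS.
    apply/rV_subP => w /submxP[z ->]; rewrite mulmxA; apply/UP.
    by rewrite -ME; apply: TL; [exact: basis_in|apply/UP; apply: submxMl].
  by rewrite XE trmx_mul mulmxA h mul0mx.
- rewrite submx0 kermx_eq0 /row_free mxrank_tr; apply/negP => fU.
  have [u vu] := basis_span hb Sv0; apply: Lv0; rewrite vu; apply/UP.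
  exact: submx_full.
(* Coordinates in the basis [b]. Outside [S] they are arbitrary, which is why [xi] is claimed to be
   linear on [S] only. *)
have /choice[co coP] v : exists u, S v -> v = vec b u.
  have [/(basis_span hb)[u ->]|] := pselect (S v); first by exists u.
  by exists 0.
have coE u : co (vec b u) = u.
  by apply: (basis_inj2 hb); rewrite -coP //; apply: basis_in.
have coS v : S v -> exists u, v = vec b u /\ co v = u.
  by move=> /(basis_span hb)[u ->]; exists u; rewrite coE.
exists (fun v => (co v *m c^T) 0 0), th; split.
- move=> a u v /coS[u' [-> ->]] /coS[v' [-> ->]].
  by rewrite -vec_linear coE mulmxDl -scalemxAl !mxE.
- move=> v /coS[u' [-> ->]] /UP /submxP[y ->]; rewrite -mulmxA.
  have -> : U *m c^T = (c *m U^T)^T by rewrite trmx_mul trmxK.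
  by move/sub_kermxP: cK => ->; rewrite trmx0 mulmx0 mxE.
- have /rV0Pn[j cj] : c != 0 by apply: contraNneq c0 => ->; rewrite sub0mx.
  exists (vec b (delta_mx 0 j)); first exact: basis_in.
  by rewrite coE -rowE !mxE.
- move=> k v /coS[u' [-> ->]]; rewrite ME !coE -mulmxA.
  have -> : M k *m c^T = th k *: c^T.
    apply: trmx_inj; rewrite trmx_mul trmxK linearZ /= trmxK.
    by have := thP k; rewrite submx0 subr_eq0 => /eqP.
  by rewrite -scalemxAr mxE.
Qed.

Lemma sums_gen_eigen v : S v ->
  sums (fun v => S v /\ exists th, jgen T th v) v.
Proof.
have [[|m'] [b hb]] : exists m (b : 'I_m -> V), basis S b.
- by exists n; apply/(has_dimP _ hS).
- by move=> /(basis_span hb)[u ->]; rewrite thinmx0 vec0; apply: sums0.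
have [M [ME Mc]] := operator_matrices hb.
move=> /(basis_span hb)[u ->].
apply: (@joint_gen_eigen F m' kT M Mc (fun u => sums _ (vec b u))).
- by rewrite vec0; apply: sums0.
- by move=> x y; rewrite vecD; apply: sumsD.
move=> x [th [p xp]]; apply: sums1; split; first exact: basis_in.
exists th, p => k.
suff -> : iter p (shiftop T k (th k)) (vec b x) = vec b (x *m (M k - (th k)%:M) ^+ p).
  by rewrite xp vec0.
elim: p {xp} => [|p IH]; first by rewrite expr0 mulmx1.
rewrite iterS IH exprSr /shiftop ME -vecZ -vecB.
by rewrite [_ ^+ p * _]/(_ *m _) mulmxA mulmxBr mul_mx_scalar.
Qed.

End FiniteDim.

(** * Expansions of rational functions *)

Section Series.
Variable F : fieldType.
Implicit Types (p q r : {poly F}) (c d : int -> F) (k : int) (f g : ratfun F).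
Local Notation "p %:F" := (@FracField.tofrac {poly F} p).

(** The coefficient of z^k in the product of [p] with the two-sided series of coefficients [c]. *)
Definition act p c k : F := \sum_(l < size p) p`_l * c (k - l%:Z).

Lemma act_widen n p c k : (size p <= n)%N ->
  act p c k = \sum_(l < n) p`_l * c (k - l%:Z).
Proof.
move=> h; rewrite /act (big_ord_widen n (fun l => p`_l * c (k - l%:Z))) //.
rewrite big_mkcond; apply: eq_bigr => i _; case: ltnP => // hi.
by rewrite nth_default // mul0r.
Qed.

Lemma actD p q c k : act (p + q) c k = act p c k + act q c k.
Proof.
rewrite !(@act_widen (maxn (size p) (size q))) ?leq_maxl ?leq_maxr ?size_polyD //.
by rewrite -big_split; apply: eq_bigr => i _; rewrite coefD mulrDl.
Qed.

Lemma actC a c k : act a%:P c k = a * c k.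
Proof. by rewrite (@act_widen 1) ?size_polyC_leq1 // big_ord1 coefC subr0. Qed.

Lemma actMX p c k : act (p * 'X) c k = act p c (k - 1).
Proof.
rewrite (@act_widen (size p).+1).
  rewrite big_ord_recl coefMX mul0r add0r; apply: eq_bigr => i _.
  by rewrite coefMX /=; congr (_ * c _); rewrite /bump /=; lia.
by rewrite (leq_trans (size_polyMleq _ _)) // size_polyX addn2.
Qed.

Lemma act_ext p c d : c =1 d -> act p c =1 act p d.
Proof. by move=> h k; apply: eq_bigr => i _; rewrite h. Qed.

Lemma act_subr p c d k : act p (fun k => c k - d k) k = act p c k - act p d k.
Proof. by rewrite /act -sumrB; apply: eq_bigr => i _; rewrite mulrBr. Qed.

Lemma act_mul p q c k : act (p * q) c k = act p (act q c) k.
Proof.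
elim/poly_ind: p k => [|p a IH] k.
  by rewrite mul0r -polyC0 !actC !mul0r.
rewrite mulrDl !actD mulrAC !actMX IH; congr (_ + _).
rewrite actC mul_polyC.
elim/poly_ind: q {IH} k => [|q b IH] k; first by rewrite scaler0 -polyC0 !actC mul0r mulr0.
by rewrite scalerDr scalerAl !actD !actMX IH -mul_polyC -polyCM !actC mulrDr mulrA.
Qed.

Definition coefz p k : F := if k is Posz m then p`_m else 0.

Lemma coefz_act p k : coefz p k = act p (coefz 1) k.
Proof.
elim/poly_ind: p k => [|p a IH] k.
  by rewrite -polyC0 actC mul0r; case: k => //= m; rewrite coef0.
rewrite actD actMX actC -IH; case: k => [[|m]|m] /=.
- by rewrite coefD coefMX coefC coef1 mulr1.
- rewrite coefD coefMX coefC /= addr0 coef1 mulr0 addr0.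
  by rewrite subn1.
- by rewrite mulr0 addr0.
Qed.

Lemma act_coefz p q k : act p (coefz q) k = coefz (p * q) k.
Proof.
rewrite coefz_act act_mul; apply: act_ext => l; exact: coefz_act.
Qed.

Definition bounded (e : bool) c :=
  exists N : int, forall k, (if e then k < N else N < k) -> c k = 0.

Lemma coefz_bounded e p : bounded e (coefz p).
Proof.
case: e; [exists 0|exists (size p)%:Z] => -[m|m] //=.
by move=> h; rewrite nth_default //; lia.
Qed.

Lemma bounded_act e p c : bounded e c -> bounded e (act p c).
Proof.
move=> [N hN]; case: e hN => hN; [exists N|exists (N + (size p)%:Z)] => k hk.
  by rewrite /act big1 // => i _; rewrite hN ?mulr0 //; lia.
by rewrite /act big1 // => i _; rewrite hN ?mulr0 //; have := ltn_ord i; lia.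
Qed.

Lemma bounded_sub e c d : bounded e c -> bounded e d -> bounded e (fun k => c k - d k).
Proof.
move=> [N hN] [M hM]; case: e hN hM => hN hM.
  by exists (Num.min N M) => k; rewrite lt_min => /andP[h1 h2]; rewrite hN ?hM ?subr0.
by exists (Num.max N M) => k; rewrite gt_max => /andP[h1 h2]; rewrite hN ?hM ?subr0.
Qed.

(** The coefficients of [c] vanish one after another, starting from the side where [c] is zero: the
    lowest coefficient of [p] is inverted when [c] is bounded below, the leading one when it is
    bounded above. Without a bound, 1 - z kills the constant sequence 1. *)
Lemma act_eq0 e p c : p != 0 -> bounded e c -> act p c =1 (fun=> 0) -> c =1 (fun=> 0).
Proof.
move=> p0 [N hN] h; case: e hN => hN.
  have [v [pv vmin]] : exists v, p`_v != 0 /\ forall l, (l < v)%N -> p`_l = 0.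
    have ex : exists v, p`_v != 0.
      by exists (size p).-1; rewrite -lead_coefE lead_coef_eq0.
    exists (ex_minn ex); case: ex_minnP => v pv mn; split=> // l lv.
    by apply/eqP; apply: contraTT lv => /mn; rewrite -leqNgt.
  suff gen n k : k < N + n%:Z -> c k = 0.
    by move=> k; apply: (gen (absz (k - N + 1)%R)); lia.
  elim: n k => [|n IH] k hk; first by apply: hN; lia.
  have := h (k + v%:Z); have vs : (v < size p)%N.
    by rewrite ltnNge; apply: contra pv => /(nth_default 0) ->.
  rewrite /act (bigD1 (Ordinal vs)) //= addrK big1 ?addr0.
    by move/eqP; rewrite mulf_eq0 (negbTE pv) => /eqP.
  move=> i /eqP iv; have [lt|ge] := ltnP i v; first by rewrite vmin ?mul0r.
  rewrite IH ?mulr0 //.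
  have : i != v :> nat by apply/eqP => E; apply: iv; apply: val_inj.
  lia.
suff gen n k : N - n%:Z < k -> c k = 0.
  by move=> k; apply: (gen (absz (k - N - 1)%R)); lia.
elim: n k => [|n IH] k hk; first by apply: hN; lia.
have sp : (0 < size p)%N by rewrite size_poly_gt0.
have := h (k + (size p).-1%:Z); have vs : ((size p).-1 < size p)%N by rewrite prednK.
rewrite /act (bigD1 (Ordinal vs)) //= addrK big1 ?addr0.
  by move/eqP; rewrite mulf_eq0 -lead_coefE lead_coef_eq0 (negbTE p0) => /eqP.
move=> i /eqP iv; rewrite IH ?mulr0 //.
have : (i < (size p).-1)%N.
  rewrite ltn_neqAle -ltnS (prednK sp) ltn_ord andbT.
  by apply/eqP => E; apply: iv; apply: val_inj.
move: (nat_of_ord i) (size p).-1 => x y; lia.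
Qed.

Lemma act_inj e p c d : p != 0 -> bounded e c -> bounded e d ->
  act p c =1 act p d -> c =1 d.
Proof.
move=> p0 bc bd h k; apply: subr0_eq.
apply: (act_eq0 p0 (bounded_sub bc bd)) => l.
by rewrite act_subr h subrr.
Qed.

Lemma ratfun_eq p q p' q' : q != 0 -> q' != 0 ->
  (p%:F / q%:F == p'%:F / q'%:F) = (p * q' == p' * q).
Proof.
by move=> h h'; rewrite eqr_div ?tofrac_eq0 // -!rmorphM /= tofrac_eq.
Qed.

Lemma expansionP e f c : expansion e f c <-> bounded e c /\
  exists p q, [/\ q != 0, f = p%:F / q%:F & act q c =1 coefz p].
Proof. by []. Qed.

Lemma expansion_rep e f c p q : expansion e f c -> q != 0 -> f = p%:F / q%:F ->
  act q c =1 coefz p.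
Proof.
move=> /expansionP[bc [p' [q' [q'0 -> h']]]] q0 /eqP; rewrite ratfun_eq // => /eqP E.
apply: (act_inj q'0 (bounded_act _ bc) (coefz_bounded e p)) => k.
rewrite -act_mul mulrC act_mul (act_ext _ h') !act_coefz.
by rewrite mulrC E mulrC.
Qed.

Lemma expansion_uniq e f c d : expansion e f c -> expansion e f d -> c =1 d.
Proof.
move=> hc hd; have /expansionP[bc [p [q [q0 fE h]]]] := hc.
have [bd _] := hd.
by apply: (act_inj q0 bc bd) => k; rewrite h (expansion_rep hd q0 fE).
Qed.

Lemma expansion_inj e f g c : expansion e f c -> expansion e g c -> f = g.
Proof.
move=> /expansionP[_ [p [q [q0 -> h]]]] /expansionP[_ [p' [q' [q'0 -> h']]]].
apply/eqP; rewrite ratfun_eq //; apply/eqP/polyP => k.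
rewrite -/(coefz (p * q') k) -/(coefz (p' * q) k) mulrC [p' * q]mulrC -!act_coefz.
by rewrite -(act_ext _ h) -(act_ext _ h') -!act_mul mulrC.
Qed.

Lemma regular_neq0 f : regular_nonzero0 f -> f != 0.
Proof.
move=> [p [r [p0 r0 ->]]]; have nz (s : {poly F}) : s.[0] != 0 -> s != 0.
  by apply: contraNneq => ->; rewrite horner0.
by rewrite mulf_neq0 ?invr_eq0 // tofrac_eq0 nz.
Qed.

Lemma regular1 : regular_nonzero0 (1 : ratfun F).
Proof. by exists 1, 1; rewrite hornerC oner_eq0; split => //; rewrite divr1. Qed.

Lemma regularM f g : regular_nonzero0 f -> regular_nonzero0 g -> regular_nonzero0 (f * g).
Proof.
move=> [p [r [p0 r0 ->]]] [p' [r' [p'0 r'0 ->]]]; exists (p * p'), (r * r').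
by rewrite !hornerM !mulf_neq0 // !rmorphM /= mulf_div.
Qed.

Lemma value0_expansion f c : regular_nonzero0 f -> expansion true f c ->
  value0 f = c 0 /\ forall k, k < 0 -> c k = 0.
Proof.
move=> [p [r [p0 r0 fE]]] hc.
have rn0 : r != 0 by apply: contraNneq r0 => ->; rewrite horner0.
have hr := expansion_rep hc rn0 fE.
have c_neg k : k < 0 -> c k = 0.
  have [[N hN] _] := hc.
  suff gen n (l : int) : l < 0 -> l < N + n%:Z -> c l = 0.
    by move=> h; apply: (gen (absz (k - N + 1)%R)) => //; lia.
  elim: n l => [|n IH] l l0 ln; first by apply: hN; lia.
  have := hr l; rewrite /act; case E : (size r) => [|s].
    by move/eqP: E; rewrite size_poly_eq0 (negbTE rn0).
  rewrite big_ord_recl subr0 big1 ?addr0.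
    have -> : coefz p l = 0 by case: l l0 {ln}.
    by move/eqP; rewrite mulf_eq0 -horner_coef0 (negbTE r0) => /eqP.
  by move=> i _; rewrite IH ?mulr0 // lift0; lia.
split=> //; rewrite /value0.
have c0E (p' r' : {poly F}) : r'.[0] != 0 -> f = p'%:F / r'%:F -> p'.[0] / r'.[0] = c 0.
  move=> r'0 E; have r'n0 : r' != 0 by apply: contraNneq r'0 => ->; rewrite horner0.
  have := expansion_rep hc r'n0 E 0; rewrite /act; case Es : (size r') => [|s].
    by move/eqP: Es; rewrite size_poly_eq0 (negbTE r'n0).
  rewrite big_ord_recl subr0 big1 ?addr0 => [|i _]; last by rewrite c_neg ?mulr0 // lift0; lia.
  by rewrite !horner_coef0 /= => <-; rewrite mulrC mulKf // -horner_coef0.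
case: classical_sets.xgetP => [y -> [p' [r' [r'0 E ->]]]|/(_ (c 0))]; first exact: c0E.
by case; exists p, r; split=> //; rewrite c0E.
Qed.

Lemma series_division p r : r.[0] != 0 ->
  exists2 c : int -> F, forall k, k < 0 -> c k = 0 & act r c =1 coefz p.
Proof.
move=> r0; rewrite horner_coef0 in r0.
(* Long division; [g n] lists the first [n] coefficients of the quotient. *)
pose step (s : seq F) := rcons s ((p`_(size s) -
  \sum_(1 <= l < (size s).+1) r`_l * s`_(size s - l)) / r`_0).
pose g n := iter n step [::].
have sg n : size (g n) = n by elim: n => //= n IH; rewrite size_rcons IH.
have gn n m : (n < m)%N -> (g m)`_n = (g n.+1)`_n.
  elim: m => // m IH; rewrite ltnS leq_eqVlt => /orP[/eqP -> //|nm].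
  by rewrite -IH //= nth_rcons sg nm.
pose d (n : nat) := (g n.+1)`_n.
have dE n : r`_0 * d n = p`_n - \sum_(1 <= l < n.+1) r`_l * d (n - l)%N.
  rewrite /d /= nth_rcons sg ltnn eqxx mulrC divfK //; congr (_ - _).
  apply: eq_big_nat => l /andP[l1 ln].
  by rewrite gn //; lia.
pose D k := if k is Posz n then d n else 0.
have D0 k : k < 0 -> D k = 0 by case: k.
exists D => // -[n|n]; last by rewrite /act big1 //= => i _; rewrite D0 ?mulr0 //; lia.
rewrite (@act_widen (size r + n.+1)) ?leq_addr //=.
rewrite -(big_mkord xpredT (fun l => r`_l * D (n%:Z - l%:Z))).
rewrite (@big_cat_nat _ _ _ n.+1) //=; last by rewrite leq_addl.
rewrite [X in _ + X]big_nat [X in _ + X]big1 ?addr0; last first.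
  by move=> l /andP[h _]; rewrite D0 ?mulr0 //; lia.
rewrite big_ltn // subr0 dE.
rewrite [X in _ + X](_ : _ = \sum_(1 <= l < n.+1) r`_l * d (n - l)%N) ?subrK //.
apply: eq_big_nat => l /andP[h1 h2].
by have -> : n%:Z - l%:Z = (n - l)%N by lia.
Qed.

Lemma expansion_exists f : regular_nonzero0 f -> exists c, expansion true f c.
Proof.
move=> [p [r [p0 r0 ->]]]; have [c c0 h] := series_division p r0.
exists c; apply/expansionP; split; first by exists 0.
by exists p, r; split=> //; apply: contraNneq r0 => ->; rewrite horner0.
Qed.

(** A chosen Taylor expansion at 0, with value 0 for functions that have none. *)
Definition ser f : int -> F :=
  if pselect (exists c, expansion true f c) is left h then projT1 (cid h) else fun=> 0.

Lemma serP f : regular_nonzero0 f -> expansion true f (ser f).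
Proof.
move=> /expansion_exists h; rewrite /ser; case: pselect => // h'.
exact: (projT2 (cid h')).
Qed.

Lemma ser_uniq f c : expansion true f c -> c =1 ser f.
Proof.
move=> h; rewrite /ser; case: pselect => [h'|[]]; last by exists c.
exact: expansion_uniq h (projT2 (cid h')).
Qed.

Lemma value0_ser f : regular_nonzero0 f -> value0 f = ser f 0.
Proof. by move=> h; have [] := value0_expansion h (serP h). Qed.

Lemma ser_neg f k : regular_nonzero0 f -> k < 0 -> ser f k = 0.
Proof. by move=> h; have [_] := value0_expansion h (serP h); apply. Qed.

Lemma ser_inj f g : regular_nonzero0 f -> regular_nonzero0 g ->
  (forall k : nat, ser f k = ser g k) -> f = g.
Proof.
move=> hf hg h; apply: (expansion_inj (serP hf)).
suff -> : ser f = ser g by apply: serP.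
by apply/funext => -[k|k] //; rewrite !ser_neg.
Qed.

Lemma value0_neq0 f : regular_nonzero0 f -> value0 f != 0.
Proof.
move=> hf; have [p [r [p0 r0 fE]]] := hf.
have rn0 : r != 0 by apply: contraNneq r0 => ->; rewrite horner0.
have := expansion_rep (serP hf) rn0 fE 0; rewrite /act; case Es : (size r) => [|s].
  by move/eqP: Es; rewrite size_poly_eq0 (negbTE rn0).
rewrite big_ord_recl subr0 big1 ?addr0 => [|i _].
  rewrite /= -!horner_coef0 value0_ser // => E; apply: contraNneq p0 => h.
  by rewrite -E h mulr0.
by rewrite ser_neg ?mulr0 // lift0; lia.
Qed.

Lemma expansion_mul e f c d p q : q != 0 -> expansion e f c -> bounded e d ->
  act q d =1 act p c -> expansion e (f * (p%:F / q%:F)) d.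
Proof.
move=> q0 /expansionP[bc [p' [q' [q'0 -> h]]]] bd E; apply/expansionP; split=> //.
exists (p' * p), (q' * q); split; rewrite ?mulf_neq0 // ?rmorphM /= ?mulf_div //.
by move=> k; rewrite act_mul (act_ext _ E) -act_mul mulrC act_mul (act_ext _ h) act_coefz mulrC.
Qed.

(* The value of [A_{j,a}^{-1}] at a node [k], for [b = q_k^{- C_{k,j}}]. *)
Definition Ap (b a : F) : ratfun F :=
  (b%:P - a *: 'X)%:F / (1 - (a * b) *: 'X)%:F.

Lemma Ap_regular b a : b != 0 -> regular_nonzero0 (Ap b a).
Proof.
move=> b0; exists (b%:P - a *: 'X), (1 - (a * b) *: 'X).
by rewrite !hornerE /= ?subr0 oner_eq0; split.
Qed.

Lemma Ap_den b a : 1 - (a * b) *: 'X != 0 :> {poly F}.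
Proof.
apply/eqP => /(congr1 (horner^~ 0)); rewrite !hornerE /= ?mulr0 ?subr0.
by move/eqP; rewrite oner_eq0.
Qed.

(** The conditions on [d] are the coefficients of (1 - a b z) d(z) = (b - a z) c(z), in the shape in
    which the exchange relations produce them. *)
Lemma Ap_expansion f c d b a : expansion true f c ->
  (forall k, k < 0 -> c k = 0) -> (forall k, k < 0 -> d k = 0) -> d 0 = b * c 0 ->
  (forall k : nat, d k.+1 - a * b * d k = b * c k.+1 - a * c k) ->
  expansion true (f * Ap b a) d.
Proof.
move=> hc c0 d0 h0 h; apply: (expansion_mul (Ap_den _ _) hc); first by exists 0.
have actL (x y : F) (g : int -> F) k : act (x%:P - y *: 'X) g k = x * g k - y * g (k - 1).
  by rewrite -scaleNr -mul_polyC actD actC actMX actC mulNr.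
rewrite -[1]/(1%:P) => -[[|k]|k]; rewrite !actL mul1r.
- by rewrite h0 (c0 (0 - 1)) ?(d0 (0 - 1)) ?mulr0.
- by have -> : k.+1%:Z - 1 = k by lia; apply: h.
- by rewrite !c0 ?d0 ?mulr0 ?subr0 // d0 ?mulr0 ?subr0 //; lia.
Qed.

End Series.

(** * Sums over a triangle *)

Section Triangle.
Variables (V : nmodType) (f : nat -> nat -> V).

Lemma triangle_diag r : \sum_(a < r.+1) \sum_(t < (r - a).+1) f a t
  = \sum_(u < r.+1) \sum_(a < u.+1) f a (u - a)%N.
Proof.
elim: r => [|r IH]; first by rewrite !big_ord1.
rewrite [RHS]big_ord_recr /= -IH big_ord_recr /= subnn big_ord1.
rewrite [X in _ = _ + X]big_ord_recr /= subnn addrA; congr (_ + _).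
rewrite -big_split; apply: eq_bigr => a _ /=.
by rewrite subSn ?big_ord_recr // -ltnS.
Qed.

End Triangle.

Lemma triangle_sym (V : nmodType) (f : nat -> nat -> V) r :
  \sum_(a < r.+1) \sum_(t < (r - a).+1) f a t
  = \sum_(t < r.+1) \sum_(a < (r - t).+1) f a t.
Proof.
rewrite triangle_diag [RHS](triangle_diag (fun t a => f a t)); apply: eq_bigr => u _.
rewrite (reindex_inj rev_ord_inj); apply: eq_bigr => a _ /=.
by rewrite subSS subKn // -ltnS.
Qed.

(** * Exchange relations between phi and x *)

Section Exponential.
Variables (F : numFieldType) (V : lmodType F).
Variables (H : nat -> V -> V) (E : nat -> V -> V).
Hypothesis H0 : forall v, H 0 v = 0.
Hypothesis EE : forall r v, E r v = ops_exp H r v.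

Local Notation P k := (iter k (ops_mul H) (@ops_one F V)).

Lemma powS k r v : P k.+1 r v = \sum_(a < r.+1) H a (P k (r - a)%N v).
Proof. by []. Qed.

Lemma pow_tail k r v : P k.+1 r.+1 v =
  \sum_(a < r) H a.+1 (P k (r - a)%N v) + H r.+1 (P k 0%N v).
Proof.
rewrite powS big_ord_recl H0 add0r big_ord_recr /= /bump add1n subnn.
by congr (_ + _); apply: eq_bigr => a _; rewrite /bump /= add1n subSS.
Qed.

Lemma pow_at0 k v : P k.+1 0%N v = 0.
Proof. by rewrite powS big_ord1 H0. Qed.

(** The first power of [H] applies the operators [H a.+1] with a < r to the zero components of
    [ops_one]. Linearity of [H] is not yet available, so the values [H a.+1 0] have to be carried
    along. *)
Lemma exp_top r v : E r.+1 v = H r.+1 v + \sum_(a < r) H a.+1 0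
  + \sum_(2 <= k < r.+2) (k`!%:R)^-1 *: P k r.+1 v.
Proof.
rewrite EE /ops_exp -(big_mkord xpredT (fun k => (k`!%:R)^-1 *: P k r.+1 v)).
rewrite big_ltn // scaler0 add0r big_ltn // invr1 scale1r; congr (_ + _).
rewrite pow_tail addrC; congr (_ + _); apply: eq_bigr => a _ /=.
by rewrite /ops_one; case: ifP => // /eqP; have := ltn_ord a; lia.
Qed.

Hypothesis Elin : forall r, lin (E r).

Lemma pow_zero n : (forall a, (a < n)%N -> H a 0 = 0) ->
  forall k r, (r < n)%N -> P k r 0 = 0.
Proof.
move=> h; elim=> [|k IH] r rn; first by rewrite /= /ops_one; case: ifP.
rewrite powS big1 // => a _; rewrite IH ?h //; have := ltn_ord a; lia.
Qed.

(** Once the lower values vanish, every power of [H] contributes the same vector [H n.+1 0] to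
    E_{n+1} 0 = 0. Its total coefficient is 1 plus a sum of inverse factorials, which is
    positive. *)
Lemma H_zero n : H n 0 = 0.
Proof.
elim/ltn_ind: n => -[|n] IH; first exact: H0.
have h k : P k.+1 n.+1 0 = H n.+1 0.
  rewrite pow_tail big1 ?add0r => [|a _].
    by congr (H _ _); case: k => // k; rewrite pow_at0.
  by rewrite (pow_zero IH) ?IH //; have := ltn_ord a; lia.
have := exp_top n 0; rewrite (lin0 (Elin _)) [\sum_(a < n) _]big1 ?addr0; last first.
  by move=> a _; rewrite IH //; have := ltn_ord a; lia.
rewrite (eq_big_nat _ _ (F2 := fun k => (k`!%:R)^-1 *: H n.+1 0)); last first.
  by move=> -[|k] // _; rewrite h.
rewrite -scaler_suml -[X in X + _]scale1r -scalerDl => /esym/eqP.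
rewrite scaler_eq0 => /orP[|/eqP //]; rewrite gt_eqF //.
apply: ltr_wpDr; rewrite ?ltr01 // sumr_ge0 // => k _.
by rewrite invr_ge0 ler0n.
Qed.

(** The logarithm in recursive form: [H r.+1] is [E r.+1] minus products of lower terms, so
    linearity and commutation pass from [E] to [H] by induction. *)
Lemma H_top r v : H r.+1 v = E r.+1 v - \sum_(2 <= k < r.+2) (k`!%:R)^-1 *:
  \sum_(a < r) H a.+1 (P k.-1 (r - a)%N v).
Proof.
rewrite exp_top [\sum_(a < r) _]big1 ?addr0; last by move=> a _; apply: H_zero.
rewrite -[LHS]addr0 -addrA; congr (_ + _); apply/esym/eqP; rewrite subr_eq0; apply/eqP.
apply: eq_big_nat => -[|[|k]] // _; rewrite pow_tail pow_at0 H_zero addr0 //.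
Qed.

Lemma pow_lin n : (forall a, (a < n)%N -> lin (H a)) ->
  forall k r, (r < n)%N -> lin (P k r).
Proof.
move=> h; elim=> [|k IH] r rn c u v.
  by rewrite /= /ops_one; case: ifP => // _; rewrite scaler0 addr0.
rewrite !powS scaler_sumr -big_split; apply: eq_bigr => a _ /=.
have an : (a < n)%N by have := ltn_ord a; lia.
by rewrite IH ?(h a) //; lia.
Qed.

Lemma H_lin n : lin (H n).
Proof.
elim/ltn_ind: n => -[|n] IH; first by move=> c u v; rewrite !H0 scaler0 addr0.
move=> c u v; rewrite !H_top Elin scalerBr addrACA -opprD; congr (_ - _).
rewrite scaler_sumr -big_split; apply: eq_bigr => k _ /=.
rewrite scalerA mulrC -scalerA -scalerDr; congr (_ *: _).
rewrite scaler_sumr -big_split; apply: eq_bigr => a _ /=.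
have an := ltn_ord a; rewrite (pow_lin IH) ?IH //; lia.
Qed.

Lemma H_comm (G : V -> V) : lin G -> (forall r v, E r (G v) = G (E r v)) ->
  forall n v, H n (G v) = G (H n v).
Proof.
move=> linG GE; elim/ltn_ind => -[|n] IH v; first by rewrite !H0 (lin0 linG).
have PG k r w : (r < n.+1)%N -> P k r (G w) = G (P k r w).
  elim: k r => [|k IHk] r rn.
    by rewrite /= /ops_one; case: ifP => // _; rewrite (lin0 linG).
  rewrite !powS (lin_sum linG); apply: eq_bigr => a _.
  by rewrite IHk ?IH //; have := ltn_ord a; lia.
rewrite !H_top (linB linG) GE; congr (_ - _); rewrite (lin_sum linG).
apply: eq_bigr => k _; rewrite (linZ linG) (lin_sum linG); congr (_ *: _).
by apply: eq_bigr => a _; have an := ltn_ord a; rewrite PG ?IH //; lia.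
Qed.

Hypothesis Ecomm : forall r s v, E r (E s v) = E s (E r v).

Lemma H_commute n m v : H n (H m v) = H m (H n v).
Proof. by apply: H_comm; [exact: H_lin|move=> r w; apply/esym/H_comm]. Qed.

(** Coefficientwise z d/dz (H^{k+1}) = (k+1) (z dH/dz) H^k; the commutation of the [H a] is what
    allows the differentiated factor to be moved to the front. *)
Lemma pow_deriv k r v : r%:R *: P k.+1 r v
  = k.+1%:R *: \sum_(a < r.+1) a%:R *: H a (P k (r - a)%N v).
Proof.
elim: k r => [|k IH] r.
  rewrite powS scaler_sumr scale1r; apply: eq_bigr => a _ /=.
  rewrite /ops_one; case: eqP => [h|_]; last by rewrite H_zero !scaler0.
  by have -> : nat_of_ord a = r by have := ltn_ord a; lia.
set A := \sum_(a < _) _; rewrite powS scaler_sumr.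
have -> : \sum_(a < r.+1) r%:R *: H a (P k.+1 (r - a)%N v)
    = A + \sum_(a < r.+1) H a ((r - a)%:R *: P k.+1 (r - a)%N v).
  rewrite -big_split; apply: eq_bigr => a _ /=.
  by rewrite (linZ (H_lin a)) -scalerDl -natrD subnKC // -ltnS.
under eq_bigr => a _ do rewrite IH (linZ (H_lin a)) (lin_sum (H_lin a)).
rewrite -scaler_sumr.
rewrite (triangle_sym (fun a b => H a (b%:R *: H b (P k (r - a - b)%N v)))) -[k.+2]addn1 natrD scalerDl scale1r addrC; congr (_ *: _ + _).
apply: eq_bigr => b _.
rewrite powS (lin_sum (H_lin b)) scaler_sumr; apply: eq_bigr => a _.
by rewrite (linZ (H_lin a)) H_commute -subnDA addnC subnDA.
Qed.

Lemma pow_gt k r v : (r < k)%N -> P k r v = 0.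
Proof.
elim: k r => // k IH r rk; rewrite powS big1 // => -[[|a] ha] _ /=; first by rewrite H0.
by rewrite IH ?H_zero //; lia.
Qed.

Lemma exp_widen N r v : (r < N)%N -> \sum_(k < N) (k`!%:R)^-1 *: P k r v = E r v.
Proof.
move=> rN; rewrite EE /ops_exp (big_ord_widen _ (fun k => (k`!%:R)^-1 *: P k r v) rN).
rewrite [RHS]big_mkcond; apply: eq_bigr => i _; case: ltnP => // h.
by rewrite pow_gt ?scaler0.
Qed.

(** The differential equation z dE/dz = (z dH/dz) E, read on coefficients. *)
Lemma exp_deriv r v : r%:R *: E r v = \sum_(a < r.+1) a%:R *: H a (E (r - a)%N v).
Proof.
rewrite EE /ops_exp scaler_sumr big_ord_recl.
have -> : r%:R *: ((0`!%:R)^-1 *: P 0%N r v) = 0.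
  by rewrite /= /ops_one; case: eqP => [->|_]; rewrite ?scale0r ?scaler0.
rewrite add0r.
transitivity (\sum_(k < r) (k`!%:R)^-1 *: \sum_(a < r.+1) a%:R *: H a (P k (r - a)%N v)).
  apply: eq_bigr => k _; rewrite scalerA mulrC -scalerA.
  rewrite (_ : nat_of_ord (lift ord0 k) = k.+1) // pow_deriv scalerA; congr (_ *: _).
  rewrite factS natrM invfM mulrC mulrA mulfV ?mul1r // pnatr_eq0 //.
under eq_bigr do rewrite scaler_sumr.
rewrite exchange_big; apply: eq_bigr => -[[|a] ha] _ /=.
  by rewrite big1 ?scale0r // => k _; rewrite scale0r scaler0.
rewrite -(@exp_widen r) ?(lin_sum (H_lin _)) ?scaler_sumr; last by lia.
by apply: eq_bigr => k _; rewrite (linZ (H_lin _)) !scalerA mulrC.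
Qed.

Lemma exp0 v : E 0 v = v.
Proof. by rewrite EE /ops_exp big_ord1 invr1 scale1r. Qed.

(* Coefficients of (1 - b^-1 z) / (1 - b z), the exponential of
   \sum_(a > 0) (b^a - b^-a) z^a / a. *)
Definition gcoef (b : F) (t : nat) : F :=
  if t is t'.+1 then b ^+ t' * (b - b^-1) else 1.

(** The same differential equation for the scalar series of [gcoef], whose logarithmic derivative is
    the sum of the (b^a - b^-a) z^a. *)
Lemma gcoef_deriv b t : b != 0 -> t%:R * gcoef b t
  = \sum_(a < t.+1) (b ^+ a - b ^- a) * gcoef b (t - a)%N.
Proof.
move=> b0; elim: t => [|t IH]; first by rewrite big_ord1 !expr0 invr1 subrr !mul0r.
rewrite big_ord_recr /= subnn mulr1 big_ord_recr /=.
have -> : \sum_(i < t) (b ^+ i - b ^- i) * gcoef b (t.+1 - i)%N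
    = b * \sum_(i < t) (b ^+ i - b ^- i) * gcoef b (t - i)%N.
  rewrite mulr_sumr; apply: eq_bigr => i _; rewrite subSn; last exact: ltnW.
  have := ltn_ord i; rewrite -subn_gt0; case: (t - i)%N => // m _.
  by rewrite /= exprS; ring.
move: IH; rewrite big_ord_recr /= subnn mulr1.
move=> /esym/(canRL (addrK _)) ->; rewrite subSn // subnn /=.
case: t => [|t] /=.
  by rewrite !expr0 !expr1 invr1; ring.
rewrite -!exprVn -[t.+2%:R]natr1 !exprS.
have bb : b * b^-1 = 1 by rewrite mulfV.
have bt : b ^+ t * b^-1 ^+ t = 1 by rewrite -exprMn bb expr1n.
move: (b^-1) bb bt => c bb bt.
rewrite mulrDl mul1r; move: (b ^+ t) (c ^+ t) bt => B C bt.
have -> : b * (t.+1%:R * (B * (b - c)) - (b * B - c * C))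
  = t.+1%:R * (b * B * (b - c)) - (b * (b * B) - (b * c) * C) by ring.
have -> : (b * B - c * C) * (b ^+ 0 * (b - c))
  = b * (b * B) - (b * c) * B - (b * c) * C + c * (c * C) by rewrite expr0; ring.
rewrite bb; have -> : b * B * (b - c) = b * (b * B) - (b * c) * B by ring.
by rewrite bb; ring.
Qed.

Section Exchange.
Variables (b : F) (e : int) (x : int -> V -> V).
Hypothesis b0 : b != 0.
Hypothesis xlin : forall s, lin (x s).
Hypothesis Hx : forall a s v, a%:R *: (H a (x s v) - x s (H a v))
  = (b ^+ a - b ^- a) *: x (s + e * a%:Z) v.

(** Induction on [r] through [exp_deriv], which expresses r E_r by the E_{r-a} with a > 0;
    characteristic 0 allows division by r. *)
Lemma exp_exchange r s v : E r (x s v)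
  = \sum_(t < r.+1) gcoef b t *: x (s + e * t%:Z) (E (r - t)%N v).
Proof.
elim/ltn_ind: r s v => -[|r] IH s v.
  by rewrite big_ord1 !exp0 scale1r mulr0 addr0.
set Q := r.+1; have Q0 : Q%:R != 0 :> F by rewrite pnatr_eq0.
apply: (scalerI Q0); rewrite exp_deriv.
transitivity (\sum_(a < Q.+1) \sum_(t < (Q - a).+1)
   (gcoef b t *: x (s + e * t%:Z) (a%:R *: H a (E (Q - a - t)%N v))
   + ((b ^+ a - b ^- a) * gcoef b t) *: x (s + e * (a + t)%:Z) (E (Q - a - t)%N v))).
  apply: eq_bigr => -[[|a] ha] _ /=.
    rewrite scale0r big1 // => t _.
    by rewrite scale0r (lin0 (xlin _)) scaler0 expr0 invr1 subrr mul0r scale0r addr0.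
  rewrite IH; last by rewrite /Q; lia.
  rewrite (lin_sum (H_lin _)) scaler_sumr; apply: eq_bigr => t _.
  rewrite (linZ (H_lin _)) (linZ (xlin _)) [_ * gcoef b t]mulrC.
  rewrite -[(gcoef b t * _) *: x _ _]scalerA -scalerDr.
  rewrite [_ *: (gcoef b t *: _)]scalerA [_ * gcoef b t]mulrC -scalerA; congr (_ *: _).
  apply/eqP; rewrite [X in _ == X]addrC -subr_eq -scalerBr Hx; apply/eqP.
  by congr (_ *: x _ _); lia.
under eq_bigr do rewrite big_split.
(* In the first sum, for fixed [t], [exp_deriv] resums the terms to [Q - t] times [E (Q - t)]; in
   the second, [gcoef_deriv] gives the factor [t]. The two weights add up to [Q]. *)
rewrite big_split /= (triangle_sym (fun a t =>
   gcoef b t *: x (s + e * t%:Z) (a%:R *: H a (E (Q - a - t)%N v)))).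
rewrite (triangle_diag (fun a t => ((b ^+ a - b ^- a) * gcoef b t) *:
   x (s + e * (a + t)%:Z) (E (Q - a - t)%N v))).
rewrite -big_split scaler_sumr; apply: eq_bigr => t _ /=.
have tQ : (t <= Q)%N by rewrite -ltnS.
rewrite -scaler_sumr -(lin_sum (xlin _)).
have -> : \sum_(a < (Q - t).+1) a%:R *: H a (E (Q - a - t)%N v) = (Q - t)%:R *: E (Q - t)%N v.
  by rewrite exp_deriv; apply: eq_bigr => a _; rewrite -!subnDA addnC.
rewrite (linZ (xlin _)).
have -> : \sum_(a < t.+1) ((b ^+ a - b ^- a) * gcoef b (t - a)) *:
     x (s + e * (a + (t - a))%:Z) (E (Q - a - (t - a))%N v)
   = (t%:R * gcoef b t) *: x (s + e * t%:Z) (E (Q - t)%N v).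
  rewrite gcoef_deriv // scaler_suml; apply: eq_bigr => a _.
  have at' : (a <= t)%N by rewrite -ltnS.
  by rewrite subnKC // -subnDA subnKC.
rewrite !scalerA -scalerDl; congr (_ *: _).
by rewrite mulrC -mulrDl -natrD subnK // mulrC.
Qed.

End Exchange.
End Exponential.

(* Contrary to [simple_datum], these properties are inherited by every J. *)
Record good_datum (F : fieldType) (K : finType) (D : datum F K) : Prop := {
  gd_q0 : qpar D != 0;
  gd_q : not_root_of_unity (qpar D);
  gd_dpos : forall i, (0 < dsym D i)%N;
  gd_diag : forall i, cart D i i = 2;
  gd_nondeg : forall x : K -> int,
    (forall j, \sum_i x i * cart D j i = 0) -> forall i, x i = 0
}.

Section Datum.
Variables (F : fieldType) (K : finType) (D : datum F K).
Hypothesis gD : good_datum D.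

Lemma qi_neq0 i : qi D i != 0.
Proof. by rewrite expf_neq0 ?(gd_q0 gD). Qed.

Lemma qi_expz_eq1 i (m : int) : qi D i ^ m = 1 -> m = 0.
Proof.
have nat_case (k : nat) : qi D i ^+ k = 1 -> k = 0%N.
  case: k => // k; rewrite /qi -exprM => /eqP h.
  have := gd_q gD (m := (dsym D i * k.+1)%N); rewrite h muln_gt0 (gd_dpos gD) /=.
  by move/(_ isT).
case: m => m; first by move/nat_case => ->.
rewrite NegzE -exprz_inv => h; have: qi D i ^+ m.+1 = 1.
  by apply: invr_inj; rewrite invr1 -exprVn.
by move/nat_case.
Qed.

Lemma qi_subV i : qi D i - (qi D i)^-1 != 0.
Proof.
rewrite subr_eq0; apply/eqP => h.
have : qi D i ^ (2 : int) = 1 by rewrite -exprnP expr2 {2}h mulfV ?qi_neq0.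
by move/qi_expz_eq1.
Qed.

End Datum.

Section Commutation.
Variables (F : numFieldType) (K : finType) (D : datum F K).
Hypothesis gD : good_datum D.
Variables (nu : {ffun K -> int}) (V : qmodule D nu).

Lemma phi_comm e e' i j r s (v : V) :
  mphi V e i r (mphi V e' j s v) = mphi V e' j s (mphi V e i r v).
Proof. exact: rel_phi_comm (mrel V) _ _ _ _ _ _ _. Qed.

Lemma phi_lead_inj e i : injective (mphi V e i (lead nu e i)).
Proof. exact: bij_inj (rel_phi_inv (mrel V) e i). Qed.

Lemma phi_x_lead e e' i j r (v : V) :
  mphi V e i (lead nu e i) (mx V e' j r v)
  = qi D i ^ (sg e * sg e' * cart D i j) *: mx V e' j r (mphi V e i (lead nu e i) v).
Proof. exact: rel_phi_x (mrel V) _ _ _ _ _ _. Qed.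

Lemma phi_neg0 i r (v : V) : r < 0 -> mphi V true i r v = 0.
Proof. exact: rel_phi_pos0 (mrel V) _ _ _. Qed.

Lemma phi_pos0 i r (v : V) : nu i < r -> mphi V false i r v = 0.
Proof. exact: rel_phi_neg0 (mrel V) _ _ _. Qed.

Lemma x_comm i j r s (v : V) :
  (qi D i - (qi D i)^-1)
    *: (mx V true i r (mx V false j s v) - mx V false j s (mx V true i r v))
  = if i == j then mphi V true i (r + s) v - mphi V false j (r + s) v else 0.
Proof. exact: rel_xpxm (mrel V) _ _ _ _ _. Qed.

(** The leading mode of phi contributes the factor [b] and the exponential the coefficients
    [gcoef b]. In the bracket of h_{i,m} with x the sign [e] of the series cancels that of 1/m,
    leaving b^a - b^-a. *)
Lemma phi_x_series e e' i j (r : nat) s (v : V) :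
  let b := qi D i ^ (sg e * sg e' * cart D i j) in
  mphi V e i (lead nu e i + sg e * r%:Z) (mx V e' j s v) =
  b *: \sum_(t < r.+1) gcoef b t *: mx V e' j (s + sg e * t%:Z)
    (mphi V e i (lead nu e i + sg e * (r - t)%:Z) v).
Proof.
move=> b; have [h [hE hX]] := rel_h (mrel V).
pose H := hseries D h e i; pose E := @ops_exp F V H.
have PE k w : mphi V e i (lead nu e i + sg e * k%:Z) w = mphi V e i (lead nu e i) (E k w).
  exact: hE.
(* [E] is defined by bare functions; it becomes linear and commutative by cancelling the injective
   leading mode in the corresponding properties of phi. *)
have inj := @phi_lead_inj e i.
have Elin k : lin (E k).
  by move=> c u w; apply: inj; rewrite linearP -!PE linearP.
have Ecomm k l w : E k (E l w) = E l (E k w).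
  apply: (inj); rewrite -!PE; apply: (inj).
  by rewrite [LHS]phi_comm [RHS]phi_comm -!PE phi_comm.
have b0 : b != 0 by rewrite expfz_neq0 ?qi_neq0.
have Hx a t w : a%:R *: (H a (mx V e' j t w) - mx V e' j t (H a w))
    = (b ^+ a - b ^- a) *: mx V e' j (t + sg e * a%:Z) w.
  case: a => [|a]; first by rewrite scale0r expr0 invr1 subrr scale0r.
  rewrite /H /hseries /= linearZ -scalerBr hX; last by rewrite mulf_neq0 //; case: (e).
  rewrite (addrC t) !scalerA; congr (_ *: _).
  have e1 : ((sg e)%:~R : F) * (sg e)%:~R^-1 = 1 by case: (e); rewrite ?divff ?oppr_eq0 ?oner_eq0.
  have a0 : a.+1%:R != 0 :> F by rewrite pnatr_eq0.
  rewrite /qint /b intrM -[(a.+1%:Z)%:~R]/(a.+1%:R) invfM.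
  have q0 := qi_subV gD i.
  set A := _ ^ (_ * _) - _; set B := qi D i - _ in q0 *.
  have -> : a.+1%:R * ((sg e)%:~R * B) * ((sg e')%:~R * ((sg e)%:~R^-1 / a.+1%:R) * (A / B))
     = (a.+1%:R / a.+1%:R) * ((sg e)%:~R * (sg e)%:~R^-1) * (B / B) * (sg e')%:~R * A by ring.
  rewrite e1 !divff // !mul1r /A exprnN exprnP !exprz_exp.
  have -> : sg e * sg e' * cart D i j * a.+1 = sg e' * (sg e * a.+1 * cart D i j) by ring.
  have -> : sg e * sg e' * cart D i j * - a.+1%:Z = - (sg e' * (sg e * a.+1 * cart D i j)) by ring.
  case: (e') => /=; rewrite ?mul1r // !mulN1r opprK.
  by rewrite opprB.
have xlin t : lin (mx V e' j t) by exact: linear_lin.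
have XE := exp_exchange (fun _ => erefl) (fun _ _ => erefl) Elin Ecomm b0 xlin Hx r s v.
rewrite PE [E r _]XE.
rewrite raddf_sum scaler_sumr; apply: eq_bigr => t _.
rewrite [in RHS]PE [LHS]linearZ /= phi_x_lead -/b !scalerA mulrC.
by [].
Qed.

(** The denominator 1 - b z is cleared: gcoef(t+1) = b gcoef(t) for t > 0, so the two series
    telescope to their first terms. *)
Lemma phi_x_rel e e' i j (r : nat) s (v : V) :
  let b := qi D i ^ (sg e * sg e' * cart D i j) in
  mphi V e i (lead nu e i + sg e * r.+1%:Z) (mx V e' j s v)
  - b *: mphi V e i (lead nu e i + sg e * r%:Z) (mx V e' j (s + sg e) v)
  = b *: mx V e' j s (mphi V e i (lead nu e i + sg e * r.+1%:Z) v)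
  - mx V e' j (s + sg e) (mphi V e i (lead nu e i + sg e * r%:Z) v).
Proof.
move=> b; have b0 : b != 0 by rewrite expfz_neq0 ?qi_neq0.
rewrite !phi_x_series -/b big_ord_recl /= scale1r mulr0 addr0 subn0 scalerDr.
rewrite -addrA; congr (_ + _); rewrite -scalerBr scaler_sumr -sumrB big_ord_recl /=.
rewrite [X in _ + X]big1 ?addr0 => [|t _].
  rewrite /bump /= subSS !mulr1 mulr0 addr0 scale1r expr0 mul1r -scalerBl scalerA.
  by rewrite subn0 [b - _ - _]addrAC subrr add0r mulrN mulfV // scaleN1r.
rewrite scalerA /bump /= subSS.
have -> : s + sg e + sg e * (1 + t)%N = s + sg e * (1 + (1 + t))%N by lia.
by rewrite -scalerBl add1n add1n /= exprS mulrA subrr scale0r.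
Qed.

End Commutation.

(** * Roots and weights *)

Section Tuples.
Variables (K : finType) (T : fieldType).
Implicit Types f g h : {ffun K -> T}.

Lemma tmulA f g h : tmul f (tmul g h) = tmul (tmul f g) h.
Proof. by apply/ffunP => k; rewrite !ffunE mulrA. Qed.

Lemma tmulC f g : tmul f g = tmul g f.
Proof. by apply/ffunP => k; rewrite !ffunE mulrC. Qed.

Lemma tmulVK f g : (forall k, f k != 0) -> tmul (tinv f) (tmul f g) = g.
Proof. by move=> f0; apply/ffunP => k; rewrite !ffunE mulKf. Qed.

Lemma tmulKV f g : (forall k, f k != 0) -> tmul f (tmul (tinv f) g) = g.
Proof. by move=> f0; apply/ffunP => k; rewrite !ffunE mulVKf. Qed.

Lemma tmulI f g h : (forall k, f k != 0) -> tmul f g = tmul f h -> g = h.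
Proof. by move=> f0 e; rewrite -(tmulVK g f0) e tmulVK. Qed.

Lemma tinvK f : tinv (tinv f) = f.
Proof. by apply/ffunP => k; rewrite !ffunE invrK. Qed.

Lemma tmul_mono0 f (X : Type) (u : X -> {ffun K -> T}) : tmul f (mono u [::]) = f.
Proof. by apply/ffunP => k; rewrite !ffunE big_nil mulr1. Qed.

Lemma mono_cons (X : Type) (u : X -> {ffun K -> T}) x m :
  mono u (x :: m) = tmul (u x) (mono u m).
Proof. by apply/ffunP => k; rewrite !ffunE big_cons. Qed.

End Tuples.

Lemma in_t_rel (K : finType) (T : fieldType) (f g : {ffun K -> T}) :
  in_t f -> in_t g -> in_t (tmul f g).
Proof. by move=> hf hg k; rewrite ffunE mulf_neq0. Qed.

Section Roots.
Variables (F : fieldType) (K : finType) (D : datum F K).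
Hypothesis gD : good_datum D.

Lemma rootwE (a : K -> int) j : rootw D a j = qi D j ^ (\sum_i a i * cart D j i).
Proof.
rewrite ffunE; elim/big_rec2: _ => [|i y x _ ->]; first by rewrite expr0z.
by rewrite expfzDr ?qi_neq0.
Qed.

Lemma rootw_in_t a : in_t (rootw D a).
Proof. by move=> j; rewrite rootwE expfz_neq0 ?qi_neq0. Qed.

Lemma rootwD a b : tmul (rootw D a) (rootw D b) = rootw D (fun i => a i + b i).
Proof.
apply/ffunP => j; rewrite ffunE !rootwE -expfzDr ?qi_neq0 //; congr (_ ^ _).
by rewrite -big_split; apply: eq_bigr => i _; rewrite mulrDl.
Qed.

Lemma rootw_ext a b : a =1 b -> rootw D a = rootw D b.
Proof. by move=> h; apply/ffunP => j; rewrite !rootwE; under eq_bigr do rewrite h. Qed.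

(** A power of q_j equal to 1 has exponent 0, so the difference of [a] and [b] lies in the kernel of
    the Cartan matrix. *)
Lemma rootw_inj a b : rootw D a = rootw D b -> a =1 b.
Proof.
move=> h i; apply/eqP; rewrite -subr_eq0; apply/eqP.
apply: (gd_nondeg gD (x := fun i => a i - b i)) => j.
apply: (qi_expz_eq1 gD (i := j)).
have -> : \sum_i (a i - b i) * cart D j i
   = (\sum_i a i * cart D j i) + - (\sum_i b i * cart D j i).
  by rewrite -sumrN -big_split; apply: eq_bigr => k _; rewrite mulrBl.
rewrite expfzDr ?qi_neq0 // -invr_expz -!rootwE h mulfV //.
by rewrite rootw_in_t.
Qed.

(** The weight [-alpha_{io j}], written componentwise to serve as the parameter [b] of [Ap]. *)
Definition nroot (X : Type) (io : X -> K) (j : X) : {ffun K -> F} :=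
  [ffun k => qi D k ^ (- cart D k (io j))].

Variables (X : Type) (io : X -> K).

Lemma nrootE j : nroot io j = rootw D (fun i => - (i == io j)%:Z).
Proof.
apply/ffunP => k; rewrite rootwE ffunE; congr (_ ^ _).
rewrite (bigD1 (io j)) //= eqxx mulN1r big1 ?addr0 // => i /negbTE ->.
by rewrite oppr0 mul0r.
Qed.

Lemma mono_nroot m : mono (nroot io) m
  = rootw D (fun i => - (count (fun j => io j == i) m)%:Z).
Proof.
elim: m => [|j m IH].
  apply/ffunP => k; rewrite rootwE ffunE big_nil big1 ?expr0z // => i _.
  by rewrite oppr0 mul0r.
rewrite mono_cons IH nrootE rootwD; apply: rootw_ext => i /=.
by rewrite PoszD opprD eq_sym.
Qed.

Lemma mono_nroot_in_t m : in_t (mono (nroot io) m).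
Proof. by rewrite mono_nroot; apply: rootw_in_t. Qed.

Lemma rootwN a : tinv (rootw D a) = rootw D (fun i => - a i).
Proof.
apply/ffunP => k; rewrite ffunE !rootwE invr_expz -sumrN; congr (_ ^ _).
by apply: eq_bigr => i _; rewrite mulNr.
Qed.

Lemma wleE g g' : in_t g -> in_t g' -> wle D g g' <->
  exists a : K -> nat, g = tmul g' (rootw D (fun i => - (a i)%:Z)).
Proof.
move=> h h'; split=> -[a E]; exists a.
  apply/ffunP => k; rewrite -rootwN -E !ffunE invfM invrK mulrA mulfV ?mul1r //.
rewrite E -rootwN; apply/ffunP => k; rewrite ffunE [tinv (tmul _ _) _]ffunE [tmul _ _ _]ffunE.
by rewrite [tinv _ _]ffunE invfM invrK mulrA mulfV // mul1r.
Qed.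

Lemma wle_mono_nroot (lam : {ffun K -> F}) m : in_t lam ->
  wle D (tmul lam (mono (nroot io) m)) lam.
Proof.
move=> l0; apply/wleE => //; first by apply: in_t_rel (mono_nroot_in_t m).
by exists (fun i => count (fun j => io j == i) m); rewrite mono_nroot.
Qed.

Lemma mono_nroot_perm m m' : mono (nroot io) m = mono (nroot io) m' ->
  forall i, count (fun j => io j == i) m = count (fun j => io j == i) m'.
Proof. by rewrite !mono_nroot => /rootw_inj h i; have := h i; lia. Qed.

(** For a node [i] occurring in neither monomial both counts are 0 and [e] must vanish; this is what
    excludes a nonzero action of x_i outside J. *)
Lemma mono_nroot_shift m m' i (e : int) :
  tmul (mono (nroot io) m) (rootw D (fun k => e * (k == i)%:Z)) = mono (nroot io) m' ->
  (count (fun j => io j == i) m)%:Z = (count (fun j => io j == i) m')%:Z + e.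
Proof.
by rewrite !mono_nroot rootwD => /rootw_inj/(_ i); rewrite eqxx; lia.
Qed.

End Roots.

Section RootOrder.
Variables (F : fieldType) (K : finType) (D : datum F K).
Hypothesis gD : good_datum D.

Lemma wle_anti g g' : in_t g -> in_t g' -> wle D g g' -> wle D g' g -> g = g'.
Proof.
move=> h h' /(wleE gD h h')[a ->] /(wleE gD h' (in_t_rel h' (rootw_in_t gD _)))[b].
rewrite -tmulA (rootwD gD) -[LHS](tmul_mono0 _ (nroot D id)) => /(tmulI h').
rewrite (mono_nroot gD) => /(rootw_inj gD) E; rewrite (_ : rootw D _ = mono (nroot D id) [::]).
  by rewrite tmul_mono0.
by rewrite (mono_nroot gD); apply: (rootw_ext gD) => i; have := E i; rewrite /=; lia.
Qed.

End RootOrder.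

(** * l-weight spaces as generalized eigenspaces *)

Section LweightSpaces.
Variables (F : fieldType) (K : finType) (D : datum F K).
Variables (nu : {ffun K -> int}) (V : qmodule D nu).

Definition phi_plus (k : K * nat) : {linear V -> V} := mphi V true k.1 k.2%:Z.

Definition theta (Psi : {ffun K -> ratfun F}) (k : K * nat) : F := ser (Psi k.1) k.2.

Lemma phi_plus_comm k l (v : V) :
  phi_plus k (phi_plus l v) = phi_plus l (phi_plus k v).
Proof. exact: rel_phi_comm (mrel V) _ _ _ _ _ _ _. Qed.

Lemma lspaceP Psi v : in_r Psi -> lspace Psi v <-> jgen phi_plus (theta Psi) v.
Proof.
move=> hP; split=> [[c hc [p hp]]|[p hp]].
  exists p => -[j r]; have /= := hp j r; rewrite /theta /=.
  by rewrite (ser_uniq (hc j)).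
exists (fun j => ser (Psi j)); first by move=> j; apply: serP.
by exists p => j r; have := hp (j, r).
Qed.

Lemma lspace_subspace Psi : in_r Psi -> subspace (@lspace _ _ _ _ V Psi).
Proof.
move=> hP; have hj := jgen_subspace phi_plus (theta Psi); split=> *.
- by apply/lspaceP => //; apply: subspace0.
- by apply/lspaceP => //; apply: subspaceD => //; apply/lspaceP.
- by apply/lspaceP => //; apply: subspaceZ => //; apply/lspaceP.
Qed.

Lemma theta_inj Psi Psi' : in_r Psi -> in_r Psi' -> theta Psi = theta Psi' -> Psi = Psi'.
Proof.
move=> h h' E; apply/ffunP => i; apply: ser_inj => // k.
by have := congr1 (fun f => f (i, k)) E.
Qed.

Lemma in_r_tmul (Psi Phi : {ffun K -> ratfun F}) :
  in_r Psi -> in_r Phi -> in_r (tmul Psi Phi).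
Proof. by move=> h h' k; rewrite ffunE; apply: regularM. Qed.

Lemma in_r_mono (X : Type) (u : X -> {ffun K -> ratfun F}) m :
  (forall x, in_r (u x)) -> in_r (mono u m).
Proof.
move=> h k; rewrite ffunE; elim/big_rec: _ => [|x y _ hy]; first exact: regular1.
by apply: regularM => //; apply: h.
Qed.

End LweightSpaces.

(** The closed form of A_{io j, a}^{-1}. Its agreement with the definition of [A] through the Y's is
    a fact about finite type Cartan matrices, shown in [tinv_A]. *)
Definition Aroot (F : fieldType) (K : finType) (D : datum F K) (X : Type) (io : X -> K)
  (x : X * {a : F | a != 0}) : {ffun K -> ratfun F} :=
  [ffun k => Ap (nroot D io x.1 k) (val x.2)].

(* The letters [X] are sent to nodes by [io]: the development is used both for
   modules over the algebra attached to J (with [io] the identity) and for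
   modules over the large algebra on which only J acts nontrivially. *)
Section Cyclic.
Variables (F : numClosedFieldType) (K : finType) (D : datum F K).
Hypothesis gD : good_datum D.
Variables (nu : {ffun K -> int}) (V : qmodule D nu).
Variables (X : Type) (io : X -> K).
Hypothesis cover : forall k,
  (exists j, io j = k) \/ (forall r v, mx V false k r v = 0).
Variables (v0 : V) (c : bool -> K -> int -> F).
Hypothesis v00 : v0 != 0.
Hypothesis xp0 : forall i r, mx V true i r v0 = 0.
Hypothesis phi0 : forall e i r, mphi V e i r v0 = c e i r *: v0.

Local Notation xm j := (mx V false (io j)).

Fixpoint low (m : seq X) : V -> Prop :=
  if m is j :: m' then sums (fun w => exists r u, low m' u /\ w = xm j r u)
  else fun w => exists a, w = a *: v0.

Lemma low_subspace m : subspace (low m).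
Proof.
elim: m => [|j m IH] /=.
  split=> [|u v [a ->] [b ->]|b v [a ->]].
  - by exists 0; rewrite scale0r.
  - by exists (a + b); rewrite scalerDl.
  - by exists (b * a); rewrite scalerA.
apply: sums_subspace => a v [r [u [hu ->]]]; exists r, (a *: u).
by rewrite linearZ /=; split=> //; apply: subspaceZ.
Qed.

Lemma low_x j m r w : low m w -> low (j :: m) (xm j r w).
Proof. by move=> h; apply: sums1; exists r, w. Qed.

Lemma phi_index e i k : (exists n : nat, k = lead nu e i + sg e * n%:Z) \/
  forall v : V, mphi V e i k v = 0.
Proof.
case: e; rewrite /lead /sg.
  have [k0|k0] := ltP k 0; first by right=> v; apply: phi_neg0.
  by left; exists (absz k); lia.
have [k0|k0] := ltP (nu i) k; first by right=> v; apply: phi_pos0.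
by left; exists (absz (nu i - k)%R); lia.
Qed.

Lemma low_phi e i k m w : low m w -> low m (mphi V e i k w).
Proof.
elim: m k w => [|j m IH] k w.
  by move=> [a ->]; exists (a * c e i k); rewrite linearZ /= phi0 scalerA.
have hs := low_subspace (j :: m).
apply: (sums_min (S := fun w => low (j :: m) (mphi V e i k w))).
  split=> [|u v|a v]; rewrite ?linear0 ?linearD ?linearZ.
  - exact: subspace0.
  - exact: subspaceD.
  - exact: subspaceZ.
move=> _ [s [u [hu ->]]].
have [[n ->]|->] := phi_index e i k; last exact: subspace0.
(* Induction on the distance from the leading mode: the exchange relation trades mode n+1 on x_s for
   mode n on a neighbouring x, up to terms in which phi already acts on the shorter word. *)
elim: n s => [|n IHn] s.
  rewrite mulr0 addr0 phi_x_lead; apply: subspaceZ => //.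
  by apply: low_x; apply: IH.
have := phi_x_rel gD e false i (io j) n s u; move/(canRL (subrK _)) => ->.
apply: subspaceD => //; last by apply: subspaceZ => //; apply: IHn.
by apply: subspaceB => //; [apply: subspaceZ => //|]; apply: low_x; apply: IH.
Qed.

Lemma c_lead_neq0 e i : c e i (lead nu e i) != 0.
Proof.
apply: contraNneq v00 => h; apply/eqP; apply: (@phi_lead_inj _ _ _ _ V e i).
by rewrite phi0 h scale0r linear0.
Qed.

Definition low_scalar e i m := c e i (lead nu e i)
  * \prod_(j <- m) qi D i ^ (- sg e * cart D i (io j)).

Lemma low_scalar_neq0 e i m : low_scalar e i m != 0.
Proof.
rewrite mulf_neq0 ?c_lead_neq0 //; elim/big_rec: _ => [|j y _ hy].
  by rewrite oner_eq0.
by rewrite mulf_neq0 ?expfz_neq0 ?qi_neq0.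
Qed.

Lemma low_lead e i m w : low m w ->
  mphi V e i (lead nu e i) w = low_scalar e i m *: w.
Proof.
elim: m w => [|j m IH] w.
  move=> [a ->]; rewrite linearZ /= phi0 /low_scalar big_nil mulr1.
  by rewrite !scalerA mulrC.
apply: (sums_min (S := fun w => mphi V e i (lead nu e i) w = low_scalar e i (j :: m) *: w)).
  split=> [|u v hu hv|a v hv]; first by rewrite linear0 scaler0.
    by rewrite linearD hu hv scalerDr.
  by rewrite linearZ /= hv !scalerA mulrC.
move=> _ [s [u [hu ->]]]; rewrite phi_x_lead IH // linearZ /= scalerA; congr (_ *: _).
by rewrite /low_scalar big_cons /= mulrN1 mulrCA.
Qed.

Definition top_weight : {ffun K -> F} := [ffun i => c true i 0].

Lemma low_wspace m w : low m w ->
  wspace true (tmul top_weight (mono (nroot D io) m)) w.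
Proof.
move=> h i; rewrite (low_lead _ _ h) /sg expr1z !ffunE; congr (_ * _ *: _).
by apply: eq_bigr => j _; rewrite ffunE mulN1r.
Qed.

Definition lows : V -> Prop := sums (fun w => exists m, low m w).

Lemma lows_subspace : subspace lows.
Proof.
by apply: sums_subspace => a v [m hm]; exists m; apply: subspaceZ => //; apply: low_subspace.
Qed.

Lemma lows_map (f : {linear V -> V}) :
  (forall m w, low m w -> lows (f w)) -> forall w, lows w -> lows (f w).
Proof. by move=> h; apply: sums_map => w [m hm]; apply: h hm. Qed.

Lemma lows_xm k r w : lows w -> lows (mx V false k r w).
Proof.
apply: lows_map => m u hu; have [[j <-]|->] := cover k; last exact: sums0.
by apply: sums1; exists (j :: m); apply: low_x.
Qed.

Lemma low_xp i r m w : low m w -> lows (mx V true i r w).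
Proof.
elim: m w => [|j m IH] w.
  by move=> [a ->]; rewrite linearZ /= xp0 scaler0; apply: sums0.
have hs := lows_subspace.
apply: (sums_min (S := fun w => lows (mx V true i r w))).
  split=> [|u v|a v]; rewrite ?linear0 ?linearD ?linearZ.
  - exact: subspace0.
  - exact: subspaceD.
  - exact: subspaceZ.
move=> _ [s [u [hu ->]]]; have := x_comm i (io j) r s u.
move=> /(canRL (scalerK (qi_subV gD i))) /(canRL (subrK _)) ->.
apply: subspaceD => //; last by apply: lows_xm; apply: IH.
apply: subspaceZ => //; case: ifP => _; last exact: sums0.
by apply: subspaceB => //; apply: sums1; exists m; apply: low_phi.
Qed.

(** The leading mode acts on each [low m] by a nonzero scalar, so it maps [lows] onto itself;
    injectivity on all of [V] does the rest. *)
Lemma lows_lead_inv e i w : lows (mphi V e i (lead nu e i) w) -> lows w.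
Proof.
have pre u : lows u -> exists2 u', lows u' & mphi V e i (lead nu e i) u' = u.
  elim=> [|u1 u2 [m hm] _ [u' hu' <-]]; first by exists 0; [exact: sums0|rewrite linear0].
  exists ((low_scalar e i m)^-1 *: u1 + u').
    apply: sumsS => //; exists m; apply: subspaceZ => //; exact: low_subspace.
  rewrite linearD linearZ /= (low_lead _ _ hm) scalerA mulVf ?low_scalar_neq0 //.
  by rewrite scale1r.
by move/pre => [u' hu' /phi_lead_inj <-].
Qed.

Lemma lows_submodule : submodule lows.
Proof.
split.
- exact: sums0.
- by move=> *; apply: sumsD.
- by move=> *; apply: subspaceZ => //; apply: lows_subspace.
- by case=> i r v; [apply: lows_map => m w; apply: low_xp|apply: lows_xm].
- move=> e i r v; apply: lows_map => m w hm; apply: sums1.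
  by exists m; apply: low_phi.
- exact: lows_lead_inv.
Qed.

Lemma v0_lows : lows v0.
Proof. by apply: sums1; exists [::], 1; rewrite scale1r. Qed.

Section Lweights.
Variable Psi0 : {ffun K -> ratfun F}.
Hypothesis Psi0r : in_r Psi0.
Hypothesis cPsi : forall i (r : nat), c true i r = ser (Psi0 i) r.
Hypothesis fd : forall m, exists n, has_dim (low m) n.

Local Notation Ar := (Aroot D io).

Lemma Aroot_in_r x : in_r (Ar x).
Proof. by move=> k; rewrite ffunE; apply: Ap_regular; rewrite ffunE expfz_neq0 ?qi_neq0. Qed.

Lemma Psi0_mono_in_r mm : in_r (tmul Psi0 (mono Ar mm)).
Proof. by apply: in_r_tmul => //; apply: in_r_mono Aroot_in_r. Qed.

Lemma phi_plus_x i (n : nat) j s v :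
  let b := nroot D io j i in
  phi_plus V (i, n.+1) (xm j s v) - b *: phi_plus V (i, n) (xm j (s + 1) v)
  = b *: xm j s (phi_plus V (i, n.+1) v) - xm j (s + 1) (phi_plus V (i, n) v).
Proof.
move=> b; have := phi_x_rel gD true false i (io j) n s v.
by rewrite /b /phi_plus ffunE /= !mul1r !add0r mulN1r.
Qed.

Lemma phi_plus_x0 i j s v :
  phi_plus V (i, 0%N) (xm j s v) = nroot D io j i *: xm j s (phi_plus V (i, 0%N) v).
Proof.
have := phi_x_lead true false i (io j) s v.
by rewrite /phi_plus ffunE /= mul1r mulN1r.
Qed.

Lemma low_lspaces m w : low m w -> sums (fun u => low m u /\
  exists mm, lspace (tmul Psi0 (mono Ar mm)) u) w.
Proof.
elim: m w => [|j m IH] w.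
  move=> hw; apply: sums1; split=> //; exists [::]; case: hw => a ->.
  rewrite tmul_mono0; apply/lspaceP => //.
  apply: (subspaceZ (jgen_subspace _ _)); apply: jgen_eigen => -[i n].
  by rewrite /phi_plus phi0 cPsi.
set S := low (j :: m); set R := fun u => S u /\ _; pose L := sums R.
have [n dS] := fd (j :: m); have hS : subspace S := low_subspace _.
have TS k v : S v -> S (phi_plus V k v) by apply: low_phi.
have hL : subspace L.
  apply: sums_subspace => a v [Sv [mm hv]]; split; first exact: subspaceZ.
  by exists mm; apply: subspaceZ => //; apply: lspace_subspace; apply: Psi0_mono_in_r.
have TL k v : S v -> L v -> L (phi_plus V k v).
  move=> _; apply: sums_map => u [Su [mm hu]]; apply: sums1; split; first exact: TS.
  exists mm; apply/lspaceP; first exact: Psi0_mono_in_r.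
  apply: jgen_comm; first exact: linear_lin.
    by move=> l x; apply: phi_plus_comm.
  by apply/lspaceP => //; apply: Psi0_mono_in_r.
suff: forall v, S v -> L v by apply.
apply: contrapT => SL.
have [xi [th [xilin xiL [y Sy xiy] xith]]] := eigen_functional (@phi_plus_comm _ _ _ _ V) hS dS TS hL TL SL.
have xi0 : xi 0 = 0.
  have := xilin (- 1) 0 0 (subspace0 hS) (subspace0 hS).
  by rewrite scaler0 addr0 mulN1r addrC subrr.
have xiD u v : S u -> S v -> xi (u + v) = xi u + xi v.
  by move=> Su Sv; rewrite -[u]scale1r xilin // mul1r scale1r.
have xiZ a u : S u -> xi (a *: u) = a * xi u.
  by move=> Su; rewrite -[_ *: _]addr0 xilin ?xi0 ?addr0 //; apply: subspace0.
have xiB u v : S u -> S v -> xi (u - v) = xi u - xi v.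
  by move=> Su Sv; rewrite -scaleN1r xiD ?xiZ ?mulN1r //; apply: subspaceZ.
have Sx r u : low m u -> S (xm j r u) by apply: low_x.
(* For an l-weight vector [u] of [low m], the exchange relation makes
   [xi (x_s u)] a geometric progression in [s]; its ratio is the parameter of the
   extra factor A^-1. *)
have [mm [u1 [r1 [hu1 lu1 xu1]]]] : exists mm u r,
    [/\ low m u, lspace (tmul Psi0 (mono Ar mm)) u & xi (xm j r u) != 0].
  apply: contrapT => no.
  have z r u : low m u -> xi (xm j r u) = 0.
    move=> hu; have /IH := hu.
    suff: forall u, sums (fun u => low m u /\ exists mm, lspace (tmul Psi0 (mono Ar mm)) u) u
       -> low m u /\ xi (xm j r u) = 0 by move=> h /h[].
    apply: sums_min => [|v [hv [mm lv]]].
      split=> [|a b [ha xa] [hb xb]|a b [hb xb]].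
      - by rewrite linear0 xi0; split=> //; apply: subspace0 (low_subspace m).
      - rewrite linearD xiD ?xa ?xb ?addr0; try exact: Sx.
        by split=> //; apply: subspaceD (low_subspace m) _ _ _ _.
      - rewrite linearZ /= xiZ ?xb ?mulr0; last exact: Sx.
        by split=> //; apply: subspaceZ (low_subspace m) _ _ _.
    split=> //; apply: contrapT => /eqP nz; apply: no; by exists mm, v, r.
  move/negP: xiy; apply; apply/eqP; move: y Sy.
  suff: forall y, S y -> S y /\ xi y = 0 by move=> h y /h[].
  apply: sums_min => [|_ [r [u [hu ->]]]]; last by split; [exact: Sx|exact: z].
  split=> [|a b [ha xa] [hb xb]|a b [hb xb]].
  - by split=> //; apply: subspace0.
  - by split; [exact: subspaceD|rewrite xiD // xa xb addr0].
  - by split; [exact: subspaceZ|rewrite xiZ // xb mulr0].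
set Psi := tmul Psi0 _ in lu1; have Psir : in_r Psi by apply: Psi0_mono_in_r.
pose U v := low m v /\ lspace Psi v.
have hlp := lspace_subspace V Psir; have hlm := low_subspace m.
have hU : subspace U.
  split=> [|a b [? ?] [? ?]|a b [? ?]]; split; by [apply: subspace0|apply: subspaceD|apply: subspaceZ].
have [nm dm] := fd m.
have [nU dU] := has_dim_sub hU (fun v h => proj1 h) hlm dm.
have TU k v : U v -> U (phi_plus V k v).
  move=> [hv lv]; split; first exact: low_phi.
  apply/lspaceP => //; apply: jgen_comm; first exact: linear_lin.
    by move=> l x; apply: phi_plus_comm.
  exact/lspaceP.
(* The vectors of [low m] that [xi] cannot see after applying any x_s. A vector of given l-weight is
   only a generalized eigenvector; modulo [Z] it can be chosen to be a true one, and inside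
   [xi (xm j s _)] each phi may then be replaced by its eigenvalue. *)
pose Z v := low m v /\ forall s, xi (xm j s v) = 0.
have hZ : subspace Z.
  split=> [|a b [ha za] [hb zb]|a b [hb zb]]; split; try by [apply: subspace0|apply: subspaceD|apply: subspaceZ].
  - by move=> s; rewrite linear0.
  - by move=> s; rewrite linearD xiD ?za ?zb ?addr0 //; apply: Sx.
  - by move=> s; rewrite linearZ /= xiZ ?zb ?mulr0 //; apply: Sx.
have b0 i : nroot D io j i != 0 by rewrite ffunE expfz_neq0 ?qi_neq0.
have xiR0 i s v : low m v -> th (i, 0%N) * xi (xm j s v)
    = nroot D io j i * xi (xm j s (phi_plus V (i, 0%N) v)).
  move=> hv; rewrite -xith; last exact: Sx.
  by rewrite -xiZ; [rewrite phi_plus_x0|apply/Sx/low_phi].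
have xiR i k s v : low m v ->
    th (i, k.+1) * xi (xm j s v) - nroot D io j i * (th (i, k) * xi (xm j (s + 1) v))
    = nroot D io j i * xi (xm j s (phi_plus V (i, k.+1) v))
      - xi (xm j (s + 1) (phi_plus V (i, k) v)).
  move=> hv; have S1 t l : S (phi_plus V l (xm j t v)) by apply/TS/Sx.
  have S2 t l : S (xm j t (phi_plus V l v)) by apply/Sx/low_phi.
  rewrite -!xith; try exact: Sx.
  rewrite -!xiZ // -!xiB //; try exact: subspaceZ.
  by rewrite phi_plus_x.
have TZ k v : U v -> Z v -> Z (phi_plus V k v).
  move=> [hv _] [_ zv]; split; first exact: low_phi.
  case: k => i k; elim: k => [|k IHk] s.
    have := xiR0 i s v hv; rewrite zv mulr0 => /esym/eqP.
    by rewrite mulf_eq0 (negbTE (b0 i)) => /eqP.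
  have := xiR i k s v hv; rewrite !zv !mulr0 subrr IHk subr0 => /esym/eqP.
  by rewrite mulf_eq0 (negbTE (b0 i)) => /eqP.
have [|u [Uu Zu [t tZ]]] := eigen_mod (@phi_plus_comm _ _ _ _ V) hU dU TU hZ TZ.
  by move/(_ _ (conj hu1 lu1)) => [_ /(_ r1) h]; rewrite h eqxx in xu1.
have [hu lu] := Uu.
have tE k : t k = theta Psi k.
  have [p /(_ k) hp] := (lspaceP u Psir).1 lu.
  exact: (eigenvalue_mod hU hZ (TU k) (TZ k) Uu Zu (tZ k) hp).
pose x s := xi (xm j s u).
have [s0 xs0] : exists s, x s != 0.
  apply: contrapT => /forallNP h; apply: Zu; split=> // s.
  by apply/eqP; apply: contrapT => /negP; apply: h.
have phiu s k : xi (xm j s (phi_plus V k u)) = theta Psi k * x s.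
  have [_ /(_ s)] := tZ k; rewrite tE linearB linearZ /= xiB ?xiZ; last first.
  - by apply: subspaceZ => //; apply: Sx.
  - by apply: Sx; apply: low_phi.
  - exact: Sx.
  by move/eqP; rewrite subr_eq0 => /eqP.
have E0 i s : th (i, 0%N) * x s = nroot D io j i * (theta Psi (i, 0%N) * x s).
  by rewrite xiR0 // phiu.
have E1 i k s : th (i, k.+1) * x s - nroot D io j i * (th (i, k) * x (s + 1))
   = nroot D io j i * (theta Psi (i, k.+1) * x s) - theta Psi (i, k) * x (s + 1).
  by rewrite xiR // !phiu.
have th0 i : th (i, 0%N) = nroot D io j i * theta Psi (i, 0%N).
  by apply: (mulIf xs0); rewrite -mulrA E0.
pose i0 := io j; pose b := nroot D io j i0.
have P0 : theta Psi (i0, 0%N) != 0 by rewrite /theta /= -value0_ser // value0_neq0.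
have bb : 1 - b ^+ 2 != 0.
  rewrite subr_eq0 eq_sym; apply/eqP; rewrite /b ffunE (gd_diag gD) => h.
  have : qi D i0 ^ (- 2%:Z * 2) = 1 by rewrite -exprz_exp.
  by move/(qi_expz_eq1 gD).
(* The ratio is forced by [E1] at the node of [j] with k = 0, which reads (1 - b^2) Psi_0 x_{s+1} =
   (b Psi_1 - th_1) x_s; here b = q_{i0}^{-2} because C_{i0,i0} = 2. *)
pose a := (b * theta Psi (i0, 1%N) - th (i0, 1%N)) / ((1 - b ^+ 2) * theta Psi (i0, 0%N)).
have xa s : x (s + 1) = a * x s.
  have := E1 i0 0%N s; rewrite th0 -/b => E.
  have d0 : (1 - b ^+ 2) * theta Psi (i0, 0%N) != 0 by rewrite mulf_neq0.
  apply: (mulfI d0); rewrite mulrA /a [_ * (_ / _)]mulrC divfK //.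
  apply/eqP; rewrite -subr_eq0; apply/eqP.
  move/eqP: E; rewrite -subr_eq0 => /eqP E; rewrite -[RHS]E; ring.
clearbody a.
have a0 : a != 0.
  by apply: contraNneq xs0 => h; rewrite -(subrK 1 s0) xa h mul0r.
(* The recurrence of [Ap_expansion], with the same [a] at every node [i]: this is what makes the
   extra factor A_{j,a}^{-1}. *)
have th1 i k : th (i, k.+1) - a * nroot D io j i * th (i, k)
   = nroot D io j i * theta Psi (i, k.+1) - a * theta Psi (i, k).
  apply: (mulIf xs0); have := E1 i k s0; rewrite xa => E.
  transitivity (th (i, k.+1) * x s0 - nroot D io j i * (th (i, k) * (a * x s0))); first by ring.
  by rewrite E; ring.
pose xx : X * {a : F | a != 0} := (j, exist _ a a0).
have thE : th = theta (tmul Psi0 (mono Ar (xx :: mm))).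
  apply/funext => -[i k].
  have -> : tmul Psi0 (mono Ar (xx :: mm)) = tmul Psi (Ar xx).
    by rewrite mono_cons [tmul (Ar _) _]tmulC tmulA.
  pose d (l : int) := if l is Posz l' then th (i, l') else 0.
  have hd : expansion true (tmul Psi (Ar xx) i) d.
    have -> : tmul Psi (Ar xx) i = Psi i * Ap (nroot D io j i) a.
      by rewrite [LHS]ffunE [Ar xx i]ffunE.
    apply: (Ap_expansion (serP (Psir i))).
    - by move=> l; apply: ser_neg.
    - by case.
    - exact: th0.
    - by move=> l; apply: th1.
  by rewrite /theta -(ser_uniq hd).
(* The contradiction: generalized eigenvectors for [th] now belong to [L], where [xi] is zero, and
   [xi], an eigenvector for [th], vanishes on those for any other [th']. *)
suff: forall v, S v -> S v /\ xi v = 0 by move/(_ _ Sy) => [_ h]; rewrite h eqxx in xiy.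
move=> v Sv.
have := sums_gen_eigen (@phi_plus_comm _ _ _ _ V) hS dS TS Sv.
apply: (sums_min (S := fun z => S z /\ xi z = 0)) => [|z [Sz [th' hz]]].
  split=> [|a1 b1 [ha xa1] [hb xb]|a1 b1 [hb xb]].
  - by split=> //; apply: subspace0.
  - by split; [exact: subspaceD|rewrite xiD // xa1 xb addr0].
  - by split; [exact: subspaceZ|rewrite xiZ // xb mulr0].
split=> //; have [E|ne] := pselect (th' = th).
  apply: xiL => //; apply: sums1; split=> //; exists (xx :: mm).
  by apply/lspaceP; [exact: Psi0_mono_in_r|rewrite -thE -E].
have [k /eqP nk] : exists k, th k <> th' k.
  by apply/existsNP => h; apply: ne; apply/funext => k; rewrite h.
have [p /(_ k) hp] := hz.
have [_ h] : S (iter p (shiftop (phi_plus V) k (th' k)) z) /\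
    xi (iter p (shiftop (phi_plus V) k (th' k)) z) = (th k - th' k) ^+ p * xi z.
  elim: p {hp} => [|p [IH1 IH2]]; first by rewrite expr0 mul1r.
  rewrite iterS /shiftop; split; first by apply: subspaceB => //; [apply: TS|apply: subspaceZ].
  rewrite xiB ?xiZ ?xith //; try by [apply: TS|apply: subspaceZ].
  by rewrite IH2 exprS; ring.
move/eqP: h; rewrite hp xi0 eq_sym mulf_eq0 expf_eq0 subr_eq0 (negbTE nk) andbF.
by move/eqP.
Qed.

End Lweights.
End Cyclic.

Lemma polynomial_dependency (F : fieldType) (T : finType) (X : nat -> T -> F) :
  exists2 a : {poly F}, a != 0 & forall t, \sum_(l < size a) a`_l * X l t = 0.
Proof.
pose N := #|T|.+1; pose M : 'M[F]_(N, #|T|) := \matrix_(l, t) X l (enum_val t).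
have : kermx M != 0.
  by rewrite kermx_eq0 /row_free neq_ltn (leq_ltn_trans (rank_leq_col M)).
case/rowV0Pn => u /sub_kermxP uM u0.
exists (rVpoly u); first by apply: contraNneq u0 => h; rewrite -[u]rVpolyK h linear0.
move=> t; have := congr1 (fun A : 'M_(1, #|T|) => A 0 (enum_rank t)) uM.
rewrite !mxE => E; rewrite -[RHS]E.
rewrite (@big_ord_widen _ _ _ _ N (fun l => (rVpoly u)`_l * X l t)) ?size_poly //.
rewrite big_mkcond; apply: eq_bigr => l _; rewrite mxE enum_rankK.
by case: ltnP => [_|h]; rewrite -(coef_rVpoly_ord u l) // nth_default ?mul0r.
Qed.

(** * Category O *)

Section CategoryOFacts.
Variables (F : numClosedFieldType) (K : finType) (D : datum F K).
Hypothesis gD : good_datum D.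
Variables (nu : {ffun K -> int}) (V : qmodule D nu).
Hypothesis OV : in_O V.

Lemma wspace_subspace (g : {ffun K -> F}) : subspace (@wspace _ _ _ _ V true g).
Proof.
split=> [|u v hu hv|a v hv] i.
- by rewrite linear0 scaler0.
- by rewrite linearD hu hv scalerDr.
- by rewrite linearZ /= hv !scalerA mulrC.
Qed.

Lemma sums_wspace v : sums (fun w => exists2 g, in_t g & @wspace _ _ _ _ V true g w) v.
Proof.
have [h _] := O_sum OV true; have [s [f [hf ->]]] := h v.
by apply: sums_of_seq => g /hf [? ?]; exists g.
Qed.

Lemma wspace_fd g : in_t g -> exists n, has_dim (@wspace _ _ _ _ V true g) n.
Proof. exact: O_dim. Qed.

Lemma wspace_x e i r g v : wspace true g v ->
  wspace true (tmul g (rootw D (fun k => sg e * (k == i)%:Z))) (mx V e i r v).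
Proof.
move=> hv k; have := phi_x_lead true e k i r v.
rewrite hv => ->; rewrite linearZ /= scalerA ffunE rootwE // !expr1z mulrC; congr (_ * _ ^ _ *: _).
rewrite mul1r (bigD1 i) //= eqxx mulr1 big1 ?addr0 // => l /negbTE ->.
by rewrite mulr0 mul0r.
Qed.

Lemma wspace_phi e i r g v : wspace true g v -> wspace true g (mphi V e i r v).
Proof. by move=> hv k; rewrite phi_comm hv linearZ. Qed.

Definition phi_zero (i : K) : {linear V -> V} := mphi V true i 0.

Lemma sums_wspace_project (R : V -> Prop) (g : {ffun K -> F}) u :
  (forall w, R w -> exists g', wspace true g' w) -> sums R u ->
  jgen phi_zero g u -> sums (fun w => R w /\ wspace true g w) u.
Proof.
move=> hR hs hu.
have hc (k l : K) (v : V) : phi_zero k (phi_zero l v) = phi_zero l (phi_zero k v).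
  exact: phi_comm.
have hR' w : R w -> exists th, jgen phi_zero th w.
  by move=> /hR[g' hw]; exists g'; apply: jgen_eigen.
have := sums_project hc hR' hs hu.
elim=> [|w w' [Rw gw] _ IH]; first exact: sums0.
have [->|w0] := eqVneq w 0; first by rewrite add0r.
apply: sumsS => //; split=> //; have [g' hw] := hR _ Rw.
move=> i; have -> : g i = g' i by rewrite (jgen_eigenvalue w0 gw hw).
exact: hw.
Qed.

(** In category O the phi_{i,0}^+ are diagonalizable, so their generalized eigenvectors are
    eigenvectors. *)
Lemma lspace_wspace Psi v : in_r Psi -> lspace Psi v -> wspace true (varpi Psi) (v : V).
Proof.
move=> hP /(lspaceP v hP)[p hp].
have hu : jgen phi_zero (varpi Psi) v.
  exists p => i; have := hp (i, 0%N); rewrite ffunE value0_ser //.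
have := sums_wspace_project _ (sums_wspace v) hu.
move=> h; apply: (sums_min (wspace_subspace _) _ (h _)) => [w []//|w [g _ hw]].
by exists g.
Qed.

Lemma varpi_in_t (Psi : {ffun K -> ratfun F}) : in_r Psi -> in_t (varpi Psi).
Proof. by move=> h i; rewrite ffunE value0_neq0. Qed.

Lemma lspace_fd Psi : in_r Psi -> exists n, has_dim (@lspace _ _ _ _ V Psi) n.
Proof.
move=> h; have [n hn] := wspace_fd (varpi_in_t h).
apply: (has_dim_sub (lspace_subspace V h) _ (wspace_subspace _) hn) => v.
exact: lspace_wspace.
Qed.

(* The numbers [a_r] with [\sum_r a_r x^-_{i,r} = 0] on [v] and on the vectors
   [x^+_{i,s} v], all of which lie in one finite-dimensional weight space, give a
   linear recurrence for [phi^+ - phi^-] on [v]. *)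
Lemma phi_rational g v (c : bool -> K -> int -> F) i : in_t g -> wspace true g v ->
  v != 0 -> (forall e k r, mphi V e k r v = c e k r *: v) ->
  exists2 q : {poly F}, q.[0] != 0 & act q (c true i) =1 act q (c false i).
Proof.
move=> gt hv v0 hc.
pose gx e := tmul g (rootw D (fun k => sg e * (k == i)%:Z)).
have gxt e : in_t (gx e) by apply: in_t_rel => //; apply: rootw_in_t.
have [n1 /(has_dimP _ (wspace_subspace _))[b1 B1]] := wspace_fd (gxt false).
have [n2 /(has_dimP _ (wspace_subspace _))[b2 B2]] := wspace_fd (gxt true).
have [n3 /(has_dimP _ (wspace_subspace _))[b3 B3]] := wspace_fd gt.
have h1 r : exists u, mx V false i r v = vec b1 u.
  by apply: (basis_span B1); apply: wspace_x.
have h2 s : exists u, mx V true i s v = vec b2 u.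
  by apply: (basis_span B2); apply: wspace_x.
have h3 (rl : nat * 'I_n2) : exists u, mx V false i rl.1 (b2 rl.2) = vec b3 u.
  apply: (basis_span B3).
  have b2in : wspace true (gx true) (b2 rl.2).
    rewrite -[b2 _](_ : vec b2 (delta_mx 0 rl.2) = _); first exact: basis_in B2 _.
    rewrite /vec (bigD1 rl.2) //= big1 ?addr0 ?mxE ?eqxx ?scale1r // => j /negbTE ij.
    by rewrite mxE ij andbF scale0r.
  have := wspace_x false i rl.1 b2in; rewrite /gx -tmulA rootwD //.
  rewrite (_ : rootw D _ = mono (nroot D id) [::]) ?tmul_mono0 //.
  by rewrite mono_nroot //; apply: rootw_ext => // k; rewrite /sg /=; lia.
have [u1 u1P] := choice h1; have [u3 u3P] := choice h3.
pose X (l : nat) (t : 'I_n1 + 'I_n2 * 'I_n3) : F :=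
  match t with inl k => u1 l 0 k | inr k => u3 (l, k.1) 0 k.2 end.
have [a a0 aX] := polynomial_dependency X.
have a1 : \sum_(l < size a) a`_l *: mx V false i l%:Z v = 0.
  under eq_bigr do rewrite u1P -vecZ.
  rewrite -vec_sum (_ : \sum_(l < _) _ = 0) ?vec0 //; apply/rowP => k.
  by rewrite summxE mxE -[RHS](aX (inl k)); apply: eq_bigr => l _; rewrite mxE.
have a2 k : \sum_(l < size a) a`_l *: mx V false i l%:Z (b2 k) = 0.
  under eq_bigr do rewrite (u3P (_, k)) -vecZ.
  rewrite -vec_sum (_ : \sum_(l < _) _ = 0) ?vec0 //; apply/rowP => k'.
  by rewrite summxE mxE -[RHS](aX (inr (k, k'))); apply: eq_bigr => l _; rewrite mxE.
have a3 s : \sum_(l < size a) a`_l *: mx V false i l%:Z (mx V true i s v) = 0.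
  have [u ->] := h2 s; rewrite /vec.
  under eq_bigr do rewrite (lin_sum (linear_lin _)) scaler_sumr.
  rewrite exchange_big big1 //= => k _.
  under eq_bigr do rewrite [X in _ *: X]linearZ /= scalerA mulrC -scalerA.
  by rewrite -scaler_sumr a2 scaler0.
(* The combination of the commutators [x^+_s, x^-_l] with coefficients a_l kills [v] by [a1] and
   [a3], while each commutator is phi^+_{s+l} - phi^-_{s+l} up to a nonzero scalar. *)
have rec s : \sum_(l < size a) a`_l * (c true i (s + l%:Z) - c false i (s + l%:Z)) = 0.
  apply/eqP; have : (\sum_(l < size a) a`_l * (c true i (s + l%:Z) - c false i (s + l%:Z))) *: v = 0.
    rewrite scaler_suml.
    transitivity (\sum_(l < size a) (qi D i - (qi D i)^-1) *:
        (mx V true i s (a`_l *: mx V false i l%:Z v)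
         - a`_l *: mx V false i l%:Z (mx V true i s v))).
      apply: eq_bigr => l _.
      rewrite [mx V true i s _]linearZ /= -[X in _ = _ *: X]scalerBr scalerA.
      rewrite [(_ - _^-1) * _]mulrC -[RHS]scalerA x_comm eqxx !hc.
      by rewrite -scalerBl scalerA.
    rewrite -scaler_sumr sumrB a3 subr0 -(lin_sum (linear_lin _)) a1 linear0 scaler0.
    by [].
  by move/eqP; rewrite scaler_eq0 (negbTE v0) orbF.
have sa : (size a).-1.+1 = size a by rewrite prednK // size_poly_gt0.
(* The coefficients are reversed, since the recurrence involves c_{s+l} and [act] involves c_{k-l}.
   The constant term is thus the leading coefficient of [a]. *)
exists (\poly_(l < size a) a`_(size a - l.+1)%N).
  by rewrite horner_coef0 coef_poly -sa /= subSS subn0 -lead_coefE lead_coef_eq0.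
move=> k; apply/eqP; rewrite -subr_eq0 !(act_widen _ _ (size_poly _ _)) -sumrB.
rewrite -[X in _ == X](rec (k - (size a).-1%:Z)); apply/eqP.
rewrite (reindex_inj rev_ord_inj); apply: eq_bigr => l _ /=.
rewrite coef_poly (_ : (size a - l.+1 < size a)%N); last by have := ltn_ord l; lia.
rewrite -mulrBr (_ : k - (size a - l.+1)%N%:Z = k - (size a).-1%:Z + l%:Z).
  by rewrite subnS subKn //; apply: ltn_ord.
by case: l => l /= lt; move: lt sa; move: (size a) => y; clear; lia.
Qed.

(** After multiplication by [q' * q] both sequences agree with that of [d], and series bounded above
    can be cancelled. It shows that the eigenvalues of phi^- are determined by those of phi^+. *)
Lemma phi_minus_uniq (c c' : int -> F) (d : int -> F) (q q' : {poly F}) (N : int) :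
  q.[0] != 0 -> q'.[0] != 0 -> act q d =1 act q c -> act q' d =1 act q' c' ->
  (forall k, N < k -> c k = 0) -> (forall k, N < k -> c' k = 0) -> c =1 c'.
Proof.
move=> q0 q'0 h h' cN c'N; have nz (p : {poly F}) : p.[0] != 0 -> p != 0.
  by apply: contraNneq => ->; rewrite horner0.
apply: (@act_inj _ false (q' * q)); rewrite ?mulf_neq0 ?nz //; try by exists N.
move=> k; rewrite [LHS]act_mul -(act_ext _ h) -act_mul mulrC act_mul (act_ext _ h') -act_mul.
by rewrite mulrC.
Qed.

(** Multiplied by [q], the phi^+ and phi^- series coincide; one vanishes in negative degrees and the
    other in large degrees, so the common value is a polynomial [p], and the phi^+ series is p/q. *)
Lemma eigenvector_lweight g v (c : bool -> K -> int -> F) : in_t g -> wspace true g v ->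
  v != 0 -> (forall e k r, mphi V e k r v = c e k r *: v) ->
  exists2 Psi, in_r Psi & forall i (r : nat), c true i r = ser (Psi i) r.
Proof.
move=> gt hv v0 hc.
suff h i : exists2 f : ratfun F, regular_nonzero0 f & expansion true f (c true i).
  have [f fP] := choice (fun i => let: ex_intro2 f h1 h2 := h i in ex_intro _ f (conj h1 h2)).
  exists [ffun i => f i] => i; rewrite ffunE; first by case: (fP i).
  by move=> r; apply: ser_uniq; case: (fP i).
have [q q0 hq] := phi_rational i gt hv v0 hc.
have zero e k : (forall w : V, mphi V e i k w = 0) -> c e i k = 0.
  by move=> /(_ v)/eqP; rewrite hc scaler_eq0 (negbTE v0) orbF => /eqP.
have cp k : k < 0 -> c true i k = 0 by move=> hk; apply: zero => w; apply: phi_neg0.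
have cm k : nu i < k -> c false i k = 0 by move=> hk; apply: zero => w; apply: phi_pos0.
(* From degree [M] on, [act q (c false i)] only involves modes above [nu i]. *)
pose M := (absz (nu i) + size q).+1.
pose p := \poly_(m < M) act q (c true i) m.
have pE : act q (c true i) =1 coefz p.
  move=> [m|m] /=; last by rewrite /act big1 // => l _; rewrite cp ?mulr0 //; lia.
  rewrite coef_poly; case: ltnP => // hm; rewrite hq /act big1 // => l _.
  rewrite cm ?mulr0 //; case: l => l /= hl; move: hm; rewrite /M; move: hl.
  by move: (size q) (nu i) => y z; clear; lia.
exists (FracField.tofrac p / FracField.tofrac q).
  exists p, q; split=> //; rewrite horner_coef0.
  have := pE 0; rewrite /= => <-; rewrite (@act_widen _ (size q).+1) // big_ord_recl.
  rewrite big1 ?addr0 => [|l _]; last by rewrite cp ?mulr0 // lift0; lia.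
  rewrite ?subr0 mulf_neq0 -?horner_coef0 //; apply: contraNneq v0 => c0.
  by apply/eqP/(@phi_lead_inj _ _ _ _ V true i); rewrite /= hc c0 scale0r linear0.
apply/expansionP; split; first by exists 0.
by exists p, q; split=> //; apply: contraNneq q0 => ->; rewrite horner0.
Qed.

Lemma exists_eigenvector (S : V -> Prop) g : subspace S -> in_t g ->
  (forall v, S v -> wspace true g v) -> (forall e i r v, S v -> S (mphi V e i r v)) ->
  ~ (forall v, S v -> v = 0) ->
  exists v c, [/\ S v, v != 0 & forall e k r, mphi V e k r v = c e k r *: v].
Proof.
move=> hS gt Sg Sphi S0.
have [n hn] := wspace_fd gt.
have [m hm] := has_dim_sub hS Sg (wspace_subspace g) hn.
pose T (k : bool * K * int) : {linear V -> V} := mphi V k.1.1 k.1.2 k.2.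
have Tc k l v : T k (T l v) = T l (T k v) by apply: phi_comm.
have TS k v : S v -> S (T k v) by apply: Sphi.
have hZ : subspace (fun v : V => v = 0).
  by split=> [//|u v -> ->|a v ->]; rewrite ?addr0 ?scaler0.
have TZ k v : S v -> v = 0 -> T k v = 0 by move=> _ ->; apply: linear0.
have [v [Sv /eqP v0 [th thP]]] := eigen_mod Tc hS hm TS hZ TZ S0.
exists v, (fun e i r => th (e, i, r)); split=> // e i r.
exact: subr0_eq (thP (e, i, r)).
Qed.

(** A generalized eigenvalue [th] of the phi^+ on a weight space need not be rational a priori. Its
    eigenspace contains a common eigenvector of all phi^+ and phi^-, and [eigenvector_lweight]
    applies to that vector. *)
Lemma sums_lspace v : sums (fun w => exists2 Psi, in_r Psi & @lspace _ _ _ _ V Psi w) v.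
Proof.
have := sums_wspace v; elim=> [|w u [g gt gw] _ IH]; first exact: sums0.
apply: sumsD => // {u IH}; have [n hn] := wspace_fd gt.
have hT k (z : V) : wspace true g z -> wspace true g (phi_plus V k z) by apply: wspace_phi.
have := sums_gen_eigen (@phi_plus_comm _ _ _ _ V) (wspace_subspace g) hn hT gw.
elim=> [|x u [gx [th hx]] _ IH]; first exact: sums0.
apply: sumsD => // {u IH}; have [->|x0] := eqVneq x 0; first exact: sums0.
pose S v := wspace true g v /\ jgen (phi_plus V) th v.
have [|y|e i r y|h|u [c [[gu thu] u0 hc]]] := @exists_eigenvector S g _ gt.
- split=> [|a b [? ?] [? ?]|a b [? ?]].
  + by split; [exact: subspace0 (wspace_subspace _)|exact: subspace0 (jgen_subspace _ _)].
  + by split; [exact: (subspaceD (wspace_subspace _))|exact: (subspaceD (jgen_subspace _ _))].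
  + by split; [exact: (subspaceZ (wspace_subspace _))|exact: (subspaceZ (jgen_subspace _ _))].
- by case.
- move=> [gv tv]; split; first exact: wspace_phi.
  apply: jgen_comm => //; first exact: linear_lin.
  by move=> k w'; apply: phi_comm.
- by case/eqP: x0; apply: h.
have [Psi hPsi cE] := eigenvector_lweight gt gu u0 hc.
apply: sums1; exists Psi => //; apply/lspaceP => //.
suff <- : th = theta Psi by [].
by apply: (jgen_eigenvalue u0 thu) => -[i r]; rewrite /phi_plus hc cE.
Qed.

Lemma in_P_lweight g : in_P V true g -> exists2 Psi, is_lweight V Psi & varpi Psi = g.
Proof.
move=> [gt [v v0 gv]].
have [|||w [c [gw w0 hc]]] := @exists_eigenvector (@wspace _ _ _ _ V true g) g (wspace_subspace _) gt.
- by [].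
- by move=> e i r w; apply: wspace_phi.
- by move/(_ v gv) => h; rewrite h eqxx in v0.
have [Psi hPsi cE] := eigenvector_lweight gt gw w0 hc.
exists Psi.
  split=> //; exists w => //; apply/lspaceP => //.
  by apply: jgen_eigen => -[i r]; rewrite /phi_plus hc cE.
apply/ffunP => i; rewrite ffunE value0_ser // -cE; have := gw i.
rewrite /= hc expr1z => /eqP; rewrite -subr_eq0 -scalerBl scaler_eq0 (negbTE w0) orbF subr_eq0.
by move/eqP.
Qed.

Lemma chiq_neq0 Psi : chiq V Psi != 0 <-> is_lweight V Psi.
Proof.
rewrite /chiq /is_lweight; case: asboolP => hP; last by rewrite eqxx; split=> // -[].
have [n hn] := lspace_fd hP; have E := dim_eq0 (lspace_subspace V hP) hn.
split=> [nz|[_ [v v0 lv]]].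
  split=> //; apply: contrapT => no; move/negP: nz; apply; apply/eqP.
  congr Posz; apply/E => v lv; apply/eqP; apply: contrapT => /negP v0; apply: no; by exists v.
by apply/eqP => -[] /E/(_ v lv) h; rewrite h eqxx in v0.
Qed.

Lemma chi_neq0 g : chi V g != 0 <-> in_P V true g.
Proof.
rewrite /chi /in_P; case: asboolP => gt; last by rewrite eqxx; split=> // -[].
have [n hn] := wspace_fd gt; have E := dim_eq0 (wspace_subspace g) hn.
split=> [nz|[_ [v v0 lv]]].
  split=> //; apply: contrapT => no; move/negP: nz; apply; apply/eqP.
  congr Posz; apply/E => v lv; apply/eqP; apply: contrapT => /negP v0; apply: no; by exists v.
by apply/eqP => -[] /E/(_ v lv) h; rewrite h eqxx in v0.
Qed.

End CategoryOFacts.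

(** Unique factorization, after writing 1 - aX = -a (X - a^{-1}). *)
Lemma prod_one_sub_perm (F : fieldType) (s t : seq F) (x y : F) :
  x != 0 -> y != 0 -> all (fun a => a != 0) s -> all (fun a => a != 0) t ->
  x *: \prod_(a <- s) (1 - a *: 'X) = y *: \prod_(a <- t) (1 - a *: 'X) :> {poly F} ->
  perm_eq s t.
Proof.
have fac (u : seq F) : all (fun a => a != 0) u ->
    exists2 z, z != 0 & \prod_(a <- u) (1 - a *: 'X) = z *: \prod_(a <- [seq a^-1 | a <- u]) ('X - a%:P).
  elim: u => [|a u IH] /= => [_|/andP[a0 /IH[z z0 E]]].
    by exists 1; rewrite ?oner_eq0 // !big_nil scale1r.
  exists (- a * z); first by rewrite mulf_neq0 ?oppr_eq0.
  rewrite !big_cons E -scalerAr [- a * z]mulrC -[RHS]scalerA; congr (_ *: _).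
  rewrite scalerAl; congr (_ * _).
  by rewrite scalerBr !scaleNr opprK -[a *: a^-1%:P]mul_polyC -polyCM mulfV // addrC.
move=> x0 y0 /fac[z z0 ->] /fac[w w0 ->]; rewrite !scalerA => E.
have h : \prod_(a <- [seq a^-1 | a <- s]) ('X - a%:P) = \prod_(a <- [seq a^-1 | a <- t]) ('X - a%:P).
  have lc := congr1 lead_coef E; rewrite !lead_coefZ !lead_coef_prod_XsubC !mulr1 in lc.
  by move: E; rewrite lc; apply: scalerI; rewrite mulf_neq0.
by move/prod_XsubC_eq: h; apply: perm_map_inj => a b; apply: invr_inj.
Qed.

(** * Independence of the A *)

Section Independence.
Variables (F : fieldType) (K : finType) (D : datum F K).
Hypothesis gD : good_datum D.
Local Notation X := (K * {a : F | a != 0})%type.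
Local Notation q := (qpar D).

Lemma qpar_expz_inj (m n : int) : q ^ m = q ^ n -> m = n.
Proof.
move=> E; have q0 := gd_q0 gD.
have : q ^ (m - n) = 1 by rewrite expfzDr // E -invr_expz mulfV ?expfz_neq0.
move=> h; suff : m - n = 0 by lia.
move: h; set k := m - n => {E}.
have nat_case (l : nat) : q ^+ l = 1 -> l = 0%N.
  by case: l => // l /eqP h; have := gd_q gD (m := l.+1) isT; rewrite h.
case: k => k; first by move/nat_case => ->.
rewrite NegzE -exprz_inv => h; have: q ^+ k.+1 = 1.
  by apply: invr_inj; rewrite invr1 -exprVn.
by move/nat_case.
Qed.

Definition symB (k j : K) : int := (dsym D k)%:Z * cart D k j.

Lemma qi_symB k j : qi D k ^ (cart D k j) = q ^ symB k j.
Proof. by rewrite /qi /symB -exprz_exp -exprnP. Qed.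

(** Up to a constant, the factor at [k] of A_{j,a}^{-1} has numerator 1 - a q^s z and denominator 1
    - a q^-s z, with s = [symB k j]. Cross-multiplication leaves two products of linear factors to
    be compared. *)
Lemma mono_Aroot_perm (m m' : seq X) k :
  mono (Aroot D id) m k = mono (Aroot D id) m' k ->
  perm_eq ([seq val x.2 * q ^ symB k x.1 | x <- m] ++ [seq val x.2 * q ^ (- symB k x.1) | x <- m'])
          ([seq val x.2 * q ^ symB k x.1 | x <- m'] ++ [seq val x.2 * q ^ (- symB k x.1) | x <- m]).
Proof.
have q0 := gd_q0 gD.
pose num (s : seq X) : {poly F} := \prod_(a <- [seq val x.2 * q ^ symB k x.1 | x <- s]) (1 - a *: 'X).
pose den (s : seq X) : {poly F} := \prod_(a <- [seq val x.2 * q ^ (- symB k x.1) | x <- s]) (1 - a *: 'X).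
have nz (s : seq X) e : all (fun a => a != 0) [seq val x.2 * q ^ (e * symB k x.1) | x <- s].
  by apply/allP => _ /mapP[x _ ->]; rewrite mulf_neq0 ?(valP x.2) ?expfz_neq0.
have nz1 s := nz s 1; have nzN s := nz s (-1).
have E1 : (fun x : X => val x.2 * q ^ (1 * symB k x.1)) = (fun x : X => val x.2 * q ^ symB k x.1).
  by apply/funext => x; rewrite mul1r.
have EN : (fun x : X => val x.2 * q ^ (-1 * symB k x.1)) = (fun x : X => val x.2 * q ^ (- symB k x.1)).
  by apply/funext => x; rewrite mulN1r.
rewrite E1 in nz1; rewrite EN in nzN.
have mE (s : seq X) : exists2 z, z != 0 &
    mono (Aroot D id) s k = FracField.tofrac (z *: num s) / FracField.tofrac (den s).
  rewrite ffunE /num /den; elim: s => [|x s [z z0 IH]].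
    by exists 1; rewrite ?oner_eq0 // !big_nil scale1r divr1.
  exists (q ^ (- symB k x.1) * z); first by rewrite mulf_neq0 ?expfz_neq0.
  rewrite !big_cons IH /= ffunE /Ap ffunE -invr_expz qi_symB invr_expz.
  set b := q ^ (- _); set N := \prod_(j <- _) _; set M := \prod_(j <- _) _.
  have bK : q ^ symB k x.1 * b = 1 by rewrite /b -expfzDr // subrr expr0z.
  have -> : (b * z) *: ((1 - (val x.2 * q ^ symB k x.1) *: 'X) * N)
      = (b%:P - val x.2 *: 'X) * (z *: N).
    rewrite -scalerA -[RHS]scalerAr [RHS]scalerAl scalerA mulrC -[LHS]scalerA.
    rewrite scalerAl -[RHS]scalerAl; congr (_ *: _); congr (_ * _).
    by rewrite scalerBr scalerA mulrCA [b * _]mulrC bK mulr1 alg_polyC.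
  by rewrite !rmorphM /= mulf_div.
move=> E; have [z z0 zE] := mE m; have [w w0 wE] := mE m'.
have dn (s : seq X) : den s != 0.
  rewrite /den; elim/big_rec: _ => [|a p _ p0]; first exact: oner_neq0.
  by rewrite mulf_neq0 // -[a]mulr1 Ap_den.
move: E; rewrite zE wE => /eqP; rewrite ratfun_eq // => /eqP E.
apply: (prod_one_sub_perm z0 w0); rewrite ?all_cat ?nz1 ?nzN // !big_cat /=.
by rewrite !scalerAl.
Qed.

(* The k-th component of a product of A_{j,a}^-1 determines, on each coset
   [c0 q^Z], the multiset of the a q_k^{C_{k,j}} minus that of the a q_k^{- C_{k,j}};
   writing a = c0 q^n, nondegeneracy of C recovers inductively all the moments
   of the exponents n for each j. *)
Section Moments.
Variable c0 : F.
Hypothesis c00 : c0 != 0.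

Definition in_coset (a : F) : bool := `[< exists n : int, a = c0 * q ^ n >].

Definition clog (a : F) : int := classical_sets.xget 0 (fun n => a = c0 * q ^ n).

Lemma clogE n : clog (c0 * q ^ n) = n.
Proof.
rewrite /clog; case: classical_sets.xgetP => [m -> /(mulfI c00)/qpar_expz_inj //|/(_ n)].
by [].
Qed.

Lemma in_coset_shift a n : in_coset (a * q ^ n) = in_coset a.
Proof.
apply/asboolP/asboolP => -[l aE]; [exists (l - n)|exists (l + n)].
  by rewrite expfzDr ?(gd_q0 gD) // mulrA -aE -invr_expz mulfK // expfz_neq0 ?(gd_q0 gD).
by rewrite aE expfzDr ?(gd_q0 gD) // mulrA.
Qed.

Lemma clog_shift a n : in_coset a -> clog (a * q ^ n) = clog a + n.
Proof.
by move/asboolP => [l ->]; rewrite -mulrA -expfzDr ?(gd_q0 gD) // !clogE.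
Qed.

Definition moment (f : int -> int) (m : seq X) (j : K) : int :=
  \sum_(x <- m | in_coset (val x.2) && (x.1 == j)) f (clog (val x.2)).

Lemma moment_shift (f : int -> int) m m' k :
  mono (Aroot D id) m k = mono (Aroot D id) m' k ->
  \sum_j moment (fun n => f (n + symB k j) - f (n - symB k j)) m j
  = \sum_j moment (fun n => f (n + symB k j) - f (n - symB k j)) m' j.
Proof.
move/mono_Aroot_perm => pE.
have part (s : seq X) : \sum_j moment (fun n => f (n + symB k j) - f (n - symB k j)) s j
   = \sum_(x <- s | in_coset (val x.2)) f (clog (val x.2) + symB k x.1)
     - \sum_(x <- s | in_coset (val x.2)) f (clog (val x.2) - symB k x.1).
  rewrite -sumrB (partition_big (fun x : X => x.1) xpredT) //=.
  by apply: eq_bigr => j _; apply: eq_bigr => x /andP[_ /eqP ->].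
have shE e (s : seq X) :
    \sum_(a <- [seq val x.2 * q ^ (e * symB k x.1) | x <- s] | in_coset a) f (clog a)
    = \sum_(x <- s | in_coset (val x.2)) f (clog (val x.2) + e * symB k x.1).
  rewrite big_map; under eq_bigl do rewrite in_coset_shift.
  by apply: eq_bigr => x hx; rewrite clog_shift.
have sh1 (s : seq X) : \sum_(a <- [seq val x.2 * q ^ symB k x.1 | x <- s] | in_coset a) f (clog a)
    = \sum_(x <- s | in_coset (val x.2)) f (clog (val x.2) + symB k x.1).
  have := shE 1 s; under eq_map do rewrite mul1r; move->.
  by apply: eq_bigr => x _; rewrite mul1r.
have shN (s : seq X) : \sum_(a <- [seq val x.2 * q ^ (- symB k x.1) | x <- s] | in_coset a) f (clog a)
    = \sum_(x <- s | in_coset (val x.2)) f (clog (val x.2) - symB k x.1).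
  have := shE (-1) s; under eq_map do rewrite mulN1r; move->.
  by apply: eq_bigr => x _; rewrite mulN1r.
have : \sum_(a <- [seq val x.2 * q ^ symB k x.1 | x <- m] ++ [seq val x.2 * q ^ (- symB k x.1) | x <- m'] | in_coset a) f (clog a)
   = \sum_(a <- [seq val x.2 * q ^ symB k x.1 | x <- m'] ++ [seq val x.2 * q ^ (- symB k x.1) | x <- m] | in_coset a) f (clog a).
  exact: perm_big.
rewrite !big_cat /= !sh1 !shN !part; lia.
Qed.

Lemma moment_sum (I : Type) (r : seq I) (c : I -> int) (f : I -> int -> int) m j :
  moment (fun n => \sum_(i <- r) c i * f i n) m j = \sum_(i <- r) c i * moment (f i) m j.
Proof.
by rewrite /moment exchange_big /=; apply: eq_bigr => i _; rewrite mulr_sumr.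
Qed.

(** For f(n) = n^{p+1} the difference f(n+s) - f(n-s) is 2(p+1) s n^p plus lower powers, whose
    moments agree by induction. What remains says that the differences of the p-th moments lie in
    the kernel of C. *)
Lemma moments_eq m m' : mono (Aroot D id) m = mono (Aroot D id) m' ->
  forall p j, moment (fun n => n ^+ p) m j = moment (fun n => n ^+ p) m' j.
Proof.
move=> E; elim/ltn_ind => p IH j.
pose y j := moment (fun n => n ^+ p) m j - moment (fun n => n ^+ p) m' j.
suff: forall j, y j = 0 by move/(_ j)/subr0_eq.
apply: (gd_nondeg gD) => k.
have := moment_shift (fun n => n ^+ p.+1) (congr1 (fun f : {ffun K -> ratfun F} => f k) E).
pose cf j (i : nat) : int := (symB k j ^+ i - (- symB k j) ^+ i) *+ 'C(p.+1, i).
have momE s : \sum_j moment (fun n => (n + symB k j) ^+ p.+1 - (n - symB k j) ^+ p.+1) s j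
    = \sum_j \sum_(i < p.+2) cf j i * moment (fun n => n ^+ (p.+1 - i)) s j.
  apply: eq_bigr => l _; rewrite -moment_sum; congr (moment _ _ _); apply/funext => n.
  rewrite !exprDn -sumrB; apply: eq_bigr => i _.
  by rewrite /cf -mulrnBl -mulrBr mulrnAl [in RHS]mulrC.
rewrite !momE => /eqP; rewrite -subr_eq0 -sumrB => /eqP h.
have : \sum_l (2 * p.+1%:Z * (dsym D k)%:Z) * (y l * cart D k l) = 0.
  rewrite -[RHS]h; apply: eq_bigr => l _; rewrite -sumrB.
  rewrite big_ord_recl big_ord_recl big1 ?addr0 => [|i _].
    rewrite /cf /= !expr0 subrr mul0rn !mul0r subrr add0r /bump /= subn1 /= bin1 expr1 expr1.
    by rewrite /y /symB opprK -mulr_natr; ring.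
  by rewrite IH ?subrr // !lift0; have := ltn_ord i; lia.
rewrite -mulr_sumr => /eqP; rewrite !mulf_eq0 => /orP[|/eqP //].
by have := gd_dpos gD k; lia.
Qed.

End Moments.

(** On the coset of the parameter of [x0], the polynomial [R] vanishes at all logarithms that occur
    except 0. Its moment is therefore R(0) times the multiplicity of [x0], and it is a combination
    of power moments. *)
Lemma Aroot_independent (m m' : seq X) :
  mono (Aroot D id) m = mono (Aroot D id) m' -> perm_eq m m'.
Proof.
move=> E; apply/allP => x0 _ /=.
have c00 : val x0.2 != 0 by exact: valP x0.2.
set c0 := val x0.2 in c00.
have mE := moments_eq c00 E.
pose R : {poly int} := \prod_(l <- [seq clog c0 (val x.2) | x <- m ++ m'] | l != 0) ('X - l%:P).
have R0 : R.[0] != 0.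
  rewrite /R horner_prod prodf_seq_neq0; apply/allP => l _; apply/implyP => l0.
  by rewrite hornerXsubC sub0r oppr_eq0.
have Rz l : l \in [seq clog c0 (val x.2) | x <- m ++ m'] -> l != 0 -> R.[l] = 0.
  move=> lm l0; rewrite /R horner_prod (big_rem l) //= l0 hornerXsubC subrr mul0r //.
have cnt (s : seq X) : {subset s <= m ++ m'} ->
    moment c0 (fun n => R.[n]) s x0.1 = R.[0] * (count_mem x0 s)%:Z.
  move=> sub.
  transitivity (\sum_(x <- s | x == x0) R.[0]).
    rewrite /moment [RHS]big_seq_cond (big_seq_cond (fun x => in_coset c0 _ && _)).
    rewrite [LHS]big_mkcond [RHS]big_mkcond; apply: eq_bigr => x _.
    have [->|xx0] := eqVneq x x0.
      have -> : in_coset c0 (val x0.2) by apply/asboolP; exists 0; rewrite expr0z mulr1.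
      rewrite eqxx !andbT; case: ifP => // _.
      by rewrite -[X in clog _ X](mulr1 c0) -(expr0z q) clogE.
    rewrite andbF; case: ifP => // /and3P[xs xc /eqP xj]; apply: Rz.
      by apply/mapP; exists x => //; apply: sub.
    apply: contraNneq xx0 => l0; apply/eqP.
    have [n xn] := asboolP _ xc; have n0 : n = 0 by rewrite -l0 xn clogE.
    rewrite (surjective_pairing x) (surjective_pairing x0) xj; congr pair.
    by apply: val_inj; rewrite xn n0 expr0z mulr1.
  by rewrite big_const_seq iter_addr_0 -mulr_natr natz.
have polyE (s : seq X) j : moment c0 (fun n => R.[n]) s j
    = \sum_(i < size R) R`_i * moment c0 (fun n => n ^+ i) s j.
  rewrite -moment_sum; congr (moment _ _ _ _); apply/funext => n.
  by rewrite horner_coef.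
apply/eqP; have : R.[0] * (count_mem x0 m)%:Z = R.[0] * (count_mem x0 m')%:Z.
  rewrite -!cnt; try by [move=> x xm; rewrite mem_cat xm ?orbT].
  by rewrite !polyE; apply: eq_bigr => i _; rewrite mE.
by move/(mulfI R0) => [].
Qed.

End Independence.

(** * Lengths of roots *)

Section Cartan.
Variables (F : fieldType) (K : finType) (D : datum F K).
Hypothesis HD : simple_datum D.
Local Notation C := (cart D).
Local Notation d i := ((dsym D i)%:Z).
Implicit Types (x y : K -> int).

Definition bform x y : int := \sum_i \sum_j x i * (d i * C i j) * y j.

Lemma bformDl x x' y : bform (fun i => x i + x' i) y = bform x y + bform x' y.
Proof.
rewrite /bform -big_split; apply: eq_bigr => i _ /=.
by rewrite -big_split; apply: eq_bigr => j _ /=; ring.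
Qed.

Lemma bformC x y : bform x y = bform y x.
Proof.
rewrite /bform exchange_big; apply: eq_bigr => j _; apply: eq_bigr => i _.
by rewrite (sd_dsym HD i j); ring.
Qed.

Lemma bformDr x y y' : bform x (fun i => y i + y' i) = bform x y + bform x y'.
Proof. by rewrite bformC bformDl ![bform _ x]bformC. Qed.

Lemma bformZl a x y : bform (fun i => a * x i) y = a * bform x y.
Proof.
rewrite /bform mulr_sumr; apply: eq_bigr => i _; rewrite mulr_sumr.
by apply: eq_bigr => j _; ring.
Qed.

Lemma bformZr a x y : bform x (fun i => a * y i) = a * bform x y.
Proof. by rewrite bformC bformZl bformC. Qed.

Lemma bform_gt0 x : (exists i, x i != 0) -> 0 < bform x x.
Proof. exact: sd_posdef. Qed.

Definition unitv (i k : K) : int := (k == i)%:Z.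

Lemma bform_unitr x j : bform x (unitv j) = \sum_i x i * (d i * C i j).
Proof.
apply: eq_bigr => i _; rewrite (bigD1 j) //= /unitv eqxx mulr1 big1 ?addr0 // => k /negbTE ->.
by rewrite mulr0.
Qed.

Lemma bform_unit i j : bform (unitv i) (unitv j) = d i * C i j.
Proof.
rewrite bform_unitr (bigD1 i) //= /unitv eqxx mul1r big1 ?addr0 // => k /negbTE ->.
by rewrite mul0r.
Qed.

(** The vector -C_{ij} alpha_i + 2 alpha_j has norm 2 d_j (4 - C_{ij} C_{ji}), which is positive. *)
Lemma cart_pair_lt4 i j : i != j -> C i j * C j i < 4.
Proof.
move=> ij; have dp := sd_dpos HD; have := sd_dsym HD i j.
have := bform_gt0 (x := fun k => (- C i j) * unitv i k + 2 * unitv j k).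
rewrite bformDl !bformDr !bformZl !bformZr !bform_unit (sd_diag HD) (sd_diag HD).
have -> : (exists i0, - C i j * unitv i i0 + 2 * unitv j i0 != 0) = True.
  by apply/propext; split=> // _; exists j; rewrite /unitv eqxx [j == i]eq_sym (negbTE ij) mulr0.
move=> /(_ I) + E; rewrite -E; have := dp i; have := dp j.
move: (dsym D i) (dsym D j) E => a b E b0 a0.
have -> : - C i j * (- C i j * (a%:Z * 2)) + - C i j * (2 * (a%:Z * C i j)) +
   (2 * (- C i j * (a%:Z * C i j)) + 2 * (2 * (b%:Z * 2)))
  = 2 * (4 * b%:Z - C i j * (a%:Z * C i j)) by ring.
rewrite E => h; have : 0 < b%:Z * (4 - C i j * C j i) by move: h; lia.
by rewrite pmulr_rgt0; lia.
Qed.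

Lemma cart_eq0 i j : (C i j == 0) = (C j i == 0).
Proof.
have di := sd_dpos HD i; have dj := sd_dpos HD j; have E := sd_dsym HD i j.
apply/eqP/eqP => h; move: E; rewrite h mulr0 => /esym/eqP; [|rewrite eq_sym];
  by rewrite mulf_eq0 => /orP[|/eqP //]; lia.
Qed.

Lemma cart_adjacent i j : i != j -> C i j != 0 ->
  [\/ [/\ dsym D i = dsym D j, C i j = -1 & C j i = -1],
      exists m, [/\ (2 <= m <= 3)%N, dsym D j = (m * dsym D i)%N, C i j = - m%:Z & C j i = -1]
    | exists m, [/\ (2 <= m <= 3)%N, dsym D i = (m * dsym D j)%N, C j i = - m%:Z & C i j = -1]].
Proof.
move=> ij n0; have p4 := cart_pair_lt4 ij.
have a0 : C i j < 0 by rewrite lt_neqAle n0 (sd_offdiag HD).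
have b0 : C j i < 0 by rewrite lt_neqAle -cart_eq0 n0 (sd_offdiag HD) // eq_sym.
have E := sd_dsym HD i j; have di := sd_dpos HD i; have dj := sd_dpos HD j.
move: (C i j) (C j i) (dsym D i) (dsym D j) p4 a0 b0 E di dj => a b x y p4 a0 b0 E x0 y0.
have a3 : -3 <= a by nia.
have b3 : -3 <= b by nia.
have ca : a = -1 \/ a = -2 \/ a = -3 by lia.
case: ca => [aE|ca].
  have cb : b = -1 \/ b = -2 \/ b = -3 by lia.
  case: cb => [bE|[bE|bE]]; subst a b.
  - by apply: Or31; split=> //; lia.
  - by apply: Or33; exists 2%N; split=> //; lia.
  - by apply: Or33; exists 3%N; split=> //; lia.
have bE : b = -1 by nia.
by case: ca => aE; subst a b; apply: Or32; [exists 2%N|exists 3%N]; split=> //; lia.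
Qed.

Definition indic (U : {set K}) (k : K) : int := (k \in U)%:Z.

Lemma bform_indic_le (U : {set K}) i j : i \in U -> j \notin U ->
  bform (indic U) (unitv j) <= d i * C i j.
Proof.
move=> iU jU; rewrite bform_unitr (bigD1 i) //= /indic iU mul1r gerDl.
apply: sumr_le0 => k _; case: (boolP (k \in U)) => kU; last by rewrite mul0r.
rewrite mul1r mulr_ge0_le0 // (sd_offdiag HD) //.
by apply: contraNneq jU => <-.
Qed.

Definition eqlen : rel K := fun i j => (C i j != 0) && (dsym D i == dsym D j).

(* A connected set of nodes of equal length is a tree, hence the sum of its roots
   is not longer than each of them. *)
Lemma connect_indic k l : connect eqlen k l -> exists U : {set K},
  [/\ k \in U, l \in U, forall i, i \in U -> dsym D i = dsym D k
    & bform (indic U) (indic U) <= 2 * d k].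
Proof.
case/connectP => p; elim/last_ind: p l => [|p l' IH] l.
  move=> _ ->; exists [set k]; split; rewrite ?set11 //.
    by move=> i /set1P ->.
  have -> : indic [set k] = unitv k by apply/funext => i; rewrite /indic inE.
  by rewrite bform_unit (sd_diag HD) mulrC.
rewrite rcons_path last_rcons => /andP[kp /andP[n0 /eqP dl]] ->.
have [U [kU lU dU qU]] := IH _ kp erefl.
have [l'U|l'U] := boolP (l' \in U); first by exists U.
exists (l' |: U); split; rewrite ?setU11 ?inE ?kU ?orbT //.
  by move=> i /setU1P[->|/dU //]; rewrite -dl dU.
have -> : indic (l' |: U) = fun i => indic U i + unitv l' i.
  apply/funext => i; rewrite /indic /unitv !inE; case: eqVneq => [->|_] /=.
    by rewrite (negbTE l'U).
  by rewrite addr0.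
rewrite bformDl !bformDr [bform (unitv _) (indic _)]bformC bform_unit (sd_diag HD).
have h := bform_indic_le lU l'U; have ll' : last k p != l' by apply: contraNneq l'U => <-.
have dlk := dU _ lU.
have a1 : C (last k p) l' <= -1.
  by have := sd_offdiag HD ll'; move: n0; lia.
have : d (last k p) * C (last k p) l' <= - d k.
  by rewrite dlk -[X in _ <= X]mulrN1 ler_wpM2l.
rewrite -dl dlk; lia.
Qed.

Lemma connect_dsym k l : connect eqlen k l -> dsym D l = dsym D k.
Proof. by case/connect_indic => U [_ lU dU _]; apply: dU. Qed.

Lemma eqlen_neighbour k u u' s s' :
  connect eqlen k u -> connect eqlen k u' -> C u s != 0 -> C u' s' != 0 ->
  dsym D s != dsym D k -> dsym D s' != dsym D k -> s = s'.
Proof.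
move=> ku ku' us us' ds ds'; apply/eqP; apply: contraT => ss'.
have esym : connect_sym eqlen.
  by apply: sym_connect_sym => i j; rewrite /eqlen cart_eq0 [dsym D i == _]eq_sym.
have uu' : connect eqlen u u' by apply: connect_trans ku'; rewrite esym.
have [U [uU u'U dU qU]] := connect_indic uu'.
rewrite (connect_dsym ku) in dU qU.
have sU : s \notin U by apply: contra ds => /dU ->.
have s'U : s' \notin U by apply: contra ds' => /dU ->.
(* with multiplicities [al] and [be] for the two outer roots, twice the sum of the
   roots of [U] plus these would have nonpositive norm *)
have outer v t : v \in U -> t \notin U -> C v t != 0 -> dsym D t != dsym D k ->
    exists2 al : int, 0 < al &
      4 * al * bform (indic U) (unitv t) + al * al * (2 * d t) <= - (4 * d k).
  move=> vU tU vt dt; have h := bform_indic_le vU tU.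
  have vt' : v != t by apply: contraNneq tU => <-.
  have dv := dU _ vU; have dk0 := sd_dpos HD k.
  have [[E _ _]|[r [r23 E Cvt Ctv]]|[r [r23 E Ctv Cvt]]] := cart_adjacent vt' vt.
  - by rewrite -dv E eqxx in dt.
  (* The multiplicity is 1 for a longer neighbour and the ratio [r] for a shorter one. In both cases
     the left side is at most -2 r d_k, and r >= 2. *)
  - exists 1 => //; rewrite Cvt dv in h; rewrite dv in E; rewrite E PoszM.
    have rx : 2 * d k <= r%:Z * d k by rewrite ler_wpM2r // lez_nat; case/andP: r23.
    move: h rx; rewrite mulrN [d k * _]mulrC.
    by move: (bform _ _) (r%:Z * d k) (d k) => B p x; clear; lia.
  - have r2 : 2 <= r%:Z :> int by rewrite lez_nat; case/andP: r23.
    exists r%:Z; first exact: lt_le_trans r2.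
    rewrite Cvt mulrN1 E PoszM in h; rewrite -dv E PoszM.
    have rx : 2 * (r%:Z * d t) <= r%:Z * (r%:Z * d t) by rewrite ler_wpM2r.
    have rB : r%:Z * bform (indic U) (unitv t) <= r%:Z * - (r%:Z * d t) by rewrite ler_wpM2l.
    move: rB rx; rewrite mulrN.
    have -> : r%:Z * r%:Z * (2 * d t) = 2 * (r%:Z * (r%:Z * d t)) by ring.
    have -> : 4 * r%:Z * bform (indic U) (unitv t) = 4 * (r%:Z * bform (indic U) (unitv t)) by ring.
    by move: (r%:Z * bform (indic U) (unitv t)) (r%:Z * (r%:Z * d t)) (r%:Z * d t) => B p x; clear; lia.
have [al al0 h1] := outer _ _ uU sU us ds.
have [be be0 h2] := outer _ _ u'U s'U us' ds'.
have := bform_gt0 (x := fun i => (2 * indic U i + al * unitv s i) + be * unitv s' i).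
rewrite !bformDl !bformDr !bformZl !bformZr !bform_unit !(sd_diag HD).
rewrite [bform (unitv s) (indic _)]bformC [bform (unitv s') (indic _)]bformC.
have nzv : exists i, 2 * indic U i + al * unitv s i + be * unitv s' i != 0.
  by exists u; rewrite /indic uU /unitv; case: (u == s); case: (u == s'); lia.
move/(_ nzv).
have B1 : d s * C s s' <= 0 by rewrite mulr_ge0_le0 ?(sd_offdiag HD).
have B2 : d s' * C s' s <= 0 by rewrite mulr_ge0_le0 ?(sd_offdiag HD) // eq_sym.
have B1' : al * (be * (d s * C s s')) <= 0 by rewrite (mulr_ge0_le0 (ltW al0)) ?(mulr_ge0_le0 (ltW be0)).
have B2' : be * (al * (d s' * C s' s)) <= 0 by rewrite (mulr_ge0_le0 (ltW be0)) ?(mulr_ge0_le0 (ltW al0)).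
set x := bform _ (unitv s) in h1 *; set y := bform _ (unitv s') in h2 *.
set z := bform _ _ in qU *; set w := al * _ in B1' *; set w' := be * _ in B2' *.
lra.
Qed.

(* A multiple bond is the only one, so the shorter of its two lengths divides
   all the others. *)
Lemma short_dsym k j : k != j -> C k j <= -2 -> dsym D k = 1%N.
Proof.
move=> kj Ckj; have nkj : C k j != 0 by lia.
have [[_ h _]|[m [m23 dj _ _]]|[m [_ _ _ h]]] := cart_adjacent kj nkj; try lia.
have dk0 := sd_dpos HD k.
have djk : dsym D j != dsym D k by rewrite dj; nia.
(* By [eqlen_neighbour], [j] is the only neighbour of different length of the component of [k], and
   conversely. Hence nothing is attached to [T], and only two lengths occur. *)
pose T := [set l | connect eqlen k l || connect eqlen j l].
have TT : T = setT.
  apply: (sd_indec HD); first by apply/set0Pn; exists k; rewrite inE connect0.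
  move=> i l; rewrite !inE negb_or => /orP[ki|ji] /andP[kl jl]; apply/eqP; apply: contraT => il.
    have dl : dsym D l != dsym D k.
      apply: contra kl => /eqP dl; apply: connect_trans (ki) (connect1 _).
      by rewrite /eqlen il dl (connect_dsym ki) eqxx.
    have E := eqlen_neighbour ki (connect0 _ _) il nkj dl djk.
    by rewrite E connect0 in jl.
  have dl : dsym D l != dsym D j.
    apply: contra jl => /eqP dl; apply: connect_trans (ji) (connect1 _).
    by rewrite /eqlen il dl (connect_dsym ji) eqxx.
  have E := eqlen_neighbour ji (connect0 _ _) il _ dl _ (s' := k).
  by rewrite E ?connect0 // 1?cart_eq0 // 1?eq_sym in kl.
have dvd i : (dsym D k %| dsym D i)%N.
  have : i \in T by rewrite TT inE.
  by rewrite inE => /orP[] /connect_dsym ->; rewrite ?dj ?dvdn_mull.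
apply/eqP; rewrite -dvdn1 -(sd_dcoprime HD).
by elim/big_rec: _ => [|i x _ hx]; rewrite ?dvdn0 // dvdn_gcd dvd.
Qed.

End Cartan.

(** A vector in the kernel of C has norm 0 for the symmetrized form. *)
Lemma simple_good_datum (F : fieldType) (K : finType) (D : datum F K) :
  simple_datum D -> qpar D != 0 -> not_root_of_unity (qpar D) -> good_datum D.
Proof.
move=> HD q0 qr; split=> //; [exact: sd_dpos|exact: sd_diag|] => x hx i.
apply/eqP; apply: contraT => xi.
have := bform_gt0 HD (ex_intro _ i xi); rewrite /bform.
rewrite exchange_big big1 ?ltxx // => j _.
transitivity ((dsym D j)%:Z * x j * (\sum_i x i * cart D j i)); last by rewrite hx mulr0.
rewrite mulr_sumr; apply: eq_bigr => k _.
by rewrite (sd_dsym HD k j); ring.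
Qed.

Lemma sum_ext (I : finType) (J : {set I}) (x : sub J -> int) (f : I -> int) :
  \sum_i oapp x 0 (insub i) * f i = \sum_j x j * f (val j).
Proof.
rewrite (bigID (fun i => i \in J)) /= [X in _ + X]big1 ?addr0 => [|i iJ].
  by rewrite big_sub; apply: eq_bigr => j _; rewrite valK.
by rewrite insubN // mul0r.
Qed.

(** Extended by 0, a vector in the kernel of C_J need not lie in the kernel of C, but its norm only
    involves the entries in J and is still 0. *)
Lemma res_good_datum (F : fieldType) (K : finType) (D : datum F K) (J : {set K}) :
  simple_datum D -> qpar D != 0 -> not_root_of_unity (qpar D) -> good_datum (resD J D).
Proof.
move=> HD q0 qr; split=> //.
- by move=> i; apply: (sd_dpos HD).
- by move=> i; apply: (sd_diag HD).
move=> x hx i; apply/eqP; apply: contraT => xi.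
pose X k := oapp x 0 (insub k).
have Xi : X (val i) = x i by rewrite /X valK.
have nzX : exists k, X k != 0 by exists (val i); rewrite Xi.
have := bform_gt0 HD nzX; rewrite (_ : bform D X X = 0) ?ltxx //.
rewrite /bform exchange_big /=.
transitivity (\sum_j X j * (\sum_i X i * ((dsym D j)%:Z * cart D j i))).
  apply: eq_bigr => j _; rewrite mulr_sumr; apply: eq_bigr => k _.
  by rewrite (sd_dsym HD k j); ring.
rewrite sum_ext big1 // => j _; rewrite sum_ext.
have -> : \sum_k x k * ((dsym D (val j))%:Z * cart D (val j) (val k))
   = (dsym D (val j))%:Z * \sum_k x k * cart (resD J D) j k.
  by rewrite mulr_sumr; apply: eq_bigr => k _ /=; ring.
by rewrite hx !mulr0.
Qed.

(** * Closed form of A_{j,a} *)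

Lemma mul_telescope2 (E : fieldType) (c c' z x y : E) : x != 0 ->
  c * z / x * (c' * x / y) = c * c' * z / y.
Proof. by move=> x0; rewrite [c' * x]mulrC -!mulrA mulKf // [z * _]mulrCA. Qed.

Section Aformula.
Variables (F : fieldType) (K : finType) (D : datum F K).
Hypothesis HD : simple_datum D.
Hypothesis q0 : qpar D != 0.
Local Notation "p %:F" := (@FracField.tofrac {poly F} p).

Let cst (b : F) : ratfun F := (b%:P)%:F.
Let lin1 (c : F) : ratfun F := (1 - c *: 'X)%:F.

Let lin1_neq0 c : lin1 c != 0.
Proof. by rewrite tofrac_eq0 -[c]mulr1 Ap_den. Qed.

Let cst_neq0 b : b != 0 -> cst b != 0.
Proof. by rewrite tofrac_eq0 polyC_eq0. Qed.

Let cstM b c : cst (b * c) = cst b * cst c.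
Proof. by rewrite /cst polyCM rmorphM. Qed.

Lemma ApE (b a : F) : b != 0 -> Ap b a = cst b * lin1 (a / b) / lin1 (a * b).
Proof.
move=> b0; rewrite /Ap /cst /lin1 -rmorphM /=; congr (_%:F / _).
by rewrite mulrBr mulr1 mul_polyC scalerA mulrC divfK.
Qed.

Lemma ApV (b a : F) : b != 0 -> (Ap b a)^-1 = Ap b^-1 a.
Proof.
move=> b0; have bV0 : b^-1 != 0 by rewrite invr_eq0.
have E : cst b^-1 = (cst b)^-1.
  by apply: (mulfI (cst_neq0 b0)); rewrite -cstM !mulfV ?cst_neq0 // /cst rmorph1.
by rewrite !ApE // invrK E !invfM invrK mulrAC.
Qed.

Lemma Ap1 (a : F) : Ap 1 a = 1.
Proof. by rewrite ApE ?oner_neq0 // divr1 mulr1 mulfK ?lin1_neq0 // /cst rmorph1. Qed.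

(** Up to the constant b, [Ap b a] is (1 - (a/b) z)/(1 - a b z); at the parameters a/b and a b the
    factors 1 - a z cancel. *)
Lemma Ap_sqr (b a : F) : b != 0 -> Ap b (a / b) * Ap b (a * b) = Ap (b ^+ 2) a.
Proof.
move=> b0; rewrite !ApE ?expf_neq0 // divfK // mulfK // expr2 invfM cstM !(mulrA a).
by apply: mul_telescope2; apply: lin1_neq0.
Qed.

Lemma Ap_cube (b a : F) : b != 0 ->
  Ap b (a / b ^+ 2) * Ap b a * Ap b (a * b ^+ 2) = Ap (b ^+ 3) a.
Proof.
move=> b0; have -> : b ^+ 3 = b ^+ 2 * b by rewrite exprSr.
rewrite !ApE ?mulf_neq0 ?expf_neq0 // !cstM.
have -> : a / b ^+ 2 * b = a / b by rewrite expr2; field.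
have -> : a * b ^+ 2 / b = a * b by rewrite expr2; field.
have -> : a / b ^+ 2 / b = a / (b ^+ 2 * b) by rewrite [(_ * b)^-1]invfM mulrA.
rewrite [a * (b ^+ 2 * b)]mulrA.
rewrite !mul_telescope2 ?lin1_neq0 //.
Qed.

Lemma YE i a k : Y D i a k = if k == i then Ap (qi D i) a else 1.
Proof.
rewrite ffunE; case: eqP => // _; rewrite ApE ?expf_neq0 //.
by rewrite /cst /lin1 -rmorphM /= mul_polyC.
Qed.

Let prod_at (P : pred K) (f : K -> ratfun F) k :
  \prod_(j | P j) (if k == j then f j else 1) = if P k then f k else 1.
Proof.
rewrite big_mkcond (bigD1 k) //= eqxx big1 ?mulr1 // => j jk.
by rewrite eq_sym (negbTE jk); case: ifP.
Qed.

Let if_mul (b : bool) (x y : ratfun F) :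
  (if b then x else 1) * (if b then y else 1) = if b then x * y else 1.
Proof. by case: b; rewrite ?mulr1. Qed.

(** For C_{kj} = -2 or -3 the shifted Y's telescope only if the shift q equals q_k. This holds since
    [short_dsym] gives d_k = 1 for such a [k]. *)
Lemma A_E j a k : A D j a k = Ap (qi D k ^ (cart D k j)) a.
Proof.
have qn i : qi D i != 0 by rewrite expf_neq0.
rewrite ffunE.
rewrite (eq_bigr (fun i => if k == i then Ap (qi D i) a else 1)); last by move=> i _; rewrite YE.
rewrite [\prod_(i | _ == -2) _](eq_bigr (fun i => if k == i then
    Ap (qi D i) (a / qpar D) * Ap (qi D i) (a * qpar D) else 1)); last first.
  by move=> i _; rewrite !YE if_mul.
rewrite [\prod_(i | _ == -3) _](eq_bigr (fun i => if k == i then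
    Ap (qi D i) (a / qpar D ^+ 2) * Ap (qi D i) a * Ap (qi D i) (a * qpar D ^+ 2) else 1)); last first.
  by move=> i _; rewrite !YE !if_mul.
rewrite !prod_at !YE if_mul.
have [->|kj] := eqVneq k j.
  by rewrite (sd_diag HD) /= !mulr1 invr1 mulr1 Ap_sqr.
rewrite mul1r.
have [c0|c0] := eqVneq (cart D k j) 0.
  by rewrite c0 /= !mulr1 invr1 expr0z Ap1.
have short : cart D k j <= -2 -> qi D k = qpar D.
  by move=> h; rewrite /qi (short_dsym HD kj h).
have [[_ cE _]|[m [m23 _ cE _]]|[m [_ _ _ cE]]] := cart_adjacent HD kj c0.
- by rewrite cE /= !mulr1 ApV.
- have [E|E] : m = 2%N \/ m = 3%N by lia.
    by rewrite cE E /= mul1r mulr1 -(short _) ?cE ?E // Ap_sqr ?qn // ApV ?expf_neq0.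
  by rewrite cE E /= !mul1r -(short _) ?cE ?E // Ap_cube ?qn // ApV ?expf_neq0.
- by rewrite cE /= !mulr1 ApV.
Qed.

Lemma tinv_A j a : tinv (A D j a) = [ffun k => Ap (qi D k ^ (- cart D k j)) a].
Proof.
apply/ffunP => k; rewrite [LHS]ffunE [RHS]ffunE A_E ApV ?expfz_neq0 ?expf_neq0 //.
by rewrite invr_expz.
Qed.

End Aformula.

(** * Direct sums of modules *)

Section PackLinear.
Variables (F : fieldType) (V W : lmodType F) (f : V -> W).
Hypothesis linf : lin f.

Definition pack_linear : {linear V -> W} :=
  HB.pack_for {linear V -> W} f (GRing.isLinear.Build F V W *:%R f linf).

End PackLinear.

Section PairMap.
Variables (F : fieldType) (V W : lmodType F) (f : {linear V -> V}) (g : {linear W -> W}).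

Lemma pair_map_lin : lin (fun u : V * W => (f u.1, g u.2)).
Proof. by move=> a u w; rewrite !linearP. Qed.

Definition pair_map : {linear (V * W)%type -> (V * W)%type} := pack_linear pair_map_lin.

End PairMap.

Lemma pair_sum (F : fieldType) (V W : lmodType F) (I : Type) (r : seq I) (f : I -> V) (g : I -> W) :
  \sum_(i <- r) ((f i, g i) : V * W) = (\sum_(i <- r) f i, \sum_(i <- r) g i).
Proof.
elim: r => [|i r IH]; first by rewrite !big_nil.
by rewrite !big_cons IH.
Qed.

Section DirectSum.
Variables (F : fieldType) (K : finType) (D : datum F K) (nu : {ffun K -> int}).
Variables (V W : qmodule D nu).
Local Notation VW := (V * W)%type.

Definition sum_x e i r : {linear VW -> VW} := pair_map (mx V e i r) (mx W e i r).
Definition sum_phi e i r : {linear VW -> VW} := pair_map (mphi V e i r) (mphi W e i r).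

Lemma ops_exp_pair (f : nat -> V -> V) (g : nat -> W -> W) r (u : VW) :
  ops_exp (fun k (u : VW) => (f k u.1, g k u.2)) r u = (ops_exp f r u.1, ops_exp g r u.2).
Proof.
have it k s (w : VW) : iter k (ops_mul (fun k (u : VW) => (f k u.1, g k u.2))) (@ops_one F VW) s w
    = (iter k (ops_mul f) (@ops_one F V) s w.1, iter k (ops_mul g) (@ops_one F W) s w.2).
  elim: k s w => [|k IH] s w; first by rewrite /= /ops_one; case: ifP; case: w.
  rewrite /= /ops_mul -pair_sum; apply: eq_bigr => l _.
  by rewrite IH.
by rewrite /ops_exp -pair_sum; apply: eq_bigr => k _; rewrite it.
Qed.

Lemma serre_word_pair e i j s l r (u : VW) :
  serre_word (fun e i r => sum_x e i r) e i j s l r u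
  = (serre_word (fun e i r => mx V e i r) e i j s l r u.1,
     serre_word (fun e i r => mx W e i r) e i j s l r u.2).
Proof.
have fp (t : seq int) (w : VW) : foldr (sum_x e i) w t
    = (foldr (mx V e i) w.1 t, foldr (mx W e i) w.2 t).
  by elim: t => [|k t IH] /=; [case: w|rewrite IH].
by rewrite /serre_word !fp.
Qed.

Lemma sum_relations : relations D nu sum_x sum_phi.
Proof.
have := mrel V; have := mrel W.
case=> w1 w2 w3 w4 w5 [hW [w6 w6']] w7 w8 w9 [v1 v2 v3 v4 v5 [hV [v6 v6']] v7 v8 v9].
split.
- move=> e i; have [g gK Kg] := v1 e i; have [g' gK' Kg'] := w1 e i.
  exists (fun u => (g u.1, g' u.2)) => -[a b] /=; first by rewrite gK gK'.
  by congr pair.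
- by move=> e e' i j r s u /=; rewrite v2 w2.
- by move=> e e' i j r u /=; rewrite v3 w3.
- by move=> i r u r0 /=; rewrite v4 // w4.
- by move=> i r u r0 /=; rewrite v5 // w5.
- exists (fun i m u => (hV i m u.1, hW i m u.2)); split.
    move=> e i r u; rewrite /= v6 w6.
    have -> : hseries D (fun i m (u : VW) => (hV i m u.1, hW i m u.2)) e i
       = fun k (u : VW) => (hseries D hV e i k u.1, hseries D hW e i k u.2).
      by apply/funext => k; apply/funext => w; rewrite /hseries; case: ifP.
    by rewrite ops_exp_pair.
  by move=> i j m r e u m0 /=; apply: injective_projections; [apply: v6'|apply: w6'].
- move=> i j r s u; have := v7 i j r s u.1; have := w7 i j r s u.2.
  by case: ifP => _ hb ha; apply: injective_projections.
- by move=> e i j r s u; apply: injective_projections; [apply: v8|apply: w8].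
- move=> e i j ij p pE r' r u; have ha := v9 e i j ij p pE r' r u.1.
  have hb := w9 e i j ij p pE r' r u.2; rewrite -[RHS]/(0, 0) -ha -hb -pair_sum.
  apply: eq_bigr => s _; rewrite -pair_sum; apply: eq_bigr => l _.
  by rewrite serre_word_pair.
Qed.

Definition sum_mod : qmodule D nu := QModule sum_relations.

Lemma sum_wspace e g (u : V) (w : W) :
  wspace (V := sum_mod) e g (u, w) <-> wspace e g u /\ wspace e g w.
Proof.
split=> [h|[h1 h2] i]; last by rewrite /= h1 h2.
by split=> i; have [] := h i.
Qed.

Lemma sum_jgen th (u : V) (w : W) :
  jgen (phi_plus sum_mod) th (u, w) <-> jgen (phi_plus V) th u /\ jgen (phi_plus W) th w.
Proof.
have it k a p : iter p (shiftop (phi_plus sum_mod) k a) (u, w)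
    = (iter p (shiftop (phi_plus V) k a) u, iter p (shiftop (phi_plus W) k a) w).
  by elim: p => //= p ->.
split=> [[p hp]|[[p hp] [r hr]]].
  by split; exists p => k; have := hp k; rewrite it => -[].
exists (p + r)%N => k; rewrite it (iter_ge0 (shiftop_lin _ _ _) (leq_addr _ _) (hp k)).
by rewrite (iter_ge0 (shiftop_lin _ _ _) (leq_addl _ _) (hr k)).
Qed.

End DirectSum.

Lemma sums_seq (F : fieldType) (V : lmodType F) (P : V -> Prop) u : sums P u ->
  exists s : seq V, (forall v, v \in s -> P v) /\ u = \sum_(v <- s) v.
Proof.
elim=> [|v w Pv _ [s [sP ->]]]; first by exists [::]; rewrite big_nil; split.
exists (v :: s); rewrite big_cons; split=> // z; rewrite inE => /orP[/eqP -> //|].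
exact: sP.
Qed.

(** The terms sharing the eigenvalue of the first one are grouped; if they add up to 0 they are
    dropped, which shortens the list without changing the sum. *)
Lemma sums_component (F : closedFieldType) (V : lmodType F) (kT : Type)
    (T : kT -> {linear V -> V}) (R : V -> Prop) u :
  (forall v, R v -> exists th, jgen T th v) -> sums R u -> u != 0 ->
  exists th u1 u2, [/\ u = u1 + u2, u1 != 0, sums (fun v => R v /\ jgen T th v) u1
    & sums (fun v => R v /\ exists2 th', th' <> th & jgen T th' v) u2].
Proof.
move=> Rg /sums_seq[s [sR ->]] {u}.
move: {2}(size s).+1 (ltnSn (size s)) => N; elim: N s sR => // N IH [|w s] sR sN.
  by rewrite big_nil eqxx.
have [th hth] := Rg _ (sR w (mem_head _ _)).
pose b v := `[< jgen T th v >]; rewrite (bigID b) /= -big_filter -[X in _ + X]big_filter.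
set u1 := \sum_(i <- filter b _) i; set s2 := filter _ _.
have h1 : sums (fun v => R v /\ jgen T th v) u1.
  apply: (sums_of_seq (f := id)) => v; rewrite mem_filter => /andP[/asboolP bv vs].
  by split=> //; apply: sR.
have h2 v : v \in s2 -> R v /\ exists2 th', th' <> th & jgen T th' v.
  rewrite mem_filter => /andP[/asboolP bv vs]; have Rv := sR _ vs.
  by split=> //; have [th' hth'] := Rg _ Rv; exists th' => // E; apply: bv; rewrite -E.
have [u10|u10] := eqVneq u1 0; last first.
  move=> _; exists th, u1, (\sum_(v <- s2) v); split=> //.
  by apply: (sums_of_seq (f := id)).
rewrite u10 add0r; apply: IH => [v /h2[] //|].
rewrite -ltnS; apply: leq_trans sN; rewrite ltnS /s2 /= /b asboolT //=.
by rewrite size_filter; apply: count_size.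
Qed.

(** * Modules of highest l-weight *)

Section Highest.
Variables (F : numClosedFieldType) (K : finType) (D : datum F K).
Hypothesis gD : good_datum D.
Variables (nu : {ffun K -> int}) (V : qmodule D nu).
Variables (X : finType) (io : X -> K).
Hypothesis cover : forall k,
  (exists j, io j = k) \/ (forall r v, mx V false k r v = 0).
Variables (v0 : V) (c : bool -> K -> int -> F) (Psi0 : {ffun K -> ratfun F}).
Hypothesis v00 : v0 != 0.
Hypothesis xp0 : forall i r, mx V true i r v0 = 0.
Hypothesis phi0 : forall e i r, mphi V e i r v0 = c e i r *: v0.
Hypothesis Psi0r : in_r Psi0.
Hypothesis cPsi : forall i (r : nat), c true i r = ser (Psi0 i) r.
Local Notation lam := (varpi Psi0).
Local Notation lows := (lows io v0).
Local Notation low := (low io v0).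
Local Notation nr := (nroot D io).
Local Notation Ar := (Aroot D io).

Lemma top_weightE : top_weight c = lam.
Proof. by apply/ffunP => i; rewrite !ffunE value0_ser // -cPsi. Qed.

Lemma low_weight m w : low m w -> wspace true (tmul lam (mono nr m)) w.
Proof. by rewrite -top_weightE; apply: low_wspace. Qed.

Lemma lows_weight g v : lows v -> wspace true g v -> v != 0 ->
  exists m, g = tmul lam (mono nr m).
Proof.
move=> lv gv v00'.
have hR w : (exists m, low m w) -> exists g', wspace true g' w.
  by move=> [m /low_weight h]; exists (tmul lam (mono nr m)).
have hs := sums_wspace_project hR lv (jgen_eigen (T := phi_zero V) gv).
apply: contrapT => no; case/negP: v00'; apply/eqP; elim: hs => // w w' [[m hm] gw] _ ->.
rewrite addr0; apply/eqP; apply: contrapT => /negP w0; apply: no; exists m.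
have hl := low_weight hm; apply/ffunP => i; apply/eqP; rewrite -subr_eq0.
have := gw i; have := hl i; rewrite /= !expr1z => -> /eqP.
by rewrite -subr_eq0 -scalerBl scaler_eq0 (negbTE w0) orbF -opprB oppr_eq0.
Qed.

(** By independence of the simple roots only the empty word has weight [lam], so this weight space
    of [lows] is the line of [v0]. *)
Lemma lows_top v : lows v -> wspace true lam v -> exists a, v = a *: v0.
Proof.
move=> lv gv.
have hR w : (exists m, low m w) -> exists g', wspace true g' w.
  by move=> [m /low_weight h]; exists (tmul lam (mono nr m)).
have hs := sums_wspace_project hR lv (jgen_eigen (T := phi_zero V) gv).
apply: (sums_min (low_subspace io v0 [::]) _ hs) => w [[m hm] gw].
have [->|w0] := eqVneq w 0; first by exists 0; rewrite scale0r.
suff m0 : m = [::] by move: hm; rewrite m0.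
have E : mono nr m = mono nr [::].
  apply: (tmulI (f := lam)); first exact: varpi_in_t.
  rewrite tmul_mono0; apply/ffunP => i; have := low_weight hm i; have := gw i.
  rewrite /= !expr1z => -> /eqP; rewrite -subr_eq0 -scalerBl scaler_eq0 (negbTE w0) orbF.
  by rewrite subr_eq0 => /eqP.
case: m hm E => // j m _ /(mono_nroot_perm gD)/(_ (io j)).
by rewrite /= eqxx.
Qed.

Lemma v0_weight : wspace true lam v0.
Proof. by move=> i; rewrite /lead phi0 ffunE value0_ser // cPsi. Qed.

Lemma v0_lspace : lspace Psi0 v0.
Proof. by apply/lspaceP => //; apply: jgen_eigen => -[i r]; rewrite /phi_plus phi0 cPsi. Qed.

Hypothesis OV : in_O V.

Lemma low_fd m : exists n, has_dim (low m) n.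
Proof.
have gt : in_t (tmul lam (mono nr m)).
  by apply: in_t_rel; [exact: varpi_in_t|apply: mono_nroot_in_t].
have [n hn] := wspace_fd OV gt.
exact: has_dim_sub (low_subspace io v0 m) (@low_weight m) (wspace_subspace V _) hn.
Qed.

Hypothesis gen : generated_by v0.

Lemma all_lows v : lows v.
Proof.
apply: gen; last exact: v0_lows.
exact: (lows_submodule gD cover v00 xp0 phi0).
Qed.

Lemma highest_in_P g : in_P V true g -> exists m, g = tmul lam (mono nr m).
Proof. by move=> [_ [v vn0 gv]]; apply: lows_weight gv vn0; apply: all_lows. Qed.

Lemma highest_lspace v : lspace Psi0 v -> exists a, v = a *: v0.
Proof. by move=> h; apply: lows_top (all_lows v) _; apply: lspace_wspace. Qed.

Lemma highest_top : top_lweight V Psi0.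
Proof.
have lt : in_t lam by apply: varpi_in_t.
have iP : in_P V true lam by split=> //; exists v0 => //; apply: v0_weight.
split.
  split; first by split=> //; exists v0 => //; apply: v0_lspace.
  split=> // g gP; have [gt _] := gP; have [m gE] := highest_in_P gP => le.
  by apply/esym/(wle_anti gD) => //; rewrite gE; apply: wle_mono_nroot.
move=> Psi [[hPsi [w w0 lw]] [PP Pmax]].
have [m E] := highest_in_P PP.
have lE : lam = varpi Psi by apply: Pmax => //; rewrite E; apply: wle_mono_nroot.
have gw := lspace_wspace OV hPsi lw; rewrite -lE in gw.
have [a wE] := lows_top (all_lows w) gw.
apply: (theta_inj hPsi Psi0r).
have /lspaceP/(_) lj := lw; apply: (jgen_eigenvalue w0 ((lspaceP w hPsi).1 lw)).
by move=> -[i r]; rewrite wE /phi_plus linearZ /= phi0 cPsi !scalerA mulrC.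
Qed.

Lemma highest_chiq : chiq V Psi0 = 1.
Proof.
rewrite /chiq asboolT //; congr Posz; apply: dimE; first exact: lspace_subspace.
exists (fun _ => v0); split.
- by move=> _; apply: v0_lspace.
- move=> a; rewrite big_ord1 => /eqP; rewrite scaler_eq0 (negbTE v00) orbF => /eqP a0 i.
  by rewrite ord1.
- by move=> v /highest_lspace[a ->]; exists (fun _ => a); rewrite big_ord1.
Qed.

Lemma highest_is_lweight Psi : is_lweight V Psi ->
  exists mm, Psi = tmul Psi0 (mono Ar mm).
Proof.
move=> [hPsi [w w0 lw]].
pose R u := exists mm, lspace (tmul Psi0 (mono Ar mm)) (u : V).
have inr mm : in_r (tmul Psi0 (mono Ar mm)) by apply: Psi0_mono_in_r.
have hw : sums R w.
  have := all_lows w; elim=> [|u u' [m hm] _ IH]; first exact: sums0.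
  apply: sumsD IH; have := low_lspaces gD v00 phi0 Psi0r cPsi low_fd hm.
  by apply: sums_mono => z [].
have hR u : R u -> exists th, jgen (phi_plus V) th u.
  by move=> [mm /(lspaceP _ (inr mm)) h]; exists (theta (tmul Psi0 (mono Ar mm))).
have := sums_project (@phi_plus_comm _ _ _ _ V) hR hw ((lspaceP w hPsi).1 lw).
move=> hs; apply: contrapT => no; case/negP: w0; apply/eqP.
elim: hs => // u u' [[mm lu] ju] _ ->; rewrite addr0; apply/eqP.
apply: contrapT => /negP u0; apply: no; exists mm; apply: (theta_inj hPsi (inr mm)).
exact: jgen_inj u0 ju ((lspaceP u (inr mm)).1 lu).
Qed.

End Highest.

(** * Restriction to J *)

Section Restrict.
Variables (F : numClosedFieldType) (I : finType) (D : datum F I) (J : {set I}).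
Hypothesis HD : simple_datum D.
Hypothesis q0 : qpar D != 0.
Hypothesis qr : not_root_of_unity (qpar D).
Variables (mu : {ffun I -> int}) (nu : {ffun sub J -> int}).
Hypothesis munu : res J mu = nu.
Variable V : qmodule D mu.
Let gD := simple_good_datum HD q0 qr.
Let gJ := res_good_datum J HD q0 qr.
Local Notation DJ := (resD J D).
Local Notation RV := (res_mod munu V).
Local Notation inJ := (val : sub J -> I).

Lemma res_tmul (T : fieldType) (f g : {ffun I -> T}) :
  res J (tmul f g) = tmul (res J f) (res J g).
Proof. by apply/ffunP => j; rewrite !ffunE. Qed.

Lemma res_mono (T : fieldType) (X : Type) (u : X -> {ffun I -> T}) m :
  res J (mono u m) = mono (fun x => res J (u x)) m.
Proof. by apply/ffunP => j; rewrite !ffunE; apply: eq_bigr => x _; rewrite ffunE. Qed.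

Lemma res_nroot : (fun j => res J (nroot D inJ j)) = nroot DJ id.
Proof. by apply/funext => j; apply/ffunP => k; rewrite !ffunE. Qed.

Lemma res_Aroot : (fun x => res J (Aroot D inJ x)) = Aroot DJ id.
Proof. by apply/funext => j; apply/ffunP => k; rewrite !ffunE. Qed.

Lemma in_r_res (Psi : {ffun I -> ratfun F}) : in_r Psi -> in_r (res J Psi).
Proof. by move=> h j; rewrite ffunE. Qed.

Lemma res_wspace_of g (v : V) : wspace true g v -> wspace (V := RV) true (res J g) v.
Proof. by move=> h j; rewrite ffunE; apply: h. Qed.

Lemma res_lspace_of Psi (v : V) : lspace Psi v -> lspace (V := RV) (res J Psi) v.
Proof.
move=> [c hc [p hp]]; exists (fun j => c (val j)); first by move=> j; rewrite ffunE.
by exists p => j r; apply: hp.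
Qed.

Lemma mono_nroot_res m m' :
  res J (mono (nroot D inJ) m) = res J (mono (nroot D inJ) m') -> perm_eq m m'.
Proof.
rewrite !res_mono res_nroot => /(mono_nroot_perm gJ) h.
by apply/allP => j _ /=; apply/eqP; apply: h.
Qed.

Lemma mono_perm (T : fieldType) (X : eqType) (u : X -> {ffun I -> T}) m m' :
  perm_eq m m' -> mono u m = mono u m'.
Proof. by move=> h; apply/ffunP => k; rewrite !ffunE; apply: perm_big. Qed.

Hypothesis OV : in_O V.

Section Weights.
Variable lam : {ffun I -> F}.
Hypothesis lt : in_t lam.
Hypothesis wt : forall g, in_P V true g ->
  exists m : seq (sub J), g = tmul lam (mono (nroot D inJ) m).

(** [v] is a sum of weight vectors of [V], and only those with the given restricted weight count.
    Their weights lie in lambda - Q_J^+ by [wt], where the components in J determine the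
    monomial. *)
Lemma res_wspace m (v : V) :
  wspace (V := RV) true (res J (tmul lam (mono (nroot D inJ) m))) v
  <-> wspace true (tmul lam (mono (nroot D inJ) m)) v.
Proof.
split; last exact: res_wspace_of.
move=> hv; pose R (w : RV) := exists2 g, in_t g & wspace (V := V) true g w.
have hR w : R w -> exists g', wspace (V := RV) true g' w.
  by move=> [g _ hg]; exists (res J g); apply: res_wspace_of.
have := sums_wspace_project hR (sums_wspace OV v) (jgen_eigen (T := phi_zero RV) hv).
apply: (sums_min (wspace_subspace V _)) => w [[g gt gw] hw].
have [->|w0] := eqVneq (w : V) 0; first exact: subspace0 (wspace_subspace V _).
have [|m' gE] := wt (g := g); first by split=> //; exists w.
suff -> : tmul lam (mono (nroot D inJ) m) = g by [].
rewrite gE; congr (tmul _ _); apply: mono_perm; apply: mono_nroot_res.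
apply: (tmulI (f := res J lam)); first by move=> j; rewrite ffunE.
rewrite -!res_tmul -gE; apply/ffunP => j.
have := res_wspace_of gw j; have := hw j; rewrite /= !expr1z => -> /eqP.
rewrite -subr_eq0 -scalerBl scaler_eq0 (negbTE w0) orbF subr_eq0 => /eqP.
by [].
Qed.

Lemma x_outside i e r (v : V) : i \notin J -> mx V e i r v = 0.
Proof.
move=> iJ; have := sums_wspace OV v.
elim=> [|w u [g gt gw] _ hu]; first by rewrite linear0.
rewrite linearD hu addr0; apply/eqP; apply: contraT => xw.
have [|m gE] := wt (g := g).
  by split=> //; exists w => //; apply: contraNneq xw => ->; rewrite linear0.
have [|m' gE'] := wt (g := tmul g (rootw D (fun k => sg e * (k == i)%:Z))).
  split; first by apply: in_t_rel => //; apply: rootw_in_t.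
  by exists (mx V e i r w) => //; apply: wspace_x.
have : tmul (mono (nroot D inJ) m) (rootw D (fun k => sg e * (k == i)%:Z)) = mono (nroot D inJ) m'.
  by apply: (tmulI lt); rewrite tmulA -gE.
have c0 (s : seq (sub J)) : count (fun j => val j == i) s = 0%N.
  apply/eqP; rewrite -leqn0 leqNgt -has_count; apply/hasPn => j _.
  by apply: contraNneq iJ => <-; apply: valP.
by move/(mono_nroot_shift gD); rewrite !c0; case: (e).
Qed.

End Weights.

Section Lweights.
Variable Psi0 : {ffun I -> ratfun F}.
Hypothesis Psi0r : in_r Psi0.
Hypothesis lw : forall Psi, is_lweight V Psi ->
  exists mm : seq (sub J * {a : F | a != 0}), Psi = tmul Psi0 (mono (Aroot D inJ) mm).

(** As for weights, with the independence of the A_{j,a} for J in place of that of the roots. *)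
Lemma res_lspace mm (v : V) :
  lspace (V := RV) (res J (tmul Psi0 (mono (Aroot D inJ) mm))) v
  <-> lspace (tmul Psi0 (mono (Aroot D inJ) mm)) v.
Proof.
have inr ms : in_r (tmul Psi0 (mono (Aroot D inJ) ms)) by apply: Psi0_mono_in_r.
split; last exact: res_lspace_of.
move=> hv; pose R (w : RV) := exists2 Psi, in_r Psi & lspace (V := V) Psi w.
have hR w : R w -> exists th, jgen (phi_plus RV) th w.
  move=> [Psi hP hg]; exists (theta (res J Psi)).
  by apply/(lspaceP (V := RV) w (in_r_res hP)); apply: res_lspace_of.
have hv' := (lspaceP (V := RV) v (in_r_res (inr mm))).1 hv.
have := sums_project (@phi_plus_comm _ _ _ _ RV) hR (sums_lspace gD OV v) hv'.
apply: (sums_min (lspace_subspace V (inr mm))) => w [[Psi hP Pw] hw].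
have [->|w0] := eqVneq (w : V) 0; first exact: subspace0 (lspace_subspace V _).
have [|ms PE] := lw (Psi := Psi); first by split=> //; exists w.
suff -> : tmul Psi0 (mono (Aroot D inJ) mm) = Psi by [].
rewrite PE; congr (tmul _ _); apply: mono_perm; apply: (Aroot_independent gJ).
rewrite -res_Aroot -!res_mono.
apply: (tmulI (f := res J Psi0)); first by move=> j; rewrite ffunE regular_neq0.
rewrite -!res_tmul -PE; apply: theta_inj; [exact: in_r_res|exact: in_r_res|].
apply: (jgen_inj (T := phi_plus RV) w0 hw).
by apply/(lspaceP (V := RV) w (in_r_res hP)); apply: res_lspace_of.
Qed.

End Lweights.
End Restrict.

Lemma varpi_tmul (F : fieldType) (K : finType) (f g : {ffun K -> ratfun F}) :
  in_r f -> in_r g -> varpi (tmul f g) = tmul (varpi f) (varpi g).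
Proof.
move=> hf hg; apply/ffunP => k; rewrite !ffunE.
have [p [r [p0 r0 fE]]] := hf k; have [p' [r' [p'0 r'0 gE]]] := hg k.
have val (h : ratfun F) (u w : {poly F}) : regular_nonzero0 h -> w.[0] != 0 ->
    h = FracField.tofrac u / FracField.tofrac w -> value0 h = u.[0] / w.[0].
  move=> hh w0 E; have wn : w != 0 by apply: contraNneq w0 => ->; rewrite horner0.
  have := expansion_rep (serP hh) wn E 0; rewrite (@act_widen _ (size w).+1) // big_ord_recl.
  rewrite big1 ?addr0 => [|i _]; last by rewrite ser_neg ?mulr0 // lift0; lia.
  rewrite ?subr0 -value0_ser // /= -!horner_coef0 => <-.
  by rewrite mulrC mulKf.
rewrite (val (f k * g k) (p * p') (r * r')); first 1 last.
- exact: regularM.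
- by rewrite hornerM mulf_neq0.
- by rewrite fE gE !rmorphM /= mulf_div.
by rewrite (val _ _ _ (hf k) r0 fE) (val _ _ _ (hg k) r'0 gE) !hornerM mulf_div.
Qed.

Lemma varpi_Aroot (F : numClosedFieldType) (K : finType) (D : datum F K) (X : Type)
    (io : X -> K) x : good_datum D -> varpi (Aroot D io x) = nroot D io x.1.
Proof.
move=> gD; apply/ffunP => k; rewrite [LHS]ffunE [Aroot _ _ _ _]ffunE.
have n0 : nroot D io x.1 k != 0 by rewrite ffunE expfz_neq0 ?qi_neq0.
set b := nroot _ _ _ _ in n0 *; set a := val x.2.
have hr := Ap_regular a n0.
have := expansion_rep (serP hr) (Ap_den b a) (erefl _) 0.
rewrite (@act_widen _ (size (1 - (a * b) *: 'X : {poly F})).+1) // big_ord_recl.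
rewrite big1 ?addr0 => [|i _]; last by rewrite ser_neg ?mulr0 // lift0; lia.
rewrite ?subr0 -value0_ser // /= !coefB !coefZ !coefX !mulr0 !subr0 coef1 coefC /= mul1r.
by [].
Qed.

Lemma varpi_mono_Aroot (F : numClosedFieldType) (K : finType) (D : datum F K) (X : Type)
    (io : X -> K) (Psi : {ffun K -> ratfun F}) mm : good_datum D -> in_r Psi ->
  varpi (tmul Psi (mono (Aroot D io) mm))
  = tmul (varpi Psi) (mono (nroot D io) [seq x.1 | x <- mm]).
Proof.
move=> gD hP; elim: mm => [|x mm IH]; first by rewrite !tmul_mono0.
have hr : in_r (tmul Psi (mono (Aroot D io) mm)) by apply: Psi0_mono_in_r.
rewrite mono_cons tmulA [tmul Psi _]tmulC -tmulA varpi_tmul //; last exact: Aroot_in_r.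
rewrite IH varpi_Aroot //= mono_cons tmulA [tmul (nroot _ _ _) _]tmulC -tmulA.
by [].
Qed.

(** * Inflations *)

Section Main.
Variables (F : numClosedFieldType) (I : finType) (D : datum F I) (J : {set I}).
Hypothesis HD : simple_datum D.
Hypothesis q0 : qpar D != 0.
Hypothesis qr : not_root_of_unity (qpar D).
Variables (mu : {ffun I -> int}) (nu : {ffun sub J -> int}).
Hypothesis munu : res J mu = nu.
Variable PsiJ : {ffun sub J -> ratfun F}.
Hypothesis PsiJr : in_r PsiJ.
Variable W : qmodule (resD J D) nu.
Hypothesis OW : in_O W.
Variables (vW : W) (cW : bool -> sub J -> int -> F).
Hypothesis vW0 : vW != 0.
Hypothesis genW : generated_by vW.
Hypothesis xpW : forall j r, mx W true j r vW = 0.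
Hypothesis phiW : forall e j r, mphi W e j r vW = cW e j r *: vW.
Hypothesis cWP : forall j (r : nat), cW true j r = ser (PsiJ j) r.
Variable V : qmodule D mu.
Hypothesis OV : in_O V.
Let gD := simple_good_datum HD q0 qr.
Let gJ := res_good_datum J HD q0 qr.
Local Notation DJ := (resD J D).
Local Notation RV := (res_mod munu V).
Local Notation inJ := (val : sub J -> I).

Let coverW (k : sub J) : (exists j : sub J, id j = k) \/ (forall r v, mx W false k r v = 0).
Proof. by left; exists k. Qed.

Lemma W_top : top_lweight W PsiJ.
Proof. exact: (highest_top gJ coverW vW0 xpW phiW PsiJr cWP OW genW). Qed.

Lemma W_chiq : chiq W PsiJ = 1.
Proof. exact: (highest_chiq gJ coverW vW0 xpW phiW PsiJr cWP OW genW). Qed.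

Lemma W_in_P g : in_P W true g -> exists m, g = tmul (varpi PsiJ) (mono (nroot DJ id) m).
Proof. exact: (highest_in_P gJ coverW vW0 xpW phiW PsiJr cWP genW). Qed.

Lemma W_is_lweight Psi : is_lweight W Psi ->
  exists mm, Psi = tmul PsiJ (mono (Aroot DJ id) mm).
Proof. exact: (highest_is_lweight gJ coverW vW0 xpW phiW PsiJr cWP OW genW). Qed.

Lemma cartan_Ainv : (fun x : sub J * {a : F | a != 0} => tinv (A D (val x.1) (val x.2)))
  = Aroot D inJ.
Proof.
apply/funext => x; rewrite tinv_A //; apply/ffunP => k.
by rewrite [LHS]ffunE [RHS]ffunE ffunE.
Qed.

Lemma cartan_aneg : (fun j : sub J => rootw D (fun i => - (i == val j)%:Z)) = nroot D inJ.
Proof. by apply/funext => j; rewrite nrootE. Qed.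

Lemma varpi_iota_JE f g : varpi_iota_J D f g
  <-> transport (nroot DJ id : sub J -> _) (nroot D inJ) f g.
Proof.
rewrite /varpi_iota_J cartan_aneg -res_nroot.
have -> : (fun j : sub J => res J (rootw D (fun i => - (i == val j)%:Z)))
    = (fun j => res J (nroot D inJ j)) by apply/funext => j; rewrite nrootE.
by split.
Qed.

Lemma iota_JE f g : iota_J D f g <-> transport (Aroot DJ id) (Aroot D inJ) f g.
Proof.
rewrite /iota_J cartan_Ainv -res_Aroot.
have -> : (fun x : sub J * {a : F | a != 0} => res J (tinv (A D (val x.1) (val x.2))))
    = (fun x => res J (Aroot D inJ x)) by apply/funext => x; rewrite -cartan_Ainv.
by split.
Qed.

(** * Characters of an inflation *)

Section Inflation.
Variable f : {linear RV -> W}.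
Hypothesis fbij : bijective f.
Hypothesis fx : forall e j r v, f (mx RV e j r v) = mx W e j r (f v).
Hypothesis fphi : forall e j r v, f (mphi RV e j r v) = mphi W e j r (f v).
Hypothesis xout : forall i, i \notin J -> forall e r v, mx V e i r v = 0.

Lemma f_wspace g v : wspace (V := RV) true g v <-> wspace true g (f v).
Proof.
split=> h i; have := h i; first by rewrite -fphi => ->; rewrite linearZ.
by rewrite -fphi -linearZ => /(bij_inj fbij).
Qed.

Lemma f_lspace Psi v : in_r Psi -> lspace (V := RV) Psi v <-> lspace Psi (f v).
Proof.
have it k a p : f (iter p (shiftop (phi_plus RV) k a) v) = iter p (shiftop (phi_plus W) k a) (f v).
  by elim: p => //= p <-; rewrite linearB linearZ /= fphi.
move=> hP; split=> /(lspaceP _ hP)[p hp]; apply/lspaceP => //; exists p => k.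
  by rewrite -it hp linear0.
by apply: (bij_inj fbij); rewrite it hp linear0.
Qed.

(** The phi_i with i outside J commute with those of J, hence preserve the highest weight space for
    J. That space is a line, so the preimage [v0] of [vW] is an eigenvector of all the phi's, and it
    is a highest vector for the whole algebra. *)
Lemma inflation_highest : exists (v0 : V) (c : bool -> I -> int -> F) (Psi0 : {ffun I -> ratfun F}),
  [/\ v0 != 0, generated_by v0, forall i r, mx V true i r v0 = 0,
      forall e i r, mphi V e i r v0 = c e i r *: v0
    & [/\ in_r Psi0, forall i (r : nat), c true i r = ser (Psi0 i) r & res J Psi0 = PsiJ]].
Proof.
have [finv fK Kf] := fbij.
pose v0 : V := finv vW; have fv0 : f v0 = vW by apply: Kf.
have v00 : v0 != 0 by apply: contraNneq vW0 => E; rewrite -fv0 E linear0.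
have gW w : wspace true (varpi PsiJ) w -> exists a, w = a *: vW.
  by move=> h; apply: (lows_top gJ phiW PsiJr cWP (all_lows gJ coverW vW0 xpW phiW genW w) h).
have hphi (ei : bool * I * int) : exists a, mphi V ei.1.1 ei.1.2 ei.2 v0 = a *: v0.
  have [|a E] := gW (f (mphi V ei.1.1 ei.1.2 ei.2 v0)).
    move=> j; have Ev : mphi V true (val j) (lead nu true j) v0 = varpi PsiJ j *: v0.
      apply: (bij_inj fbij); have := fphi true j (lead nu true j) v0; rewrite /= => ->.
      by rewrite fv0 phiW cWP [RHS]linearZ /= fv0 ffunE value0_ser.
    by rewrite -fphi /= phi_comm Ev [mphi _ _ _ _ _]linearZ /= [LHS]linearZ.
  by exists a; apply: (bij_inj fbij); rewrite E linearZ /= fv0.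
have [c' cP'] := choice hphi; pose c e i r := c' (e, i, r).
have phi0 e i r : mphi V e i r v0 = c e i r *: v0 by apply: (cP' (e, i, r)).
have xp0 i r : mx V true i r v0 = 0.
  have [iJ|iJ] := boolP (i \in J); last exact: xout.
  apply: (bij_inj fbij); rewrite -[mx V _ _ _ _]/(mx RV true (Sub i iJ) r v0 : V).
  by rewrite fx fv0 xpW linear0.
have gt : in_t [ffun i => c true i 0].
  by move=> i; rewrite ffunE; apply: (c_lead_neq0 (V := V) (nu := mu) v00 phi0 true).
have gv : wspace true [ffun i => c true i 0] v0.
  by move=> i; rewrite /lead phi0 ffunE.
have [Psi0 Psi0r cE] := eigenvector_lweight gD OV gt gv v00 phi0.
exists v0, c, Psi0; split=> //.
- move=> S SS Sv0 w; rewrite -[w](fK w).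
  apply: (genW (S := fun w => S (finv w))) => //.
  have fi_lin : lin finv.
    by move=> a u v; apply: (bij_inj fbij); rewrite linearP !Kf.
  have fi_x e j r u : finv (mx W e j r u) = mx V e (val j) r (finv u).
    by apply: (bij_inj fbij); rewrite Kf -[mx V _ _ _ _]/(mx RV e j r (finv u) : V) fx Kf.
  have fi_phi e j r u : finv (mphi W e j r u) = mphi V e (val j) r (finv u).
    by apply: (bij_inj fbij); rewrite Kf -[mphi V _ _ _ _]/(mphi RV e j r (finv u) : V) fphi Kf.
  split.
  + by rewrite (lin0 fi_lin); apply: (sm_0 SS).
  + by move=> u v hu hv; rewrite (linD fi_lin); apply: (sm_add SS).
  + by move=> a v hv; rewrite (linZ fi_lin); apply: (sm_scale SS).
  + by move=> e j r v hv; rewrite fi_x; apply: (sm_x SS).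
  + by move=> e j r v hv; rewrite fi_phi; apply: (sm_phi SS).
  + move=> e j v; rewrite fi_phi (_ : lead nu e j = lead mu e (val j)); first exact: (sm_inv SS).
    by rewrite /lead -munu ffunE.
- split=> //; apply/ffunP => j; rewrite ffunE; apply: ser_inj => // r.
  rewrite -cE -cWP; apply/eqP; rewrite -subr_eq0.
  have : (c true (val j) r - cW true j r) *: vW == 0.
    rewrite scalerBl -phiW -fv0 -fphi -[mphi RV true j r v0 : V]/(mphi V true (val j) r v0).
    by rewrite phi0 linearZ /= subrr.
  by rewrite scaler_eq0 (negbTE vW0) orbF.
Qed.

Let coverV k : (exists j : sub J, val j = k) \/ (forall r (v : V), mx V false k r v = 0).
Proof.
have [kJ|kJ] := boolP (k \in J); first by left; exists (Sub k kJ); rewrite SubK.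
by right=> r v; apply: xout.
Qed.

Lemma res_varpi Psi0 : res J Psi0 = PsiJ -> res J (varpi Psi0) = varpi PsiJ.
Proof. by move=> <-; apply/ffunP => j; rewrite !ffunE. Qed.

Lemma inflation_chi : exists f g, [/\ nchi W f, nchi V g & varpi_iota_J D f g].
Proof.
have [v0 [c [Psi0 [v00 gen xp0 phi0 [Psi0r cE resPsi]]]]] := inflation_highest.
have wt := highest_in_P gD coverV v00 xp0 phi0 Psi0r cE gen.
have lt : in_t (varpi Psi0) by apply: varpi_in_t.
have ltJ : in_t (varpi PsiJ) by apply: varpi_in_t.
exists (shift (tinv (varpi PsiJ)) (chi W)), (shift (tinv (varpi Psi0)) (chi V)); split.
- by exists PsiJ => //; apply: W_top.
- by exists Psi0 => //; apply: (highest_top gD coverV v00 xp0 phi0 Psi0r cE OV gen).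
apply/varpi_iota_JE; rewrite /shift !tinvK; split.
- move=> t /(chi_neq0 OW)/W_in_P[m E]; exists m; exact: (tmulI ltJ E).
- move=> t /(chi_neq0 OV)/wt[m E]; exists m; exact: (tmulI lt E).
move=> m; rewrite /chi !asboolT; first 1 last.
- by apply: in_t_rel => //; apply: mono_nroot_in_t.
- by apply: in_t_rel => //; apply: mono_nroot_in_t.
congr Posz; have gt : in_t (tmul (varpi Psi0) (mono (nroot D inJ) m)).
  by apply: in_t_rel => //; apply: mono_nroot_in_t.
have [n hn] := wspace_fd OV gt.
apply/esym/(dim_bij (wspace_subspace V _) (wspace_subspace W _) fbij _ hn) => v.
rewrite -(res_wspace HD q0 qr munu OV lt wt) res_tmul res_varpi // res_mono res_nroot.
exact: f_wspace.
Qed.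

(** Psi_p consists of the components of the highest l-weight outside J. At such a node the
    commutator of x^+ and x^- is 0, so phi^+ and phi^- have the same eigenvalues on [v0]; these
    vanish below 0 and above mu_i, and the one at mu_i is nonzero. *)
Lemma inflation_chiq : exists f g (Psip : {ffun I -> ratfun F}),
  [/\ nchiq W f, iota_J D f g, J_trivial J Psip,
      in_r_deg [ffun i => mu i - ext 0 nu i] Psip
    & chiq V =1 shift (tmul (ext 1 PsiJ) Psip) g].
Proof.
have [v0 [c [Psi0 [v00 gen xp0 phi0 [Psi0r cE resPsi]]]]] := inflation_highest.
have lw := highest_is_lweight gD coverV v00 xp0 phi0 Psi0r cE OV gen.
pose Psip : {ffun I -> ratfun F} := [ffun i => if i \in J then 1 else Psi0 i].
have PsiE : tmul (ext 1 PsiJ) Psip = Psi0.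
  apply/ffunP => i; rewrite !ffunE; have [iJ|iJ] := boolP (i \in J).
    by rewrite insubT /= mulr1 -resPsi ffunE.
  by rewrite insubN // mul1r.
have nz i : Psi0 i != 0 by apply: regular_neq0.
have nzJ j : PsiJ j != 0 by apply: regular_neq0.
exists (shift (tinv PsiJ) (chiq W)), (shift (tinv Psi0) (chiq V)), Psip; split.
- by exists PsiJ => //; apply: W_top.
- apply/iota_JE; rewrite /shift !tinvK; split.
  + move=> t /(chiq_neq0 OW)/W_is_lweight[m E]; exists m; exact: (tmulI nzJ E).
  + move=> t /(chiq_neq0 OV)/lw[m E]; exists m; exact: (tmulI nz E).
  move=> m; have r1 : in_r (tmul PsiJ (mono (Aroot DJ id) m)) by apply: Psi0_mono_in_r.
  have r2 : in_r (tmul Psi0 (mono (Aroot D inJ) m)) by apply: Psi0_mono_in_r.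
  rewrite /chiq !asboolT //; congr Posz.
  have [n hn] := lspace_fd OV r2.
  apply/esym/(dim_bij (lspace_subspace V r2) (lspace_subspace W r1) fbij _ hn) => v.
  rewrite -(res_lspace HD q0 qr munu OV Psi0r lw) res_tmul resPsi res_mono res_Aroot.
  exact: f_lspace.
- by move=> j jJ; rewrite ffunE jJ.
- split=> i; rewrite !ffunE.
    by case: ifP => _; [exact: regular1|exact: Psi0r].
  have [iJ|iJ] := boolP (i \in J).
    rewrite insubT /= -munu ffunE /= subrr; exists 1, 1.
    by rewrite oner_neq0 divr1 subrr; split=> //; rewrite rmorph1.
  rewrite insubN //= subr0.
  have cpm r : c true i r = c false i r.
    apply/eqP; rewrite -subr_eq0; have := x_comm i i r 0 v0.
    rewrite eqxx !(xout iJ) subr0 scaler0 addr0 !phi0 -scalerBl => /esym/eqP.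
    by rewrite scaler_eq0 (negbTE v00) orbF.
  have zero e k : (forall w : V, mphi V e i k w = 0) -> c e i k = 0.
    by move=> /(_ v0)/eqP; rewrite phi0 scaler_eq0 (negbTE v00) orbF => /eqP.
  have cp k : k < 0 -> c true i k = 0 by move=> hk; apply: zero => w; apply: phi_neg0.
  have cm k : mu i < k -> c true i k = 0.
    by move=> hk; rewrite cpm; apply: zero => w; apply: phi_pos0.
  have c00 : c true i 0 != 0 by exact: (c_lead_neq0 (V := V) v00 phi0 true).
  have cmu : c true i (mu i) != 0 by rewrite cpm; exact: (c_lead_neq0 (V := V) v00 phi0 false).
  (* The coefficient at 0 is nonzero while those above mu_i vanish, so mu_i >= 0. *)
  have [M muE] : exists M : nat, mu i = M%:Z.
    have : ~~ (mu i < 0) by apply: contra c00 => h; apply/eqP/cm.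
    by case: (mu i) => // M _; exists M.
  pose p := \poly_(k < M.+1) c true i k%:Z.
  have pE : c true i =1 coefz p.
    move=> [k|k] /=; last by apply: cp.
    by rewrite coef_poly; case: ltnP => // h; apply: cm; rewrite muE; lia.
  have sp : size p = M.+1 by apply: size_poly_eq; rewrite -muE.
  exists p, 1; rewrite sp oner_neq0 size_poly1 muE; split=> //.
  + by rewrite -size_poly_eq0 sp.
  + have h : expansion true (FracField.tofrac p / FracField.tofrac 1) (c true i).
      apply/expansionP; split; first by exists 0.
      exists p, 1; rewrite oner_neq0; split=> // k; rewrite -[1]/(1%:P) actC mul1r.
      exact: pE.
    apply/esym/(expansion_inj h).
    suff -> : c true i = ser (Psi0 i) by apply: serP.
    by apply/funext => -[k|k]; [exact: cE|rewrite cp // ser_neg].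
  + by lia.
- move=> t; rewrite PsiE /shift tinvK tmulKV //.
Qed.

End Inflation.

(** * From the character formulas to inflations *)

Lemma chi_inflation (f : {ffun sub J -> F} -> int) g : nchi V g -> varpi_iota_J D f g ->
  forall i, i \notin J -> forall e r v, mx V e i r v = 0.
Proof.
move=> [Psi [[[Psir _] _] _] gE] /varpi_iota_JE[_ gsupp _] i iJ e r v.
have lt : in_t (varpi Psi) by exact: varpi_in_t Psir.
have wt g' : in_P V true g' -> exists m, g' = tmul (varpi Psi) (mono (nroot D inJ) m).
  move=> /(chi_neq0 OV) h; have [|m mE] := gsupp (tmul (tinv (varpi Psi)) g').
    by rewrite gE /shift tinvK tmulKV.
  by exists m; rewrite -mE tmulKV.
exact: (x_outside HD q0 qr OV lt wt).
Qed.

Section Converse.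
Hypothesis simpleW : simple_module W.
Variables (f : {ffun sub J -> ratfun F} -> int) (g : {ffun I -> ratfun F} -> int).
Variable Psip : {ffun I -> ratfun F}.
Hypothesis fW : nchiq W f.
Hypothesis fg : iota_J D f g.
Hypothesis Psip_trivial : J_trivial J Psip.
Hypothesis Psipr : in_r Psip.
Hypothesis gV : chiq V =1 shift (tmul (ext 1 PsiJ) Psip) g.

Local Notation Psi0 := (tmul (ext 1 PsiJ) Psip).
Local Notation lam := (varpi Psi0).

Lemma Psi0r : in_r Psi0.
Proof.
apply: in_r_tmul => // i; rewrite ffunE; case: insubP => [j _ _|_] /=.
  exact: PsiJr.
exact: regular1.
Qed.

Lemma res_Psi0 : res J Psi0 = PsiJ.
Proof.
by apply/ffunP => j; rewrite !ffunE valK /= Psip_trivial ?mulr1 //; apply: valP.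
Qed.

Let Psi0_neq0 i : Psi0 i != 0.
Proof. by apply: regular_neq0; apply: Psi0r. Qed.

Let lam_in_t : in_t lam.
Proof. by apply: varpi_in_t; apply: Psi0r. Qed.

Lemma V_is_lweight Psi : is_lweight V Psi ->
  exists mm : seq (sub J * {a : F | a != 0}), Psi = tmul Psi0 (mono (Aroot D inJ) mm).
Proof.
move=> /(chiq_neq0 OV); rewrite gV /shift => h.
have /iota_JE[_ gs _] := fg; have [mm E] := gs _ h.
by exists mm; rewrite -E tmulKV.
Qed.

Lemma chiq_eq mm : chiq V (tmul Psi0 (mono (Aroot D inJ) mm))
  = chiq W (tmul PsiJ (mono (Aroot DJ id) mm)).
Proof.
(* [fW] normalizes by some top l-weight of [W]; uniqueness identifies it with [PsiJ]. *)
have [Psi [_ Psi_max] fE] := fW; have [WP _] := W_top.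
rewrite gV /shift tmulVK //; have /iota_JE[_ _ <-] := fg.
by rewrite fE /shift tinvK -(Psi_max _ WP).
Qed.

Lemma V_in_P g' : in_P V true g' ->
  exists m : seq (sub J), g' = tmul lam (mono (nroot D inJ) m).
Proof.
move/(in_P_lweight gD OV) => [Psi /V_is_lweight[mm ->] <-].
by exists [seq x.1 | x <- mm]; rewrite varpi_mono_Aroot //; apply: Psi0r.
Qed.

Lemma V_x_outside i : i \notin J -> forall e r v, mx V e i r v = 0.
Proof. by move=> iJ e r v; exact: (x_outside HD q0 qr OV lam_in_t V_in_P). Qed.

Lemma V_lspace mm (v : V) :
  lspace (V := RV) (tmul PsiJ (mono (Aroot DJ id) mm)) v
  <-> lspace (tmul Psi0 (mono (Aroot D inJ) mm)) v.
Proof.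
rewrite -(res_lspace HD q0 qr munu OV Psi0r V_is_lweight).
by rewrite res_tmul res_Psi0 res_mono res_Aroot.
Qed.

Lemma V_wspace m (v : V) :
  wspace (V := RV) true (tmul (varpi PsiJ) (mono (nroot DJ id) m)) v
  <-> wspace true (tmul lam (mono (nroot D inJ) m)) v.
Proof.
rewrite -(res_wspace HD q0 qr munu OV lam_in_t V_in_P).
by rewrite res_tmul res_varpi ?res_Psi0 // res_mono res_nroot.
Qed.

(** The space of l-weight Psi_0 has dimension 1 like that of Psi^J in [W], and all phi's preserve
    it. A nonzero x_j^+ v1 would have weight lambda + alpha_j, outside lambda - Q_J^+. The phi^- act
    as on [vW] because phi^+ determines phi^- by rationality. *)
Lemma V_highest : exists v1 : V,
  [/\ v1 != 0, forall j r, mx RV true j r v1 = 0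
    & forall e j r, mphi RV e j r v1 = cW e j r *: v1].
Proof.
have hP := Psi0r.
have d1 : dim (@lspace _ _ _ _ V Psi0) = 1%N.
  have := chiq_eq [::]; rewrite !tmul_mono0 W_chiq /chiq asboolT //.
  by move=> [].
have [n hn] := lspace_fd OV hP; have E := dimE (lspace_subspace V hP) hn.
rewrite d1 in E; rewrite -E in hn; case: hn => b [b1 b2 b3].
pose v1 := b ord0; have lv1 : lspace Psi0 v1 := b1 ord0.
have v10 : v1 != 0.
  apply/eqP => h; have := b2 (fun _ => 1); rewrite big_ord1 -/v1 h scaler0 => /(_ erefl ord0)/eqP.
  by rewrite oner_eq0.
have span v : lspace Psi0 v -> exists a, v = a *: v1.
  by move=> /b3[a ->]; exists (a ord0); rewrite big_ord1.
have hphi (ei : bool * I * int) : exists a, mphi V ei.1.1 ei.1.2 ei.2 v1 = a *: v1.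
  apply: span; apply/lspaceP => //; apply: jgen_comm; first exact: linear_lin.
    by move=> k w; apply: phi_comm.
  exact/lspaceP.
have [c' cP'] := choice hphi; pose c e i r := c' (e, i, r).
have phi1 e i r : mphi V e i r v1 = c e i r *: v1 by apply: (cP' (e, i, r)).
have gv1 : wspace true lam v1 by apply: lspace_wspace.
have cE i (r : nat) : c true i r = ser (Psi0 i) r.
  have hj := (lspaceP v1 hP).1 lv1.
  have h := jgen_eigenvalue v10 hj (c := fun k : I * nat => c true k.1 k.2%:Z) (fun k => phi1 _ _ _).
  by have := congr1 (fun h : I * nat -> F => h (i, r)) h.
exists v1; split=> //.
  move=> j r; apply/eqP; apply: contraT => xv.
  have [|m E'] := V_in_P (g' := tmul lam (rootw D (fun k => sg true * (k == val j)%:Z))).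
    split; first by apply: in_t_rel => //; apply: rootw_in_t.
    by exists (mx V true (val j) r v1) => //; apply: wspace_x.
  move/(tmulI lam_in_t): E' => E'.
  have : tmul (mono (nroot D inJ) [::]) (rootw D (fun k => sg true * (k == val j)%:Z)) = mono (nroot D inJ) m.
    by rewrite -E' tmulC tmul_mono0.
  by move/(mono_nroot_shift gD) => /=; lia.
have czero (M : qmodule DJ nu) (w : M) (d : bool -> sub J -> int -> F) : w != 0 ->
    (forall e j r, mphi M e j r w = d e j r *: w) ->
    (forall j k, k < 0 -> d true j k = 0) /\ (forall j k, nu j < k -> d false j k = 0).
  move=> w0 hd; have z e j k : (forall w : M, mphi M e j k w = 0) -> d e j k = 0.
    by move=> /(_ w)/eqP; rewrite hd scaler_eq0 (negbTE w0) orbF => /eqP.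
  by split=> j k hk; apply: z => u; [apply: phi_neg0|apply: phi_pos0].
pose cV e (j : sub J) r := c e (val j) r.
have phi1J e j r : mphi RV e j r v1 = cV e j r *: (v1 : RV) by apply: phi1.
have [zp zm] := czero RV v1 cV v10 phi1J.
have [zpW zmW] := czero W vW cW vW0 phiW.
have cT j r : cV true j r = cW true j r.
  case: r => r; last by rewrite zp // zpW.
  rewrite /cV cE cWP.
  have <- : res J Psi0 j = PsiJ j by rewrite res_Psi0.
  by rewrite [res _ _ _]ffunE.
have vWg : wspace true (varpi PsiJ) vW by apply: (v0_weight phiW PsiJr cWP).
move=> e j r; case: e; first by rewrite phi1J cT.
have [q qn0 hq] := phi_rational gD OV (val j) lam_in_t gv1 v10 phi1.
have [q' q'n0 hq'] := phi_rational gJ OW j (varpi_in_t PsiJr) vWg vW0 phiW.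
rewrite phi1J; congr (_ *: _).
apply: (phi_minus_uniq (d := cW true j) qn0 q'n0 _ hq' (zm j) (zmW j)).
by move=> k; rewrite -(act_ext _ (cT j)) hq.
Qed.

(** * The submodule generated by (v1, w) as a graph *)

Section Graph.
Variable v1 : V.
Hypothesis v10 : v1 != 0.
Hypothesis xp1 : forall j r, mx RV true j r v1 = 0.
Hypothesis phi1 : forall e j r, mphi RV e j r v1 = cW e j r *: v1.

Let P := sum_mod RV W.
Let n0 : P := (v1 : RV, vW).
Local Notation graph := (lows (id : sub J -> sub J) n0).

Let n00 : n0 != 0.
Proof. by apply: contraNneq v10 => -[->]. Qed.

Let xpP j r : mx P true j r n0 = 0.
Proof. by apply: injective_projections; [apply: xp1|apply: xpW]. Qed.

Let phiP e j r : mphi P e j r n0 = cW e j r *: n0.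
Proof. by apply: injective_projections; [apply: phi1|apply: phiW]. Qed.

Let coverP (k : sub J) : (exists j : sub J, id j = k) \/ (forall r v, mx P false k r v = 0).
Proof. by left; exists k. Qed.

Let graph_submod : submodule graph.
Proof. exact: (lows_submodule gJ coverP n00 xpP phiP). Qed.

Let graph_subspace : subspace graph := lows_subspace _ _.

(** Instead of placing the direct sum in category O, each span is enclosed in the product of a
    weight space of [V] and one of [W]; [V_wspace] passes from weights for J to weights of [V]. *)
Let graph_fd m : exists n, has_dim (low (id : sub J -> sub J) n0 m) n.
Proof.
have gt : in_t (tmul (varpi PsiJ) (mono (nroot DJ id) m)).
  by apply: in_t_rel; [exact: varpi_in_t|apply: mono_nroot_in_t].
have gtV : in_t (tmul lam (mono (nroot D inJ) m)).
  by apply: in_t_rel => //; apply: mono_nroot_in_t.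
have [n hn] := wspace_fd OV gtV; have [n' hn'] := wspace_fd OW gt.
have [p hp] := has_dim_prod (wspace_subspace V _) (wspace_subspace W _) hn hn'.
pose Q (x : P) := wspace true (tmul lam (mono (nroot D inJ) m)) (x.1 : V)
  /\ wspace true (tmul (varpi PsiJ) (mono (nroot DJ id) m)) x.2.
have hQ : subspace Q.
  split=> [|a b [? ?] [? ?]|a b [? ?]]; split.
  - exact: subspace0 (wspace_subspace V _).
  - exact: subspace0 (wspace_subspace W _).
  - exact: (subspaceD (wspace_subspace V _)).
  - exact: (subspaceD (wspace_subspace W _)).
  - exact: (subspaceZ (wspace_subspace V _)).
  - exact: (subspaceZ (wspace_subspace W _)).
apply: (@has_dim_sub F P Q _ p (low_subspace _ _ m) _ hQ hp) => -[u w] h.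
by have /sum_wspace[/V_wspace hu hw] := low_weight phiP PsiJr cWP h.
Qed.

Let inrJ mm : in_r (tmul PsiJ (mono (Aroot DJ id) mm)).
Proof. exact: Psi0_mono_in_r. Qed.

Let R (n : P) := graph n /\ exists mm, lspace (tmul PsiJ (mono (Aroot DJ id) mm)) n.

Let R_jgen n : R n -> exists th, jgen (phi_plus P) th n.
Proof.
move=> [_ [mm h]]; exists (theta (tmul PsiJ (mono (Aroot DJ id) mm))).
exact/lspaceP.
Qed.

Let graph_sums n : graph n -> sums R n.
Proof.
elim=> [|u u' [m hm] _ IH]; first exact: sums0.
apply: sumsD IH; have := low_lspaces gJ n00 phiP PsiJr cWP graph_fd hm.
by apply: sums_mono => z [hz lz]; split=> //; apply: sums1; exists m.
Qed.

(** The [w] with (0, w) in the graph form a submodule of [W]. It is not all of [W]: (0, vW) has the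
    highest weight, so it would be a multiple of (v1, vW). *)
Lemma graph_zero_l (w : W) : graph ((0 : RV), w) -> w = 0.
Proof.
have [_ simp] := simpleW.
have [|h|h] := simp (fun w => graph ((0 : RV), w)); last 2 first.
- exact: h.
- have vWg : wspace (V := P) true (varpi PsiJ) ((0 : RV), vW).
    apply/sum_wspace; split; last exact: (v0_weight phiW PsiJr cWP).
    exact: subspace0 (wspace_subspace RV _).
  have [a [/esym/eqP E1 E2]] := lows_top gJ phiP PsiJr cWP (h vW) vWg.
  move: E1; rewrite scaler_eq0 (negbTE v10) orbF => /eqP a0.
  by case/eqP: vW0; rewrite E2 a0 scale0r.
have pE (u u' : RV) (w1 w2 : W) : u = u' -> w1 = w2 -> ((u, w1) : P) = (u', w2) by move=> -> ->.
split.
- exact: subspace0 graph_subspace.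
- move=> u v hu hv; have := subspaceD graph_subspace hu hv.
  by congr graph; apply: pE => //; rewrite addr0.
- move=> a v hv; have := subspaceZ graph_subspace a hv.
  by congr graph; apply: pE => //; rewrite scaler0.
- move=> e j r v hv; have := sm_x graph_submod e j r hv.
  by congr graph; apply: pE => //; rewrite linear0.
- move=> e j r v hv; have := sm_phi graph_submod e j r hv.
  by congr graph; apply: pE => //; rewrite linear0.
- move=> e j v hv; apply: (sm_inv graph_submod (e := e) (i := j)).
  by move: hv; congr graph; apply: pE => //; rewrite linear0.
Qed.

Lemma graph_surj (w : W) : exists u : RV, graph (u, w).
Proof.
apply: (genW (S := fun w => exists u : RV, graph (u, w))); last first.
  by exists v1; apply: v0_lows.
split.
- by exists 0; apply: subspace0 graph_subspace.
- by move=> a b [u hu] [u' hu']; exists (u + u'); apply: (subspaceD graph_subspace hu hu').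
- by move=> a b [u hu]; exists (a *: u); apply: (subspaceZ graph_subspace a hu).
- by move=> e j r v [u hu]; exists (mx RV e j r u); apply: (sm_x graph_submod e j r hu).
- by move=> e j r v [u hu]; exists (mphi RV e j r u); apply: (sm_phi graph_submod e j r hu).
- move=> e j v [u hu]; have [h _ Kh] := rel_phi_inv (mrel RV) e j.
  by exists (h u); apply: (sm_inv graph_submod (e := e) (i := j)); rewrite /= Kh.
Qed.

Let snd_sums th (n : P) : sums (fun n => R n /\ exists2 th', th' <> th & jgen (phi_plus P) th' n) n ->
  jgen (phi_plus W) th n.2 -> n.2 = 0.
Proof.
move=> hn hj; apply: (jgen_disjoint (@phi_plus_comm _ _ _ _ W) _ hj).
elim: hn {hj} => [|[u w] n' [_ [th' ne /sum_jgen[_ hw]]] _ IH]; first exact: sums0.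
by apply: sumsS => //; exists th'.
Qed.

(** Any point of the graph over [w] is split into generalized eigenvectors; the components of other
    l-weight have second coordinates adding up to 0, so the remaining part still lies over [w]. *)
Lemma graph_lift mm (w : W) : lspace (tmul PsiJ (mono (Aroot DJ id) mm)) w ->
  exists2 u : RV, graph (u, w) & lspace (tmul PsiJ (mono (Aroot DJ id) mm)) u.
Proof.
move=> /(lspaceP _ (inrJ mm)) hw; have [u hu] := graph_surj w.
have [n1 [n2 [E h1 h2]]] := sums_split (theta (tmul PsiJ (mono (Aroot DJ id) mm))) R_jgen (graph_sums hu).
set th := theta _ in hw h1 h2.
have g1 : jgen (phi_plus P) th n1 by apply: (sums_min (jgen_subspace _ _) _ h1) => v [].
case: n1 E h1 g1 => u1 w1 E h1 /sum_jgen[ju1 jw1].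
have wE : w = w1 + n2.2 by have := congr1 (fun n : P => n.2) E.
have n20 : n2.2 = 0.
  apply: (snd_sums h2); have -> : n2.2 = w - w1 by rewrite wE addrC addKr.
  exact: (subspaceB (jgen_subspace _ _)).
exists u1; last by apply/(lspaceP _ (inrJ mm)).
have -> : w = w1 by rewrite wE n20 addr0.
by apply: (sums_min graph_subspace _ h1) => v [[]].
Qed.

(** Lifts of a basis of the l-weight space of [W] are independent in [V] by [graph_zero_l]; since
    the dimensions agree, they form a basis of the l-weight space of [V]. *)
Lemma graph_lspace mm (u : V) : lspace (tmul Psi0 (mono (Aroot D inJ) mm)) u ->
  exists2 w : W, graph (u : RV, w) & w = 0 -> u = 0.
Proof.
move=> hu; set PJ := tmul PsiJ (mono (Aroot DJ id) mm).
have r1 : in_r (tmul Psi0 (mono (Aroot D inJ) mm)).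
  by have hP := Psi0r; apply: Psi0_mono_in_r.
have [d hd] := lspace_fd OW (inrJ mm); have [d' hd'] := lspace_fd OV r1.
have hsW := lspace_subspace W (inrJ mm); have hsV := lspace_subspace V r1.
have dd : d' = d.
  by have := chiq_eq mm; rewrite /chiq !asboolT // (dimE hsW hd) (dimE hsV hd') => -[].
rewrite dd in hd'; have /(has_dimP _ hsW)[b hb] := hd.
have bin i : lspace PJ (b i).
  rewrite -[b i](_ : vec b (delta_mx 0 i) = _); first exact: basis_in hb _.
  rewrite /vec (bigD1 i) //= big1 ?addr0 ?mxE ?eqxx ?scale1r // => j /negbTE ij.
  by rewrite mxE ij andbF scale0r.
have lift i : exists u : RV, graph (u, b i) /\ lspace PJ u.
  by have [x h1 h2] := graph_lift (bin i); exists x.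
have [c cP] := choice lift.
have gc y : graph ((vec (c : 'I_d -> V) y : RV), vec b y).
  have -> : ((vec (c : 'I_d -> V) y : RV), vec b y) = \sum_i y 0 i *: ((c i, b i) : P).
    rewrite /vec -(pair_sum _ (fun i => y 0 i *: c i) (fun i => y 0 i *: b i)).
    by [].
  by apply: subspace_sum => // i; apply: subspaceZ => //; case: (cP i).
have cinj y : vec (c : 'I_d -> V) y = 0 -> y = 0.
  move=> y0; have := gc y; rewrite y0 => /graph_zero_l; exact: (basis_inj hb).
have cV i : lspace (tmul Psi0 (mono (Aroot D inJ) mm)) (c i : V).
  by apply/V_lspace; case: (cP i).
have [y uE] := independent_span hsV hd' cV cinj hu.
exists (vec b y); first by rewrite uE.
by move/(basis_inj hb) => y0; rewrite uE y0 vec0.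
Qed.

Lemma graph_total (u : V) : exists w : W, graph (u : RV, w).
Proof.
have := sums_lspace gD OV u; elim=> [|x y [Psi hP hx] _ [w hw]].
  by exists 0; apply: subspace0 graph_subspace.
have [->|x0] := eqVneq x 0; first by exists w; rewrite add0r.
have [|mm E] := V_is_lweight (Psi := Psi); first by split=> //; exists x.
rewrite E in hx; have [w' hw' _] := graph_lspace hx.
by exists (w' + w); apply: (subspaceD graph_subspace hw' hw).
Qed.

(** A nonzero l-weight component (u1, w1) of (u, 0) has w1 = 0. As u1 has an l-weight of [V], it
    also lies in the graph over some [w] which is zero only if u1 is; subtraction gives (0, w) in
    the graph, so w = 0 and u1 = 0. *)
Lemma graph_zero_r (u : V) : graph (u : RV, (0 : W)) -> u = 0.
Proof.
move=> hu; apply/eqP; apply: contraT => u0.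
have n0' : ((u : RV, (0 : W)) : P) != 0 by apply: contraNneq u0 => -[->].
have [th [n1 [n2 [E n10 h1 h2]]]] := sums_component R_jgen (graph_sums hu) n0'.
have g1 : jgen (phi_plus P) th n1 by apply: (sums_min (jgen_subspace _ _) _ h1) => v [].
have gr1 : graph n1 by apply: (sums_min graph_subspace _ h1) => v [[]].
have [mm thE] : exists mm, th = theta (tmul PsiJ (mono (Aroot DJ id) mm)).
  apply: contrapT => no; case/negP: n10; apply/eqP.
  elim: h1 => // x y [[_ [mm hx]] jx] _ ->; rewrite addr0; apply/eqP.
  apply: contraT => x0; case: no; exists mm.
  exact: (jgen_inj x0 jx ((lspaceP x (inrJ mm)).1 hx)).
case: n1 E n10 h1 g1 gr1 => u1 w1 E n10 h1 /sum_jgen[ju1 jw1] gr1.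
have wE : 0 = w1 + n2.2 by have := congr1 (fun n : P => n.2) E.
have n2E : n2.2 = - w1 by apply/eqP; rewrite -addr_eq0 addrC -wE.
have n20 : n2.2 = 0.
  by apply: (snd_sums h2); rewrite n2E; apply: (subspaceN (jgen_subspace _ _)).
have w10 : w1 = 0 by apply/eqP; rewrite -oppr_eq0 -n2E n20.
have /V_lspace lu1 : lspace (V := RV) (tmul PsiJ (mono (Aroot DJ id) mm)) u1.
  by apply/(lspaceP _ (inrJ mm)); rewrite -thE.
have [w hw wu] := graph_lspace lu1.
have : graph ((0 : RV), w).
  have := subspaceB graph_subspace hw gr1; rewrite w10.
  by congr graph; apply: injective_projections; rewrite /= ?subrr ?subr0.
by move/graph_zero_l/wu => u10; rewrite w10 u10 eqxx in n10.
Qed.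

Lemma graph_iso : mod_iso RV W.
Proof.
have [h hP] := choice graph_total.
have uniq (u : V) (w : W) : graph (u : RV, w) -> h u = w.
  move=> hu; apply/subr0_eq/graph_zero_l.
  have := subspaceB graph_subspace (hP u) hu.
  by congr graph; apply: injective_projections; rewrite /= ?subrr.
have linh : lin (h : RV -> W).
  move=> a u v; apply: uniq.
  exact: (subspaceD graph_subspace (subspaceZ graph_subspace a (hP u)) (hP v)).
exists (pack_linear linh); split.
- have [k kP] := choice graph_surj.
  exists k => [u|w] /=; last by apply: uniq.
  apply/subr0_eq/graph_zero_r.
  have := subspaceB graph_subspace (kP (h u)) (hP u).
  by congr graph; apply: injective_projections; rewrite /= ?subrr.
- by move=> e j r v; apply: uniq; apply: (sm_x graph_submod e j r (hP v)).
- by move=> e j r v; apply: uniq; apply: (sm_phi graph_submod e j r (hP v)).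
Qed.

End Graph.

Lemma chiq_inflation : is_inflation munu V W.
Proof.
have [v1 [v10 xp1 phi1]] := V_highest; split=> //.
  exact: graph_iso v10 xp1 phi1.
exact: V_x_outside.
Qed.

End Converse.
End Main.

Theorem theorem3p14 (R : realType) (n : nat) (D : datum R[i] 'I_n)
  (HD : simple_datum D) (hq0 : qpar D != 0) (hq : not_root_of_unity (qpar D))
  (J : {set 'I_n}) (nu : {ffun sub J -> int})
  (PsiJ : {ffun sub J -> ratfun R[i]}) (HPsiJ : in_r PsiJ)
  (W : qmodule (resD J D) nu) (HW : highest_lweight W PsiJ)
  (mu : {ffun 'I_n -> int}) (munu : res J mu = nu)
  (V : qmodule D mu) (HV : in_O V) :
  (mod_iso (res_mod munu V) W ->
     (is_inflation munu V W <->
      exists f g, [/\ nchi W f, nchi V g & varpi_iota_J D f g])) /\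
  (simple_module W ->
     (is_inflation munu V W <->
      exists f g (Psip : {ffun 'I_n -> ratfun R[i]}),
        [/\ nchiq W f, iota_J D f g, J_trivial J Psip,
            in_r_deg [ffun i => mu i - ext 0 nu i] Psip
          & chiq V =1 shift (tmul (ext 1 PsiJ) Psip) g])).
Proof.
have [OW [vW [vW0 genW xpW expW]]] := HW.
have [cW cWp] := choice (fun ej : bool * sub J =>
  let: ex_intro2 c cx cphi := expW ej.1 ej.2 in ex_intro _ c (conj cx cphi)).
pose c e j := cW (e, j).
have phiW e j r : mphi W e j r vW = c e j r *: vW by apply: (cWp (e, j)).2.
have cWP j (r : nat) : c true j r = ser (PsiJ j) r by apply: ser_uniq (cWp (true, j)).1 _.
split=> [iso|simpW]; split.
- move=> [_ _ _ xout]; have [f [fbij fx fphi]] := iso.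
  exact: (inflation_chi HD hq0 hq HPsiJ OW vW0 genW xpW phiW cWP HV fbij fx fphi xout).
- move=> [f [g [_ gV fg]]]; split=> // i iJ.
  exact: (chi_inflation HD hq0 hq HV gV fg iJ).
- move=> [_ _ [f [fbij fx fphi]] xout].
  exact: (inflation_chiq HD hq0 hq HPsiJ OW vW0 genW xpW phiW cWP HV fbij fx fphi xout).
- move=> [f [g [Psip [fW fg triv [Psipr _] gV]]]].
  exact: (chiq_inflation HD hq0 hq munu HPsiJ OW vW0 genW xpW phiW cWP HV simpW fW fg triv Psipr gV).
Qed.
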